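(* Let $d\ge 1$ and $\ell>1$ be integers, let $\xi_1,\xi_2,\dots$ be i.i.d. real-valued random variables, let $F:\mathbb{R}^\ell\to SL_d(\mathbb{R})$ be a Borel measurable map, and let $q_1<q_2<\dots<q_\ell$ (pointwise on the positive integers) be strictly increasing functions from the positive integers to the nonnegative integers with $q_1(1)\ge 1$. For $n\ge 1$ set $$X_n=F(\xi_{q_1(n)},\xi_{q_2(n)},\dots,\xi_{q_\ell(n)}),\qquad \Pi_N=X_N\cdots X_2X_1 .$$ All $X_n$ have the same distribution; denote it by $\mu$ and let $G_\mu\subset SL_d(\mathbb{R})$ be the support of $\mu$. Assume: (i) $G_\mu$ is strongly irreducible, i.e. there is no finite (nonempty) union of proper nonzero linear subspaces of $\mathbb{R}^d$ that is preserved as a set by all matrices from $G_\mu$; (ii) $E\|X_1\|^\alpha<\infty$ for some $\alpha>0$; (iii) for every $\sigma>0$ there exists $n_0(\sigma)$ such that for all $n\ge n_0(\sigma)$, $$q_{i+1}(n)\ \ge\ q_i\big(n+[\sigma\ln n]\big),\qquad i=1,\dots,\ell-1 .$$ Let $Y_1,Y_2,\dots$ be an i.i.d. sequence of random matrices with distribution $\mu$, and let $\gamma_1,\dots,\gamma_d$ be the constants given by the almost sure limits $$\gamma_i=\lim_{N\to\infty}\frac1N\ln s_i(Y_N\cdots Y_2Y_1),\qquad i=1,\dots,d .$$ Then, with probability one, $$\lim_{N\to\infty}\frac1N\ln s_i(\Pi_N)=\gamma_i,\qquad i=1,\dots,d .$$ In particular, with probability one, $\lim_{N\to\infty}\fr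ac1N\ln\|\Pi_N\|=\gamma_1$.
   Context: For a real $d\times d$ matrix $g$, $s_1(g)\ge s_2(g)\ge\dots\ge s_d(g)\ge 0$ denote its singular values, i.e. the square roots of the eigenvalues of $g^*g$; $\|g\|=s_1(g)=\max_{x\ne 0}\|gx\|/\|x\|$ is the Euclidean operator norm. $[\,\cdot\,]$ denotes the integer part. Under assumptions (i) and (ii) it is a known fact that the almost sure limits $\gamma_i$ for the i.i.d. product $Y_N\cdots Y_1$ exist and are non-random (they are the Lyapunov exponents of $\mu$). *)

(* Defs.v *)
From HB Require Import structures.
From mathcomp Require Import all_boot all_order all_algebra.
From mathcomp Require Import finmap.
From mathcomp Require Import all_classical all_reals all_analysis.

Set Implicit Arguments.
Unset Strict Implicit.
Unset Printing Implicit Defensive.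
Import Order.TTheory GRing.Theory Num.Theory.
Import numFieldNormedType.Exports.
Local Open Scope classical_set_scope.
Local Open Scope ring_scope.

Notation borel T := (g_sigma_algebraType (@open T)).

Definition enorm (R : realType) (d : nat) (x : 'cV[R]_d) : R :=
  Num.sqrt (\sum_(i < d) x i 0 ^+ 2).

Definition opnorm (R : realType) (d : nat) (g : 'M[R]_d) : R :=
  sup [set r | exists2 x : 'cV[R]_d, x != 0 & r = enorm (g *m x) / enorm x].

(* Eigenvalues repeated according to their multiplicity as roots of the
   characteristic polynomial, in decreasing order. Such a list is unique, and
   it exists for every symmetric matrix; [::] is a junk value for the others. *)
Definition eigenvalues (R : realType) (d : nat) (A : 'M[R]_d) : seq R :=
  xget [::] [set s : seq R | sorted >=%R s /\
                             char_poly A = \prod_(a <- s) ('X - a%:P)].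

(* Indices start at 0: the largest singular value is the one of index 0. *)
Definition singular_value (R : realType) (d : nat) (g : 'M[R]_d) (i : 'I_d) : R :=
  Num.sqrt (nth 0 (eigenvalues (g^T *m g)) i).

(* lprod X N = X N *m ... *m X 2 *m X 1; the value X 0 is not used. *)
Fixpoint lprod (R : realType) (d : nat) (X : nat -> 'M[R]_d) (N : nat) : 'M[R]_d :=
  if N is N'.+1 then X N *m lprod X N' else 1%:M.

Definition independent_family d d' (T : measurableType d) (T' : measurableType d')
    (R : realType) (P : probability T R) (X : nat -> {RV P >-> T'}) : Prop :=
  forall (J : {fset nat}) (A : nat -> set T'),
    (forall j, j \in J -> measurable (A j)) ->
    P (\bigcap_(j in [set` J]) (X j @^-1` A j)) =
    (\prod_(j <- J) P (X j @^-1` A j))%E.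

Definition iid d d' (T : measurableType d) (T' : measurableType d')
    (R : realType) (P : probability T R) (X : nat -> {RV P >-> T'}) : Prop :=
  independent_family X /\
  forall m n (A : set T'), measurable A ->
    distribution P (X m) A = distribution P (X n) A.

Definition msupport (R : realType) (T : ptopologicalType)
    (mu : set (borel T) -> \bar R) : set T :=
  [set x | forall U : set T, open U -> U x -> (0 < mu U)%E].

Definition subspaces_union (R : realType) (d : nat)
    (L : seq {vspace 'cV[R]_d}) : set 'cV[R]_d :=
  [set x | exists2 V, V \in L & x \in V].

Definition strongly_irreducible (R : realType) (d : nat)
    (G : set 'M[R]_d) : Prop :=
  ~ exists L : seq {vspace 'cV[R]_d},
      [/\ L != [::],
          forall V, V \in L -> V != 0%VS /\ V != fullv &
          forall g, G g ->
            [set g *m x | x in subspaces_union L] = subspaces_union L].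

Definition nonconventional (R : realType) (T : Type) (d l : nat)
    (F : 'rV[R]_l -> 'M[R]_d) (q : 'I_l -> nat -> nat) (xi : nat -> T -> R)
    (n : nat) (w : T) : 'M[R]_d :=
  F (\row_(i < l) xi (q i n) w).

(* Main.v *)
(* The laws of the products Y_n ... Y_1 form a convolution semigroup.  For such
   a semigroup and two rates theta < theta', either the negative moments satisfy
   E |S_n|^-delta <= C exp (- delta theta n), or the positive ones satisfy
   E |S_n|^delta <= C exp (delta theta' n).  In the irreducible case this holds
   because, when the negative moments of |v S_n| fail to decay, some vector v
   grows slowly on average, and irreducibility spreads its slow growth to the
   whole norm; a common invariant subspace is removed by induction on the
   dimension.  Applied to the exterior powers of the Y_n, together with the
   almost sure limits, this gives exponential concentration of the norms of all
   exterior powers, without any irreducibility hypothesis.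

   Cut X_1, ..., X_N into blocks of length about c ln N, leaving out a prefix of
   length about sqrt N.  The spreading of the q_i makes the factors of a window of
   logarithmic length independent, so by concentration and Borel-Cantelli all
   blocks and all pairs of consecutive blocks have almost surely the expected
   norms in every exterior power.  Submultiplicativity bounds the norm of the
   k-th exterior power of the product from above.  When gamma_k > gamma_(k+1),
   a block of the k-th exterior power is close to a rank one matrix, and the
   inequality |AB| |BC| <= |ABC| |B| + |A| |C| m2(B), with m2 the sum of the
   2 x 2 minors, propagates the lower bound from block to block.  The remaining
   exponents are squeezed between consecutive gaps since both the singular
   values and the gamma_i are sorted. *)
Require Import Defs.
From mathcomp Require Import fingroup perm complex.
From HB Require Import structures.
From mathcomp Require Import all_boot all_order all_algebra.
From mathcomp Require Import finmap ring lra zify.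
From mathcomp Require Import all_classical all_reals all_analysis measurable_realfun.

Set Implicit Arguments.
Unset Strict Implicit.
Unset Printing Implicit Defensive.
Import Order.TTheory GRing.Theory Num.Theory.
Import numFieldNormedType.Exports.
Local Open Scope classical_set_scope.
Local Open Scope ring_scope.

(** The limits for the i.i.d. products are purely qualitative: in each degree they only say that at
    large times the norm has the expected size with probability at least one half. Logarithmic
    blocks ask for more. They must be short, since independence holds only inside windows of that
    length, and yet the failure probability has to be summable over all [N] starting points, which
    forces a bound exponential in the block length. The dichotomy turns the weak information into
    such a bound: both of its branches are moment estimates, hence carry exponential tails, and an
    event of probability one half is enough to exclude the branch that contradicts the limit.
    Fractional moments are the only integrability available, so everything is expanded to first
    order in a small exponent. Distant blocks may be dependent, so the passage from blocks to the
    whole product is purely deterministic. The obstacle there is cancellation between consecutive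
    blocks; the norms of products of two neighbours are what excludes it. *)

Lemma measurable_set_lt d (T : measurableType d) (R : realType) (f g : T -> R) :
  measurable_fun [set: T] f -> measurable_fun [set: T] g ->
  measurable [set x | f x < g x].
Proof.
move=> mf mg; rewrite -[X in measurable X]setTI.
by apply: (measurable_fun_ltr mf mg measurableT (_ : measurable [set true])).
Qed.

Lemma measurable_set_le d (T : measurableType d) (R : realType) (f g : T -> R) :
  measurable_fun [set: T] f -> measurable_fun [set: T] g ->
  measurable [set x | f x <= g x].
Proof.
move=> mf mg; rewrite -[X in measurable X]setTI.
by apply: (measurable_fun_ler mf mg measurableT (_ : measurable [set true])).
Qed.

Lemma measurable_fun_norm d (T : measurableType d) (R : realType) (f : T -> R) :
  measurable_fun [set: T] f -> measurable_fun [set: T] (fun x => `|f x|).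
Proof. by move=> mf; apply: measurableT_comp mf; exact: normr_measurable. Qed.

Section MeasurableComp.
Context d (T : measurableType d) (R : realType).
Implicit Type f : T -> R.

Lemma measurable_fun_powR f p : measurable_fun [set: T] f ->
  measurable_fun [set: T] (fun x => f x `^ p).
Proof. by move=> mf; exact: (measurableT_comp (measurable_powR p) mf). Qed.

Lemma measurable_fun_ln f : measurable_fun [set: T] f ->
  measurable_fun [set: T] (fun x => ln (f x)).
Proof. by move=> mf; apply: measurableT_comp mf; exact: measurable_ln. Qed.

Lemma measurable_fun_opp f : measurable_fun [set: T] f ->
  measurable_fun [set: T] (fun x => - f x).
Proof. by move=> mf; exact: measurable_funN. Qed.

Lemma measurable_fun_inv f : measurable_fun [set: T] f ->
  measurable_fun [set: T] (fun x => (f x)^-1).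
Proof.
(* The inverse is reduced to real powers, which invert only nonnegative arguments; hence the split
   by sign. *)
move=> mf; rewrite (_ : (fun x => _) =
    (fun x => if 0 <= f x then f x `^ (-1) else - (- f x) `^ (-1))).
  apply: measurable_fun_ifT.
  - by apply: (@measurable_fun_ler _ _ _ setT (cst 0) f).
  - exact: measurable_fun_powR.
  - exact/measurable_fun_opp/measurable_fun_powR/measurable_fun_opp.
apply/funext => y; case: ifPn => [y0|]; first by rewrite powR_inv1.
by rewrite -ltNge => y0; rewrite powR_inv1 ?invrN ?opprK// oppr_ge0 ltW.
Qed.

Lemma measurable_fun_scale c f : measurable_fun [set: T] f ->
  measurable_fun [set: T] (fun x => c * f x).
Proof. exact: (measurable_funM (measurable_cst c)). Qed.

End MeasurableComp.

(** * Borel measurability of matrix-valued maps *)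

Section BorelMatrix.
Variable R : realType.

Let rat_box m n (c : 'M[rat]_(m, n)) (k : nat) : set 'M[R]_(m, n) :=
  [set M | forall i j, `|M i j - ratr (c i j)| < k.+1%:R^-1].

(** Boxes with rational centres and radii of the form 1/(k+1) are a countable base, so an open set
    is a countable union of sets defined by entries. This reduces Borel measurability of a matrix to
    that of its entries. *)
Lemma open_mx_rat_box m n (U : set 'M[R]_(m, n)) (M : 'M[R]_(m, n)) :
  open U -> U M -> exists ck : 'M[rat]_(m, n) * nat,
    rat_box ck.1 ck.2 M /\ rat_box ck.1 ck.2 `<=` U.
Proof.
move=> oU UM.
have /nbhs_ballP[e /= e0 eU] : nbhs M U by exact: open_nbhs_nbhs.
pose k := Num.truncn (2 / e).
have k1 : k.+1%:R^-1 < e / 2.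
  rewrite -[ltRHS]invf_div ltf_pV2 ?posrE ?divr_gt0//.
  exact: truncnS_gt.
have ex (i : 'I_m) (j : 'I_n) : {q : rat | `|M i j - ratr q| < k.+1%:R^-1}.
  apply: cid; have : M i j - k.+1%:R^-1 < M i j + k.+1%:R^-1.
    by rewrite ltrBlDr -addrA ltrDl addr_gt0// invr_gt0.
  move=> /rat_in_itvoo[q]; rewrite in_itv/= => /andP[q1 q2].
  by exists q; rewrite distrC ltr_distl q1 q2.
exists (\matrix_(i, j) sval (ex i j), k); split => /=.
  by move=> i j; rewrite mxE; case: (ex i j).
move=> N NB; apply: eU; split => // i j.
have := NB i j; rewrite mxE; case: (ex i j) => q /= Mq Nq.
rewrite /ball/=; rewrite (_ : M i j - N i j = (M i j - ratr q) - (N i j - ratr q)).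
  by rewrite (le_lt_trans (ler_normB _ _))// [ltRHS](splitr e) ltrD// (lt_trans _ k1).
by rewrite opprB addrA addrNK.
Qed.

Lemma measurable_fun_mx d (T : measurableType d) m n (f : T -> 'M[R]_(m, n)) :
  (forall i j, measurable_fun [set: T] (fun x => f x i j)) ->
  measurable_fun [set: T] (f : T -> borel 'M[R]_(m, n)).
Proof.
move=> mf; apply: (@measurability _ _ T (borel 'M[R]_(m, n)) _ _ (@open 'M[R]_(m, n))) => //.
move=> _ [U oU <-]; rewrite setTI.
have -> : f @^-1` U = \bigcup_(ck : 'M[rat]_(m, n) * nat)
    [set x | rat_box ck.1 ck.2 (f x) /\ rat_box ck.1 ck.2 `<=` U].
  apply/seteqP; split => x /=.
    by move=> /(open_mx_rat_box oU)[ck]; exists ck.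
  by move=> [ck _ [fx]]; apply.
apply: countable_bigcupT_measurable; first exact: countableP.
move=> -[c k] /=.
have [sU|sU] := pselect (rat_box c k `<=` U); last first.
  rewrite (_ : [set _ | _] = set0)//; apply/seteqP; split => x //= -[_].
  by move=> /sU.
rewrite (_ : [set _ | _] = \bigcap_(ij in [set: 'I_m * 'I_n])
   [set x | `|f x ij.1 ij.2 - ratr (c ij.1 ij.2)| < k.+1%:R^-1]); last first.
  apply/seteqP; split => x /=; first by move=> [fx _] ij _; exact: fx.
  by move=> fx; split => // i j; exact: (fx (i, j)).
apply: fin_bigcap_measurable => [|[i j] _ /=]; first exact: finite_finset.
apply: measurable_set_lt => //.
by apply: measurable_fun_norm; exact: measurable_funB.
Qed.

Lemma measurable_entry m n (i : 'I_m) (j : 'I_n) :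
  measurable_fun [set: borel 'M[R]_(m, n)]
    (fun M : borel 'M[R]_(m, n) => (M : 'M[R]_(m, n)) i j).
Proof.
apply: (measurability _ (RGenOpens.measurableE R)).
move=> _ [_ [a [b ->]] <-]; rewrite setTI; apply: sub_gen_smallest.
have := @interval_open R (BSide false a) (BSide true b) isT isT.
by move=> /(open_comp _); apply => M _; exact: coord_continuous.
Qed.

Lemma measurable_mulmx d (T : measurableType d) m n p
    (f : T -> 'M[R]_(m, n)) (g : T -> 'M[R]_(n, p)) :
  measurable_fun [set: T] (f : T -> borel 'M[R]_(m, n)) ->
  measurable_fun [set: T] (g : T -> borel 'M[R]_(n, p)) ->
  measurable_fun [set: T] ((fun x => f x *m g x) : T -> borel 'M[R]_(m, p)).
Proof.
move=> mf mg; apply: measurable_fun_mx => i j.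
under eq_fun do rewrite mxE; apply: measurable_sum => k.
by apply: measurable_funM; [exact: (measurableT_comp (measurable_entry i k) mf)|
  exact: (measurableT_comp (measurable_entry k j) mg)].
Qed.

Lemma measurable_det n :
  measurable_fun [set: borel 'M[R]_n] (fun g : borel 'M[R]_n => \det (g : 'M[R]_n)).
Proof.
apply: measurable_sum => s; apply: measurable_funM => //.
by apply: measurable_prod => i _; exact: measurable_entry.
Qed.

Lemma measurable_mxsub m n m' n' (f : 'I_m' -> 'I_m) (h : 'I_n' -> 'I_n) :
  measurable_fun [set: borel 'M[R]_(m, n)]
   ((fun g : 'M[R]_(m, n) => mxsub f h g) : borel 'M[R]_(m, n) -> borel 'M[R]_(m', n')).
Proof.
apply: measurable_fun_mx => i j; under eq_fun do rewrite mxE.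
exact: measurable_entry.
Qed.

End BorelMatrix.

(** * Convolution semigroups of matrix laws *)

Section Expectation.
Context d (T : measurableType d) (R : realType) (mu : probability T R).
Implicit Types f g : T -> R.

Definition Ex f : \bar R := (\int[mu]_x (f x)%:E)%E.

Lemma Ex_ge0 f : (forall x, 0 <= f x) -> (0 <= Ex f)%E.
Proof. by move=> f0; apply: integral_ge0 => x _; rewrite lee_fin. Qed.

Lemma Ex_le_ae f g : (forall x, 0 <= f x) -> (forall x, 0 <= g x) ->
  measurable_fun [set: T] f -> measurable_fun [set: T] g ->
  {ae mu, forall x, f x <= g x} -> (Ex f <= Ex g)%E.
Proof.
move=> f0 g0 mf mg fg; apply: ae_ge0_le_integral => //.
- by move=> x _; rewrite lee_fin.
- exact/measurable_EFinP.
- by move=> x _; rewrite lee_fin.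
- exact/measurable_EFinP.
- by apply: filterS fg => x fg _; rewrite lee_fin.
Qed.

Lemma Ex_le f g : (forall x, 0 <= f x) ->
  measurable_fun [set: T] f -> measurable_fun [set: T] g ->
  (forall x, f x <= g x) -> (Ex f <= Ex g)%E.
Proof.
move=> f0 mf mg fg; apply: Ex_le_ae => //; last exact: aeW.
by move=> x; rewrite (le_trans (f0 x)).
Qed.

Lemma ExD f g : (forall x, 0 <= f x) -> (forall x, 0 <= g x) ->
  measurable_fun [set: T] f -> measurable_fun [set: T] g ->
  Ex (fun x => f x + g x) = (Ex f + Ex g)%E.
Proof.
move=> f0 g0 mf mg; rewrite /Ex -ge0_integralD//.
- by move=> x _; rewrite lee_fin.
- exact/measurable_EFinP.
- by move=> x _; rewrite lee_fin.
- exact/measurable_EFinP.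
Qed.

Lemma ExZ c f : 0 <= c -> (forall x, 0 <= f x) -> measurable_fun [set: T] f ->
  Ex (fun x => c * f x) = (c%:E * Ex f)%E.
Proof.
move=> c0 f0 mf; rewrite /Ex -ge0_integralZl//.
- exact/measurable_EFinP.
- by move=> x _; rewrite lee_fin.
Qed.

Lemma Ex_cst c : Ex (fun=> c) = c%:E.
Proof. by rewrite /Ex integral_cst//= (@probability_setT _ _ _ mu) mule1. Qed.

Lemma ae_Ex_fin f : (forall x, 0 <= f x) -> Ex f = 0%E ->
  measurable_fun [set: T] f -> {ae mu, forall x, f x = 0}.
Proof.
move=> f0 Ef0 mf; have /ae_eq_integral_abs : measurable_fun [set: T] (EFin \o f).
  exact/measurable_EFinP.
move=> /(_ mu measurableT)[+ _]; have <- : Ex f = (\int[mu]_x `|(EFin \o f) x|)%E.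
  by apply: eq_integral => x _ /=; rewrite ger0_norm.
move=> /(_ Ef0); apply: filterS => x /(_ I) []//.
Qed.

End Expectation.

Lemma Ex_distribution d d' (T : measurableType d) (T' : measurableType d')
    (R : realType) (P : probability T R) (X : {mfun T >-> T'}) (f : T' -> R) :
  (forall x, 0 <= f x) -> measurable_fun [set: T'] f ->
  Ex (distribution P X) f = Ex P (fun x => f (X x)).
Proof.
move=> f0 mf; rewrite /Ex ge0_integral_pushforward//.
- exact/measurable_EFinP.
- by move=> x _; rewrite lee_fin.
Qed.

Section AlmostEverywhere.
Context d (T : measurableType d) (R : realType) (mu : probability T R).
Implicit Types A B C : T -> Prop.

Lemma ae_imp A B : (forall x, A x -> B x) ->
  {ae mu, forall x, A x} -> {ae mu, forall x, B x}.
Proof. exact: filterS. Qed.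

Lemma ae_imp2 A B C : (forall x, A x -> B x -> C x) ->
  {ae mu, forall x, A x} -> {ae mu, forall x, B x} -> {ae mu, forall x, C x}.
Proof. exact: filterS2. Qed.

Lemma ae_forall_fin (I : finType) (Q : I -> T -> Prop) :
  (forall i, {ae mu, forall x, Q i x}) -> {ae mu, forall x, forall i, Q i x}.
Proof. exact: filter_forall. Qed.

Lemma ae_forall_nat (Q : nat -> T -> Prop) :
  (forall i, {ae mu, forall x, Q i x}) -> {ae mu, forall x, forall i, Q i x}.
Proof. exact: ae_foralln. Qed.

Lemma ae_exists A : {ae mu, forall x, A x} -> exists x, A x.
Proof.
have muT : (0 < mu setT)%E by rewrite (@probability_setT _ _ _ mu).
by move=> /(@filter_ex _ _ (ae_properfilter_algebraOfSetsType muT)).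
Qed.

End AlmostEverywhere.

Section ConvolutionSemigroup.
Context (R : realType) (r : nat).
Local Notation M := (borel 'M[R]_r).
Implicit Type law : nat -> probability M R.

(** Only this identity is kept from the random products, so that the same estimates apply to the
    laws of diagonal blocks and of exterior powers. Testing on nonnegative functions avoids all
    integrability conditions. *)
Definition conv_sg law := forall n k (f : M -> R), (forall g, 0 <= f g) ->
  measurable_fun [set: M] f ->
  Ex (law (n + k)%N) f =
  (\int[law n]_g \int[law k]_h (f ((g : 'M[R]_r) *m (h : 'M[R]_r)))%:E)%E.

Variable law : nat -> probability M R.
Hypothesis sg : conv_sg law.

Lemma measurable_mulmx2 (f : M -> R) : measurable_fun [set: M] f ->
  measurable_fun [set: M * M] (fun gh => f ((gh.1 : 'M[R]_r) *m (gh.2 : 'M[R]_r))).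
Proof.
move=> mf; apply: (measurableT_comp mf).
by apply: measurable_mulmx; [exact: measurable_fst|exact: measurable_snd].
Qed.

Lemma conv_sg_swap n k (f : M -> R) : (forall g, 0 <= f g) ->
  measurable_fun [set: M] f ->
  Ex (law (n + k)%N) f =
  (\int[law k]_h \int[law n]_g (f ((g : 'M[R]_r) *m (h : 'M[R]_r)))%:E)%E.
Proof.
move=> f0 mf; rewrite sg//.
apply: (fubini_tonelli (fun gh : M * M =>
  (f ((gh.1 : 'M[R]_r) *m (gh.2 : 'M[R]_r)))%:E)).
  by apply/measurable_EFinP; exact: measurable_mulmx2.
by move=> x; rewrite lee_fin.
Qed.

Lemma measurable_inner k (f : M -> R) : (forall g, 0 <= f g) ->
  measurable_fun [set: M] f ->
  measurable_fun [set: M] (fun g : M => \int[law k]_h (f ((g : 'M[R]_r) *m (h : 'M[R]_r)))%:E)%E.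
Proof.
move=> f0 mf.
apply: (@measurable_fun_fubini_tonelli_F _ _ _ _ _ (law k) (fun gh : M * M =>
  (f ((gh.1 : 'M[R]_r) *m (gh.2 : 'M[R]_r)))%:E)).
  by apply/measurable_EFinP; exact: measurable_mulmx2.
by move=> x; rewrite lee_fin.
Qed.

Lemma measurable_inner_swap k (f : M -> R) : (forall g, 0 <= f g) ->
  measurable_fun [set: M] f ->
  measurable_fun [set: M] (fun h : M => \int[law k]_g (f ((g : 'M[R]_r) *m (h : 'M[R]_r)))%:E)%E.
Proof.
move=> f0 mf.
apply: (@measurable_fun_fubini_tonelli_G _ _ _ _ _ (law k) (fun gh : M * M =>
  (f ((gh.1 : 'M[R]_r) *m (gh.2 : 'M[R]_r)))%:E)).
  by apply/measurable_EFinP; exact: measurable_mulmx2.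
by move=> x; rewrite lee_fin.
Qed.

(** Tonelli for the indicator of the complement of [Q]: a nonnegative function with zero integral
    vanishes almost everywhere, first in the right factor and then in the left one. *)
Lemma conv_sg_ae_swap n k (Q : set M) : measurable Q -> {ae law (n + k)%N, forall g, Q g} ->
  {ae law k, forall h, {ae law n, forall g, Q ((g : 'M[R]_r) *m (h : 'M[R]_r))}}.
Proof.
move=> mQ aeQ; pose f : M -> R := \1_(~` Q).
have f0 g : 0 <= f g by rewrite /f indicE.
have mf : measurable_fun [set: M] f by exact/measurable_indic/measurableC.
have mg (h : M) : measurable_fun [set: M] (fun g => f ((g : 'M[R]_r) *m (h : 'M[R]_r))).
  by apply: (measurableT_comp mf); apply: measurable_mulmx.
have /eqP : Ex (law (n + k)%N) f = 0%E.
  apply/eqP; rewrite eq_le Ex_ge0// andbT.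
  have <- : Ex (law (n + k)%N) (fun=> 0) = 0%E by rewrite Ex_cst.
  apply: Ex_le_ae => //; apply: filterS aeQ => g Qg.
  by rewrite /f indicE memNset//=; apply.
rewrite conv_sg_swap// => /eqP int0.
have : (\int[law k]_h `|\int[law n]_g (f ((g : 'M[R]_r) *m (h : 'M[R]_r)))%:E|)%E = 0%E.
  rewrite -[RHS]int0; apply: eq_integral => h _; rewrite gee0_abs//.
  by apply: integral_ge0 => g _; rewrite lee_fin.
move/(ae_eq_integral_abs (law k) measurableT (measurable_inner_swap n f0 mf)).
apply: filterS => h /(_ I) /= fh0.
have := ae_Ex_fin (fun g => f0 _) fh0 (mg h).
apply: filterS => g; rewrite /f indicE => /eqP; rewrite pnatr_eq0 eqb0 => hQ.
by apply: contrapT => nQ; move/negP: hQ; apply; rewrite inE.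
Qed.

Lemma conv_sg_submul n k (f f1 f2 : M -> R) :
  (forall g, 0 <= f g) -> (forall g, 0 <= f1 g) -> (forall g, 0 <= f2 g) ->
  measurable_fun [set: M] f -> measurable_fun [set: M] f1 ->
  measurable_fun [set: M] f2 ->
  {ae law n, forall g, {ae law k, forall h,
     f ((g : 'M[R]_r) *m (h : 'M[R]_r)) <= f1 g * f2 h}} ->
  (Ex (law (n + k)%N) f <= Ex (law n) f1 * Ex (law k) f2)%E.
Proof.
move=> f0 f10 f20 mf mf1 mf2 H; rewrite sg//.
have E2 : (0 <= Ex (law k) f2)%E by exact: Ex_ge0.
have mg (g : M) : measurable_fun [set: M] (fun h => f ((g : 'M[R]_r) *m (h : 'M[R]_r))).
  by apply: (measurableT_comp mf); apply: measurable_mulmx.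
rewrite muleC -ge0_integralZl//; last 2 first.
- exact/measurable_EFinP.
- by move=> x _; rewrite lee_fin.
apply: ae_ge0_le_integral => //.
- by move=> g _; apply: integral_ge0 => h _; rewrite lee_fin.
- exact: measurable_inner.
- by move=> g _; rewrite mule_ge0// lee_fin.
- by apply: measurable_funeM; exact/measurable_EFinP.
have := @filterS _ _ (ae_filter_ringOfSetsType (law n)) _ _ _ H; apply => g Hg _.
rewrite muleC -[X in (_ <= X)%E]ExZ//.
apply: Ex_le_ae => //.
- by move=> h; exact: mulr_ge0.
- exact: measurable_fun_scale.
Qed.

(** The right factor is integrated first, with the left one frozen: [f1] is the size that factors
    out of the inner expectation and [V] bounds what remains, uniformly in the left factor. *)
Lemma conv_sg_le n k (f f1 : M -> R) V :
  (forall g, 0 <= f g) -> (forall g, 0 <= f1 g) -> 0 <= V ->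
  measurable_fun [set: M] f -> measurable_fun [set: M] f1 ->
  {ae law n, forall g : M, (Ex (law k)
     (fun h : M => f ((g : 'M[R]_r) *m (h : 'M[R]_r))) <= (V * f1 g)%:E)%E} ->
  (Ex (law (n + k)%N) f <= V%:E * Ex (law n) f1)%E.
Proof.
move=> f0 f10 V0 mf mf1 H; rewrite sg// -ExZ//.
apply: ae_ge0_le_integral => //.
- by move=> g _; apply: integral_ge0 => h _; rewrite lee_fin.
- exact: measurable_inner.
- by move=> g _; rewrite lee_fin mulr_ge0.
- by apply/measurable_EFinP; exact: measurable_fun_scale.
by have := @filterS _ _ (ae_filter_ringOfSetsType (law n)) _ _ _ H; apply => g Hg _.
Qed.

End ConvolutionSemigroup.

(** * The entrywise norm and the two-sided size of a matrix *)

Section EntrySum.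
Variable R : realType.

(** Constants disappear in exponential rates, so any norm would do; this one is submultiplicative
    also for rectangular matrices, and its measurability is read off the entries. *)
Definition N1 m n (A : 'M[R]_(m, n)) : R := \sum_i \sum_j `|A i j|.

Lemma N1_ge0 m n (A : 'M[R]_(m, n)) : 0 <= N1 A.
Proof. by apply: sumr_ge0 => i _; apply: sumr_ge0. Qed.
Hint Resolve N1_ge0 : core.

Lemma entry_le_N1 m n (A : 'M[R]_(m, n)) i j : `|A i j| <= N1 A.
Proof.
rewrite /N1 (bigD1 i)//= (bigD1 j)//= -addrA lerDl addr_ge0//.
  by apply: sumr_ge0.
by apply: sumr_ge0 => k _; apply: sumr_ge0.
Qed.

Lemma N1_eq0 m n (A : 'M[R]_(m, n)) : (N1 A == 0) = (A == 0).
Proof.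
apply/eqP/eqP => [A0|->]; last first.
  by rewrite /N1 big1// => i _; rewrite big1// => j _; rewrite mxE normr0.
apply/matrixP => i j; rewrite mxE; apply/eqP; rewrite -normr_le0 -A0.
exact: entry_le_N1.
Qed.

Lemma N1_gt0 m n (A : 'M[R]_(m, n)) : (0 < N1 A) = (A != 0).
Proof. by rewrite lt_def N1_ge0 andbT N1_eq0. Qed.

Lemma N1D m n (A B : 'M[R]_(m, n)) : N1 (A + B) <= N1 A + N1 B.
Proof.
rewrite /N1 -big_split/=; apply: ler_sum => i _.
by rewrite -big_split/=; apply: ler_sum => j _; rewrite mxE ler_normD.
Qed.

Lemma N1Z m n c (A : 'M[R]_(m, n)) : N1 (c *: A) = `|c| * N1 A.
Proof.
rewrite /N1 mulr_sumr; apply: eq_bigr => i _; rewrite mulr_sumr.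
by apply: eq_bigr => j _; rewrite mxE normrM.
Qed.

Lemma N1N m n (A : 'M[R]_(m, n)) : N1 (- A) = N1 A.
Proof. by rewrite -scaleN1r N1Z normrN1 mul1r. Qed.

Lemma N1_tr m n (A : 'M[R]_(m, n)) : N1 A^T = N1 A.
Proof.
rewrite /N1 exchange_big; apply: eq_bigr => i _; apply: eq_bigr => j _.
by rewrite mxE.
Qed.

Lemma N1M m n p (A : 'M[R]_(m, n)) (B : 'M[R]_(n, p)) :
  N1 (A *m B) <= N1 A * N1 B.
Proof.
rewrite [N1 A]/N1 mulr_suml; apply: ler_sum => i _; rewrite mulr_suml.
rewrite (@le_trans _ _ (\sum_j \sum_k `|A i k| * `|B k j|))//.
  apply: ler_sum => j _; rewrite mxE (le_trans (ler_norm_sum _ _ _))//.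
  by apply: ler_sum => k _; rewrite normrM.
rewrite exchange_big/=; apply: ler_sum => k _; rewrite -mulr_sumr ler_wpM2l//.
rewrite /N1 (bigD1 k)//= lerDl.
by apply: sumr_ge0 => j _; apply: sumr_ge0.
Qed.

Lemma N1_1 n : N1 (1%:M : 'M[R]_n) = n%:R.
Proof.
rewrite /N1 (eq_bigr (fun=> 1)) ?sumr_const ?card_ord// => i _.
rewrite (bigD1 i)//= mxE eqxx normr1 big1 ?addr0// => j ji.
by rewrite mxE eq_sym (negbTE ji) normr0.
Qed.

Lemma measurable_N1 d (T : measurableType d) m n (f : T -> 'M[R]_(m, n)) :
  measurable_fun [set: T] (f : T -> borel 'M[R]_(m, n)) ->
  measurable_fun [set: T] (fun x => N1 (f x)).
Proof.
move=> mf; apply: measurable_sum => i; apply: measurable_sum => j.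
by apply: measurable_fun_norm; exact: (measurableT_comp (measurable_entry i j) mf).
Qed.

(** Controls expansion and contraction at once: for a row vector [x] of norm 1 and an invertible
    [g], [ln (Nb g)] bounds the absolute value of the logarithm of the norm of [x *m g]. *)
Definition Nb n (A : 'M[R]_n) : R := N1 A + N1 (invmx A).

Lemma Nb_ge0 n (A : 'M[R]_n) : 0 <= Nb A.
Proof. by rewrite addr_ge0. Qed.

Lemma N1_le_Nb n (A : 'M[R]_n) : N1 A <= Nb A.
Proof. by rewrite lerDl. Qed.

Lemma N1V_le_Nb n (A : 'M[R]_n) : N1 (invmx A) <= Nb A.
Proof. by rewrite lerDr. Qed.

Lemma Nb_ge1 n (A : 'M[R]_n) : (0 < n)%N -> A \in unitmx -> 1 <= Nb A.
Proof.
move=> n0 uA; have : 1 <= N1 A * N1 (invmx A).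
  rewrite (le_trans _ (N1M _ _))// mulmxV// N1_1 ler1n//.
rewrite /Nb; have := N1_ge0 A; have := N1_ge0 (invmx A).
move: (N1 A) (N1 _) => a b b0 a0 ab.
have [a1|a1] := leP 1 a; first by rewrite (le_trans a1)// lerDl.
by rewrite (le_trans ab)// (le_trans (ler_wpM2r b0 (ltW a1)))// mul1r lerDr.
Qed.

Lemma N1_invmx_ge n (A : 'M[R]_n) : (0 < n)%N -> A \in unitmx -> (Nb A)^-1 <= N1 A.
Proof.
move=> n0 uA; have Nb1 := Nb_ge1 n0 uA.
rewrite -[leLHS]mul1r ler_pdivrMr ?(lt_le_trans ltr01)//.
apply: (@le_trans _ _ (N1 A * N1 (invmx A))); last by rewrite ler_wpM2l// N1V_le_Nb.
by rewrite (le_trans _ (N1M _ _))// mulmxV// N1_1 ler1n.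
Qed.

Lemma N1_unitmx_gt0 n (A : 'M[R]_n) : (0 < n)%N -> A \in unitmx -> 0 < N1 A.
Proof.
move=> n0 uA; rewrite (lt_le_trans _ (N1_invmx_ge n0 uA))// invr_gt0.
by rewrite (lt_le_trans ltr01)// Nb_ge1.
Qed.

Lemma unitmx_mulmx n (A B : 'M[R]_n) :
  A \in unitmx -> B \in unitmx -> A *m B \in unitmx.
Proof. by rewrite unitmx_mul => -> ->. Qed.

Lemma measurable_invmx n :
  measurable_fun [set: borel 'M[R]_n]
    (invmx : borel 'M[R]_n -> borel 'M[R]_n).
Proof.
have mdet : measurable_fun [set: borel 'M[R]_n] (fun A : 'M[R]_n => \det A).
  exact: measurable_det.
(* On singular matrices [invmx] returns its argument, which is the branch [id]; on the others it is
   the adjugate divided by the determinant. *)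
apply: (@measurable_fun_ifT _ _ _ _
  ((fun A => (\det A)^-1 *: \adj A) : borel 'M[R]_n -> borel 'M[R]_n) id
  (fun A => (A : 'M[R]_n) \in unitmx)) => //.
  have -> : (fun A : 'M[R]_n => A \in unitmx) = (fun A : 'M[R]_n => ~~ (\det A == 0)).
    by apply/funext => A; rewrite unitmxE unitfE.
  by apply: measurable_neg; apply: measurable_fun_eqr.
apply: measurable_fun_mx => i j; under eq_fun do rewrite !mxE.
apply: measurable_funM; first exact: measurable_fun_inv.
apply: measurable_fun_scale.
rewrite (_ : (fun A => _) = (@determinant R n.-1) \o (mxsub (lift j) (lift i))).
  apply: (@measurableT_comp _ _ _ _ (borel 'M[R]_n.-1)); first exact: measurable_det.
  exact: measurable_mxsub.
by apply/funext => A /=; congr (\det _); apply/matrixP => k l; rewrite !mxE.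
Qed.

Lemma measurable_Nb d (T : measurableType d) n (f : T -> 'M[R]_n) :
  measurable_fun [set: T] (f : T -> borel 'M[R]_n) ->
  measurable_fun [set: T] (fun x => Nb (f x)).
Proof.
move=> mf; apply: measurable_funD; first exact: measurable_N1.
by apply: measurable_N1; exact: (measurableT_comp (@measurable_invmx n) mf).
Qed.

Lemma N1_mulV n (x : 'rV[R]_n) (g : 'M[R]_n) : g \in unitmx ->
  N1 x <= N1 (x *m g) * Nb g.
Proof.
move=> ug; rewrite -{1}(mulmxK ug x) (le_trans (N1M _ _))//.
by rewrite ler_wpM2l// N1V_le_Nb.
Qed.

Lemma N1_mul_Nb m n (x : 'M[R]_(m, n)) (g : 'M[R]_n) : N1 (x *m g) <= N1 x * Nb g.
Proof. by rewrite (le_trans (N1M _ _))// ler_wpM2l// N1_le_Nb. Qed.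

End EntrySum.
#[global] Hint Resolve N1_ge0 Nb_ge0 : core.

(** Take a matrix of maximal rank among those whose row space lies in [S]; a vector of [S] outside
    that row space could be added to it and would raise the rank. *)
Lemma subspace_rowspace (F : fieldType) n (S : set 'rV[F]_n) :
  S 0 -> (forall c x y, S x -> S y -> S (c *: x + y)) ->
  exists A : 'M[F]_n, forall x, S x <-> (x <= A)%MS.
Proof.
move=> S0 Slin.
pose Q k := `[< exists A : 'M[F]_n, \rank A = k /\ forall x, (x <= A)%MS -> S x >].
have Q0 : exists k, Q k.
  exists 0%N; apply/asboolP; exists 0; split; first exact: mxrank0.
  by move=> x; rewrite submx0 => /eqP ->.
have Qn k : Q k -> (k <= n)%N by move=> /asboolP[A [<- _]]; exact: rank_leq_row.
case: (ex_maxnP Q0 Qn) => k /asboolP[A [rA AS]] kmax.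
exists A => x; split; last exact: AS.
move=> Sx; apply: contrapT => /negP xA.
suff /kmax : Q (\rank (A + x)%MS).
  rewrite -rA leqNgt => /negP; apply.
  rewrite ltn_neqAle (mxrank_leqif_sup (addsmxSl A x)).2 mxrankS ?addsmxSl//.
  by rewrite addsmx_sub negb_and xA orbT.
apply/asboolP; exists (A + x)%MS; split => // y /sub_addsmxP[[u c] /= ->].
rewrite addrC (mx11_scalar c) mul_scalar_mx; apply: Slin => //.
by apply: AS; exact: submxMl.
Qed.

Lemma mulmx2B (F : pzRingType) m n p q (v v' : 'M[F]_(m, n)) (h : 'M[F]_(n, p))
    (l l' : 'M[F]_(p, q)) :
  v *m h *m l = v' *m h *m l' + ((v - v') *m h *m l + v' *m h *m (l - l')).
Proof. by rewrite !(mulmxBl, mulmxBr) [X in _ + X]addrA subrK addrCA subrr addr0. Qed.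

Section Topology.
Variable R : realType.

Lemma N1_le_norm n (x : 'rV[R]_n) : N1 x <= n%:R * `|x|.
Proof.
rewrite /N1 big_ord1 mulr_natl -[in X in _ *+ X](card_ord n) -sumr_const.
apply: ler_sum => i _; rewrite [leRHS]/Num.Def.normr/= mx_normrE.
by apply/bigmax_geP; right => /=; exists (0, i).
Qed.

Lemma norm_le_N1 n (x : 'rV[R]_n) : `|x| <= N1 x.
Proof.
rewrite [leLHS]/Num.Def.normr/= mx_normrE; apply/bigmax_leP; split; first exact: N1_ge0.
by move=> [i j] _ /=; exact: entry_le_N1.
Qed.

Lemma loc_lipschitz_continuous n (f : 'rV[R]_n -> R) :
  (forall z, exists C, forall z', N1 (z - z') <= 1 ->
     `|f z - f z'| <= C * N1 (z - z')) -> continuous f.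
Proof.
move=> Hf z; have [C fC] := Hf z.
apply/(@cvgrPdist_le R R^o _ (nbhs z) (nbhs_filter z) f (f z)) => e e0.
(* The factor [n.+1] converts the sup norm into [N1]; the other factor makes the distance at most 1,
   where the Lipschitz bound is valid, and also at most [e] after multiplication by [C]. *)
pose D := n.+1%:R * (1 + `|C| / e) : R.
have D0 : 0 < D by rewrite mulr_gt0// ltr_wpDr// divr_ge0// ltW.
have aux t : 0 <= t -> t <= (1 + `|C| / e)^-1 -> t <= 1 /\ C * t <= e.
  move=> t0 tC; have c1 : 0 < 1 + `|C| / e by rewrite ltr_wpDr// divr_ge0// ltW.
  split; first by rewrite (le_trans tC)// invf_le1// lerDl divr_ge0// ltW.
  rewrite (@le_trans _ _ (`|C| * t))//; first by rewrite ler_wpM2r// ler_norm.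
  rewrite (le_trans (ler_wpM2l _ tC))// ler_pdivrMr// mulrDr mulr1.
  by rewrite mulrCA divff ?gt_eqF// mulr1 lerDr ltW.
near=> z'.
have zz' : N1 (z - z') <= (1 + `|C| / e)^-1.
  rewrite (le_trans (N1_le_norm _))//.
  have : `|z - z'| <= D^-1.
    near: z'; apply: (@cvgr_dist_le _ _ _ (nbhs z) _ id z) => //.
    by rewrite invr_gt0.
  move=> /(ler_wpM2l (ler0n R n.+1)); rewrite [D^-1]invfM mulVKf ?pnatr_eq0//.
  by apply: le_trans; rewrite ler_wpM2r// ler_nat.
have [zz1 Czz] := aux _ (N1_ge0 _) zz'.
exact: le_trans (fC _ zz1) Czz.
Unshelve. all: by end_near. Qed.

Lemma continuous_N1_mul n p (L : 'M[R]_(n, p)) : continuous (fun x : 'rV[R]_n => N1 (x *m L)).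
Proof.
apply: loc_lipschitz_continuous => z; exists (N1 L) => z' _.
rewrite mulrC (le_trans _ (N1M _ _))// mulmxBl ler_norml lerBrDr lerBlDr.
rewrite addrC lerBlDr; apply/andP; split.
  rewrite -[X in N1 X <= _](subrK (z *m L)) (le_trans (N1D _ _))// addrC lerD2l.
  by rewrite -N1N opprB.
by rewrite -[X in N1 X <= _](subrK (z' *m L)) (le_trans (N1D _ _)).
Qed.

End Topology.

(** * Uniform transitivity of irreducible laws *)

Section UniformIrreducibility.
Context (R : realType) (r : nat).
Local Notation M := (borel 'M[R]_r).
Variable law : nat -> probability M R.
Hypothesis sg : conv_sg law.
Hypothesis ae_unit : forall n, {ae law n, forall g, (g : 'M[R]_r) \in unitmx}.

Definition irreducible_law := forall N : 'M[R]_r,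
  (forall n, {ae law n, forall g, (N *m (g : 'M[R]_r) <= N)%MS}) ->
  N != 0 -> row_full N.

(* The denominator makes the matrix coefficient bounded and Lipschitz in (v, l),
   uniformly in h, so that compactness turns positivity into a uniform bound. *)
Definition hits (v : 'rV[R]_r) (l : 'cV[R]_r) (h : M) : R :=
  N1 (v *m (h : 'M[R]_r) *m l) / (1 + N1 (h : 'M[R]_r)).

Lemma hits_ge0 v l h : 0 <= hits v l h.
Proof. exact: divr_ge0 (N1_ge0 _) (addr_ge0 ler01 (N1_ge0 _)). Qed.

Lemma measurable_hits v l : measurable_fun [set: M] (hits v l).
Proof.
apply: measurable_funM.
  apply: measurable_N1; apply: measurable_mulmx => //.
  by apply: measurable_mulmx => //; exact: measurable_id.
apply: measurable_fun_inv; apply: measurable_funD => //.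
by apply: measurable_N1; exact: measurable_id.
Qed.

Lemma hits_bound v l h : hits v l h <= N1 v * N1 l.
Proof.
rewrite /hits ler_pdivrMr ?(ltr_wpDr (N1_ge0 _))// (le_trans (N1M _ _))//.
rewrite (le_trans (ler_wpM2r (N1_ge0 _) (N1M _ _)))// mulrAC.
by rewrite ler_wpM2l ?lerDr// mulr_ge0 ?N1_ge0.
Qed.

Lemma hits_lip v l v' l' h :
  hits v l h <= hits v' l' h + (N1 (v - v') * N1 l + N1 v' * N1 (l - l')).
Proof.
rewrite (le_trans (y := hits v' l' h + (hits (v - v') l h + hits v' (l - l') h)))//.
  rewrite /hits -!mulrDl ler_wpM2r ?invr_ge0 ?(addr_ge0 ler01 (N1_ge0 _))//.
  have -> : v *m (h : 'M[R]_r) *m l = v' *m (h : 'M[R]_r) *m l' +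
      ((v - v') *m (h : 'M[R]_r) *m l + v' *m (h : 'M[R]_r) *m (l - l')).
    exact: mulmx2B.
  by rewrite (le_trans (N1D _ _))// lerD2l N1D.
by rewrite lerD2l lerD// hits_bound.
Qed.

(** The pair of a row vector and a column vector is packed into one row vector, so that compactness
    is used in a single space. Several times [k] are summed because the time at which a pair is hit
    depends on the pair. *)
Definition Fhit K (z : 'rV[R]_(r + r)) : R :=
  \sum_(k < K) fine (Ex (law k) (hits (lsubmx z) (rsubmx z)^T)).

Lemma Ex_hits_fin k v l : Ex (law k) (hits v l) \is a fin_num.
Proof.
rewrite ge0_fin_numE; last exact/Ex_ge0/hits_ge0.
apply: (@le_lt_trans _ _ (N1 v * N1 l)%:E); last exact: ltry.
rewrite -(Ex_cst (law k)); apply: Ex_le => //.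
- exact: hits_ge0.
- exact: measurable_hits.
- exact: hits_bound.
Qed.

Lemma N1_lsub (z : 'rV[R]_(r + r)) : N1 (lsubmx z) <= N1 z.
Proof.
rewrite /N1 !big_ord1 big_split_ord/= -[leLHS]addr0 lerD//; last exact: sumr_ge0.
by apply: ler_sum => i _; rewrite mxE.
Qed.

Lemma N1_rsub (z : 'rV[R]_(r + r)) : N1 (rsubmx z) <= N1 z.
Proof.
rewrite /N1 !big_ord1 big_split_ord/= -[leLHS]add0r lerD//; first exact: sumr_ge0.
by apply: ler_sum => i _; rewrite mxE.
Qed.

Lemma Fhit_continuous K : continuous (Fhit K).
Proof.
(* By [hits_lip] each summand varies by at most [N1 (z - z')] times the sum of the two norms, which
   is at most [2 * N1 z + 1] when the distance is at most 1. *)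
apply: loc_lipschitz_continuous => z; exists (K%:R * (2 * N1 z + 1)) => z' zz'.
have N1z' : N1 z' <= N1 z + 1.
  by rewrite -[X in N1 X](subrK z) addrC (le_trans (N1D _ _))// lerD2l -N1N opprB.
have bnd (a b : 'rV[R]_(r + r)) k : N1 a <= N1 z + 1 -> N1 b <= N1 z + 1 ->
   N1 a + N1 b <= 2 * N1 z + 1 ->
   fine (Ex (law k) (hits (lsubmx a) (rsubmx a)^T)) <=
   fine (Ex (law k) (hits (lsubmx b) (rsubmx b)^T)) + (2 * N1 z + 1) * N1 (a - b).
  move=> az bz ab; rewrite -lee_fin EFinD !fineK ?Ex_hits_fin//.
  have c0 : 0 <= (2 * N1 z + 1) * N1 (a - b).
    by rewrite mulr_ge0 ?N1_ge0// addr_ge0// mulr_ge0// N1_ge0.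
  rewrite -(Ex_cst (law k)) -ExD; first last.
  - exact: measurable_cst.
  - exact: measurable_hits.
  - by [].
  - exact: hits_ge0.
  apply: Ex_le => //; first exact: hits_ge0.
  - exact: measurable_hits.
  - by apply: measurable_funD => //; exact: measurable_hits.
  move=> h; rewrite (le_trans (hits_lip _ _ (lsubmx b) (rsubmx b)^T h))//.
  rewrite lerD2l -!linearB/= !N1_tr.
  rewrite (@le_trans _ _ (N1 (a - b) * N1 a + N1 b * N1 (a - b)))//.
    by rewrite lerD ?ler_pM ?N1_ge0 ?N1_lsub ?N1_rsub.
  by rewrite mulrC -mulrDl ler_wpM2r ?N1_ge0.
have N1zz : N1 (z' - z) = N1 (z - z') by rewrite -N1N opprB.
rewrite /Fhit -sumrB (le_trans (ler_norm_sum _ _ _))//.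
rewrite -mulrA mulr_natl -[in leRHS](card_ord K) -sumr_const; apply: ler_sum => k _.
have b1 := bnd z z' k; have b2 := bnd z' z k; rewrite N1zz in b2.
have {}b1 := b1 ltac:(lra) ltac:(lra) ltac:(lra).
have {}b2 := b2 ltac:(lra) ltac:(lra) ltac:(lra).
by rewrite ler_norml; apply/andP; split; lra.
Qed.

Lemma Ex_hits_eq0 k v l : Ex (law k) (hits v l) = 0%E ->
  {ae law k, forall h, v *m (h : 'M[R]_r) *m l = 0}.
Proof.
move=> E0; have := ae_Ex_fin (hits_ge0 v l) E0 (measurable_hits v l).
apply: ae_imp => h /eqP; rewrite mulf_eq0 invr_eq0 (gt_eqF (ltr_wpDr (N1_ge0 _) ltr01)).
by rewrite orbF N1_eq0 => /eqP.
Qed.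

(** Otherwise the vectors paired to zero with almost every [v *m h], for every time, form a nonzero
    subspace [A], because it contains [l]. Its annihilator [N] is invariant and nonzero, hence
    everything by irreducibility, which forces [A] to be zero. *)
Lemma exists_hit (v : 'rV[R]_r) (l : 'cV[R]_r) : irreducible_law -> v != 0 -> l != 0 ->
  exists k, (0 < Ex (law k) (hits v l))%E.
Proof.
move=> irr v0 l0; apply: contrapT => nohit.
have E0 k : Ex (law k) (hits v l) = 0%E.
  apply/eqP; rewrite eq_le Ex_ge0 ?andbT; last exact: hits_ge0.
  by rewrite leNgt; apply/negP => ?; apply: nohit; exists k.
pose S (x : 'rV[R]_r) := forall k, {ae law k, forall h, v *m (h : 'M[R]_r) *m x^T = 0}.
have [A AS] : exists A : 'M[R]_r, forall x, S x <-> (x <= A)%MS.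
  apply: subspace_rowspace.
    by move=> k; apply: aeW => h; rewrite trmx0 mulmx0.
  move=> c x y Sx Sy k; apply: ae_imp2 (Sx k) (Sy k) => h hx hy.
  by rewrite linearP/= mulmxDr -scalemxAr hx hy scaler0 addr0.
have SA x : S x -> (x <= A)%MS by move=> /AS.
have Sl : S l^T by move=> k; rewrite trmxK; exact: Ex_hits_eq0.
have A0 : A != 0.
  apply/negP => /eqP A0; move: (SA _ Sl); rewrite A0 submx0 => /eqP /(congr1 trmx).
  by rewrite trmxK trmx0 => /eqP; rewrite (negbTE l0).
have Srow i : S (row i A) by apply/AS; exact: row_sub.
pose N := kermx A^T.
have mQ (x : 'rV[R]_r) : measurable [set h : M | v *m (h : 'M[R]_r) *m x^T = 0].
  rewrite (_ : [set _ | _] = [set h : M | N1 (v *m (h : 'M[R]_r) *m x^T) <= 0]).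
    apply: measurable_set_le => //; apply: measurable_N1.
    by do 2 apply: measurable_mulmx => //; exact: measurable_id.
  apply/seteqP; split => h /=; first by move=> /eqP; rewrite -N1_eq0 => /eqP ->.
  by move=> h0; apply/eqP; rewrite -N1_eq0 eq_le h0 N1_ge0.
(* Invariance is proved on the dual side: splitting the law at time [k + n] shows that [A] is stable
   under the transpose of almost every [g], hence its annihilator under [g] itself. *)
have stab n : {ae law n, forall g, (N *m (g : 'M[R]_r) <= N)%MS}.
  have Sg : {ae law n, forall g, forall i, S ((row i A) *m (g : 'M[R]_r)^T)}.
    apply: ae_forall_fin => i; apply: ae_forall_nat => k.
    have := conv_sg_ae_swap sg (mQ (row i A)) (Srow i (k + n)%N).
    apply: ae_imp => g; apply: ae_imp => h /=.
    by rewrite trmx_mul trmxK !mulmxA.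
  apply: ae_imp Sg => g Sg; apply/sub_kermxP.
  have /submxP[D AgD] : (A *m (g : 'M[R]_r)^T <= A)%MS.
    by apply/row_subP => i; rewrite row_mul; exact: SA.
  move/(congr1 trmx): AgD; rewrite !trmx_mul trmxK => AgD.
  by rewrite -mulmxA AgD mulmxA mulmx_ker mul0mx.
(* The law at time 0 is not assumed to be the point mass at the identity, so the nonzero vector of
   [N] is [v *m h] for a typical invertible [h] rather than [v]. *)
have vN : exists2 u : 'rV[R]_r, u != 0 & (u <= N)%MS.
  have : {ae law 0%N, forall h, (h : 'M[R]_r) \in unitmx /\
      (v *m (h : 'M[R]_r) <= N)%MS}.
    have Sh : {ae law 0%N, forall h, forall i, v *m (h : 'M[R]_r) *m (row i A)^T = 0}.
      by apply: ae_forall_fin => i; exact: Srow.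
    apply: ae_imp2 (ae_unit 0) Sh => h uh Sh; split => //; apply/sub_kermxP.
    apply: trmx_inj; rewrite trmx0 trmx_mul trmxK; apply/row_matrixP => i.
    rewrite row_mul row0 -[LHS]trmxK trmx_mul trmxK.
    by rewrite Sh trmx0.
  move=> /ae_exists[h [uh vhN]]; exists (v *m (h : 'M[R]_r)) => //.
  by apply: contra_neq v0 => vh0; rewrite -(mulmxK uh v) vh0 mul0mx.
have N0 : N != 0.
  case: vN => u u0 uN; apply: contra_neq u0 => N0.
  by move: uN; rewrite N0 submx0 => /eqP.
have := irr N stab N0; rewrite -sub1mx => /submx_trans/(_ (submx_refl _)).
move=> /sub_kermxP; rewrite mul1mx => /(congr1 trmx); rewrite trmxK trmx0.
by move/eqP; rewrite (negbTE A0).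
Qed.

(** Compactness of the product of two unit spheres. One integer [K] bounds the times and gives the
    lower bound: the sums grow with [K] and the thresholds decrease, so the largest index of a
    finite subcover works for all pairs. *)
Lemma uniform_hits : irreducible_law ->
  exists K : nat, forall (v : 'rV[R]_r) (l : 'cV[R]_r), N1 v = 1 -> N1 l = 1 ->
  K.+1%:R^-1 <= \sum_(k < K) fine (Ex (law k) (hits v l)).
Proof.
move=> irr.
pose A := [set z : 'rV[R]_(r + r) | N1 (lsubmx z) = 1 /\ N1 (rsubmx z) = 1].
have lsubE (z : 'rV[R]_(r + r)) : lsubmx z = z *m col_mx 1%:M 0.
  by rewrite -{2}(hsubmxK z) mul_row_col mulmx1 mulmx0 addr0.
have rsubE (z : 'rV[R]_(r + r)) : rsubmx z = z *m col_mx 0 1%:M.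
  by rewrite -{2}(hsubmxK z) mul_row_col mulmx1 mulmx0 add0r.
have cA : compact A.
  apply: bounded_closed_compact.
    exists 2; split; first exact: num_real.
    move=> M M2 z [lz rz]; rewrite /= (le_trans _ (ltW M2))// (le_trans (norm_le_N1 z))//.
    have -> : N1 z = N1 (lsubmx z) + N1 (rsubmx z).
      rewrite /N1 !big_ord1 big_split_ord/=.
      by congr (_ + _); apply: eq_bigr => i _; rewrite mxE.
    by rewrite lz rz; lra.
  have -> : A = (fun z => N1 (z *m col_mx 1%:M 0)) @^-1` [set 1] `&`
                (fun z => N1 (z *m col_mx 0 1%:M)) @^-1` [set 1].
    by apply/seteqP; split => z; rewrite /A/= lsubE rsubE.
  by apply: closedI; apply: preimage_closed => [z _|];
    [exact: continuous_N1_mul|exact: closed_eq|exact: continuous_N1_mul|exact: closed_eq].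
move: cA; rewrite compact_cover.
move=> /(_ nat setT (fun K => [set z | K.+1%:R^-1 < Fhit K z])) [|z [lz rz]|D _ AD].
- move=> K _; rewrite (_ : [set _ | _] = Fhit K @^-1` [set x | K.+1%:R^-1 < x])//.
  apply: open_comp => [z _|]; first exact: Fhit_continuous.
  exact: open_gt.
- have v0 : lsubmx z != 0 by rewrite -N1_eq0 lz oner_eq0.
  have l0 : (rsubmx z)^T != 0 by rewrite -N1_eq0 N1_tr rz oner_eq0.
  have [k Ek] := exists_hit irr v0 l0.
  have {}Ek : 0 < fine (Ex (law k) (hits (lsubmx z) (rsubmx z)^T)).
    by apply: fine_gt0; rewrite Ek -ge0_fin_numE ?Ex_hits_fin// Ex_ge0//; exact: hits_ge0.
  set e := fine _ in Ek.
  (* The first argument brings the time [k] into the sum, the second brings the threshold below the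
     value [e] of its term. *)
  exists (maxn k.+1 (Num.truncn e^-1)) => //=.
  apply: (@lt_le_trans _ _ e).
    rewrite -[ltRHS]invrK ltf_pV2 ?posrE ?invr_gt0//.
    rewrite (lt_le_trans (truncnS_gt _))// ler_nat ltnS leq_maxr//.
  rewrite /Fhit (bigD1 (Ordinal (leq_maxl k.+1 (Num.truncn e^-1))))//= lerDl.
  by apply: sumr_ge0 => i _; rewrite fine_ge0// Ex_ge0//; exact: hits_ge0.
exists (\max_(k <- D) k)%N => v l v1 l1.
have /AD[k /= kD Fk] : A (row_mx v l^T).
  by split => /=; rewrite ?row_mxKl ?row_mxKr ?N1_tr.
have kmax : (k <= \max_(j <- D) j)%N by apply: (@leq_bigmax_seq _ _ xpredT id).
move: Fk; rewrite /Fhit row_mxKl row_mxKr trmxK => /ltW Fk.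
rewrite (@le_trans _ _ k.+1%:R^-1)// ?lef_pV2 ?posrE ?ler_nat//.
rewrite (le_trans Fk)// -!(big_mkord xpredT (fun k => fine (Ex (law k) (hits v l)))).
rewrite (big_cat_nat _ kmax)//= lerDl.
by apply: sumr_ge0 => i _; rewrite fine_ge0// Ex_ge0//; exact: hits_ge0.
Qed.

End UniformIrreducibility.

(** * First-order expansions of exponentials *)

Section ExpIneq.
Variable R : realType.
Implicit Types (t s a b d y z L : R).

Lemma expRN_le t : 0 <= t -> expR (- t) <= 1 - t + t ^+ 2.
Proof.
move=> t0; rewrite expRN.
have t1 : 0 < 1 + t by lra.
apply: (@le_trans _ _ (1 + t)^-1).
  by rewrite lef_pV2 ?posrE ?expR_gt0// expR_ge1Dx.
rewrite -[X in X <= _]mul1r ler_pdivrMr//.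
have : 0 <= t ^+ 3 by rewrite exprn_ge0.
lra.
Qed.

Lemma expR_le_mul s : expR s <= 1 + s * expR s.
Proof.
have := expR_ge1Dx (- s); rewrite expRN => h.
have e0 := expR_gt0 s.
have := ler_wpM2r (ltW e0) h; rewrite mulVf ?gt_eqF//; lra.
Qed.

Lemma expR_le_quad t : 0 <= t -> expR t <= 1 + t + t ^+ 2 * expR t.
Proof.
move=> t0; have := expR_le_mul t; have := expR_gt0 t.
set e := expR t => e0 h.
have : 0 <= t * (1 + t * e - e) by rewrite mulr_ge0// subr_ge0.
nra.
Qed.

Lemma le_expR t : t <= expR t.
Proof. by have := expR_ge1Dx t; lra. Qed.

Lemma le_expR_scale a t : 0 < a -> t <= a^-1 * expR (a * t).
Proof.
by move=> a0; rewrite mulrC ler_pdivlMr// mulrC; exact: le_expR.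
Qed.

Lemma sqr_le_expR a t : 0 < a -> 0 <= t -> t ^+ 2 <= 2 / a ^+ 2 * expR (a * t).
Proof.
move=> a0 t0; have := @expR_ge1Dxn R (a * t) 1 (mulr_ge0 (ltW a0) t0).
rewrite (_ : (1.+1)`!%:R = 2 :> R)// => h.
rewrite mulrAC ler_pdivlMr ?exprn_gt0// -exprMn [t * a]mulrC; lra.
Qed.

(** The loss [ln t], once weighted by [t], costs at most 1 because [- (t * ln t) <= 1]. A hitting
    coefficient close to 0 is therefore harmless. *)
Lemma scaled_log_le t L : 0 < t -> t <= 1 ->
  t * Num.max 0 L <= Num.max 0 (L + ln t) + 1.
Proof.
move=> t0 t1; have lt0 : ln t <= 0 by exact: ln_le0.
have tln : - (t * ln t) <= 1.
  rewrite -mulrN -lnV ?posrE// mulrC -ler_pdivlMr// mul1r ltW// ln_sublinear//.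
  by rewrite invr_gt0.
have [L0|L0] := leP L 0.
  by rewrite mulr0 addr_ge0// le_max lexx.
have [LL|LL] := leP (L + ln t) 0.
  rewrite add0r (le_trans _ tln)// -mulrN ler_pM2l//; lra.
by nra.
Qed.

(** Compares an exponential moment of small exponent with the mean of the positive part. For
    positive [z] this is the second-order expansion; for negative [z] the linear factor is absorbed
    by the moment of the larger exponent [d1], at the price of one factor [d]. *)
Lemma expR_split_le d (d1 : R) z b : 0 < d -> d <= d1 / 2 -> `|z| <= b ->
  expR (- (d * z)) + d * Num.max 0 z <=
  1 + d ^+ 2 * b ^+ 2 + d * (2 / d1 * expR (- (d1 * z))).
Proof.
move=> d0 dd1 zb; have d10 : 0 < d1 by lra.
have z2 : z ^+ 2 <= b ^+ 2 by rewrite -real_normK ?num_real// ler_pXn2r ?nnegrE ?(le_trans _ zb).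
have E0 : 0 <= d * (2 / d1 * expR (- (d1 * z))).
  by rewrite mulr_ge0 ?(ltW d0)// mulr_ge0 ?divr_ge0 ?expR_ge0// ltW.
have D0 : 0 <= d ^+ 2 * b ^+ 2 by rewrite mulr_ge0// sqr_ge0.
have [z0|z0] := leP z 0.
  have h1 := expR_le_mul (- (d * z)).
  have h2 := @le_expR_scale (d1 / 2) (- z) ltac:(lra).
  suff : - (d * z) * expR (- (d * z)) <= d * (2 / d1 * expR (- (d1 * z))) by lra.
  rewrite (_ : - (d * z) * expR (- (d * z)) = d * (- z * expR (- (d * z)))); last by ring.
  rewrite ler_pM2l//.
  apply: (@le_trans _ _ ((d1 / 2)^-1 * expR (d1 / 2 * - z) * expR (- (d * z)))).
    by rewrite ler_wpM2r// expR_ge0.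
  rewrite invf_div -mulrA ler_wpM2l ?divr_ge0 ?(ltW d10)//.
  rewrite -expRD ler_expR; nra.
have h := @expRN_le (d * z) (mulr_ge0 (ltW d0) (ltW z0)).
have : (d * z) ^+ 2 <= d ^+ 2 * b ^+ 2.
  by rewrite exprMn ler_pM2l// exprn_gt0.
lra.
Qed.

(** The converse comparison, from the mean of the positive part to an exponential moment: as [d] is
    at most half of [a], the exponential of [a * b] dominates the quadratic remainder. *)
Lemma expR_pos_le d a y b : 0 < d -> d <= a / 2 -> `|y| <= b ->
  expR (d * y) <= 1 + d * Num.max 0 y + d ^+ 2 * (8 / a ^+ 2 * expR (a * b)).
Proof.
move=> d0 da yb; have a0 : 0 < a by lra.
have b0 : 0 <= b by rewrite (le_trans _ yb).
have E0 : 0 <= d ^+ 2 * (8 / a ^+ 2 * expR (a * b)).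
  by rewrite mulr_ge0 ?sqr_ge0// mulr_ge0 ?divr_ge0 ?sqr_ge0 ?expR_ge0.
have [y0|y0] := leP y 0.
  have : expR (d * y) <= 1 by rewrite expR_le1; nra.
  lra.
have := @expR_le_quad (d * y) (mulr_ge0 (ltW d0) (ltW y0)).
suff : (d * y) ^+ 2 * expR (d * y) <= d ^+ 2 * (8 / a ^+ 2 * expR (a * b)) by lra.
rewrite (_ : (d * y) ^+ 2 * expR (d * y) = d ^+ 2 * (y ^+ 2 * expR (d * y))); last by ring.
rewrite ler_pM2l ?exprn_gt0//.
have yb' : y <= b by rewrite (le_trans (ler_norm _)).
have := @sqr_le_expR (a / 2) y ltac:(lra) (ltW y0) => h.
apply: (@le_trans _ _ (2 / (a / 2) ^+ 2 * expR (a / 2 * y) * expR (d * y))).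
  by rewrite ler_wpM2r// expR_ge0.
rewrite -[leLHS]mulrA -expRD.
have -> : 2 / (a / 2) ^+ 2 = 8 / a ^+ 2 by field; lra.
rewrite ler_wpM2l ?divr_ge0 ?sqr_ge0// ler_expR; nra.
Qed.

End ExpIneq.

(** One bound at a single time [m] fixes the rate for all times: write [n] as a multiple of [m] plus
    a remainder. The constant adds up the costs [W] of all remainders below [m]. [Bd n U] stands for
    a moment at time [n] being at most [U]. *)
Lemma submult_growth (R : realType) (Bd : nat -> R -> Prop) (a : R) (m : nat) :
  (forall n k U V, 0 <= U -> 0 <= V -> Bd n U -> Bd k V -> Bd (n + k)%N (U * V)) ->
  (forall n U V, U <= V -> Bd n U -> Bd n V) ->
  (forall n, exists2 V, 0 <= V & Bd n V) ->
  (0 < m)%N -> Bd m (expR (a * m%:R)) ->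
  exists2 C, 0 <= C & forall n, Bd n (C * expR (a * n%:R)).
Proof.
move=> Bmul Bmono Bex m0 Bm.
have /choice[V VP] : forall n, exists V, 0 <= V /\ Bd n V.
  by move=> n; have [V] := Bex n; exists V.
pose W s := V s * expR (- (a * s%:R)).
have W0 s : 0 <= W s by rewrite mulr_ge0 ?expR_ge0//; have [] := VP s.
exists (\sum_(s < m) W s); first by apply: sumr_ge0.
move=> n; rewrite (divn_eq n m) addnC; set s := (n %% m)%N; set q := (n %/ m)%N.
have sm : (s < m)%N by rewrite ltn_mod.
apply: (Bmono _ (V s * expR (a * (q * m)%:R))).
  rewrite natrD mulrDr expRD mulrA ler_wpM2r ?expR_ge0//.
  rewrite -ler_pdivrMr ?expR_gt0// -expRN.
  by rewrite (bigD1 (Ordinal sm))//= lerDl; apply: sumr_ge0.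
elim: q => [|q IHq]; first by rewrite mul0n mulr0 expR0 mulr1 addn0; have [] := VP s.
rewrite mulSn addnCA natrD mulrDr expRD mulrCA.
apply: Bmul => //; rewrite ?expR_ge0//.
by rewrite mulr_ge0 ?expR_ge0//; have [] := VP s.
Qed.

Lemma lee_solve (R : realType) (a c d : R) (X : \bar R) : 0 < d -> (0 <= X)%E ->
  (a%:E + d%:E * X <= c%:E)%E -> (X <= ((c - a) / d)%:E)%E.
Proof.
move=> d0; case: X => [x||]// _; last by rewrite gt0_muley ?lte_fin.
by rewrite -EFinM -EFinD !lee_fin => H; rewrite ler_pdivlMr//; lra.
Qed.

(** * The growth dichotomy: rates and slow directions *)

Section GrowthRates.
Context (R : realType) (r : nat).
Local Notation M := (borel 'M[R]_r).
Implicit Type law : nat -> probability M R.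

Definition moments law (alpha : R) := [/\ 0 < alpha,
  forall n, {ae law n, forall g, (g : 'M[R]_r) \in unitmx} &
  forall n, (Ex (law n) (fun g : M => (Nb (g : 'M[R]_r) `^ alpha)%R) < +oo)%E].

(** All small exponents are required, since in the reducible case the two diagonal blocks have to be
    treated with a common exponent. A single exponent is enough for the lower rate, which is
    inherited from one block. *)
Definition upper_rate law (theta : R) := exists2 d0, 0 < d0 &
  forall d, 0 < d -> d <= d0 -> exists C, forall n,
  (Ex (law n) (fun g : M => (N1 (g : 'M[R]_r) `^ d)%R) <= (C * expR (d * theta * n%:R))%:E)%E.

Definition lower_rate law (theta : R) := exists2 d, 0 < d & exists C, forall n,
  (Ex (law n) (fun g : M => (N1 (g : 'M[R]_r) `^ (- d))%R) <=
   (C * expR (- (d * theta) * n%:R))%:E)%E.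

(** Uniformity in the direction is what makes these bounds submultiplicative: the second factor
    starts from the direction that the first one has produced. *)
Definition vec_bound law (d : R) n (U : R) := forall x : 'rV[R]_r, N1 x = 1 ->
  (Ex (law n) (fun g : M => (N1 (x *m (g : 'M[R]_r)) `^ (- d))%R) <= U%:E)%E.

End GrowthRates.

Section Alternative.
Context (R : realType) (r : nat) (r0 : (0 < r)%N).
Local Notation M := (borel 'M[R]_r).
Variable law : nat -> probability M R.
Hypothesis sg : conv_sg law.
Variable alpha : R.
Hypothesis mom : moments law alpha.

Let alpha0 : 0 < alpha. Proof. by case: mom. Qed.
Let aeU n : {ae law n, forall g, (g : 'M[R]_r) \in unitmx}. Proof. by case: mom. Qed.
Let momfin n : (Ex (law n) (fun g : M => (Nb (g : 'M[R]_r) `^ alpha)%R) < +oo)%E.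
Proof. by case: mom. Qed.

Let mNb d : measurable_fun [set: M] (fun g : M => (Nb (g : 'M[R]_r) `^ d)%R).
Proof. by apply: measurable_fun_powR; apply: measurable_Nb; exact: measurable_id. Qed.

Let mN1 m (L : 'M[R]_(m, r)) d : measurable_fun [set: M] (fun g : M => (N1 (L *m (g : 'M[R]_r)) `^ d)%R).
Proof.
apply: measurable_fun_powR; apply: measurable_N1; apply: measurable_mulmx => //.
Qed.

Let mN d : measurable_fun [set: M] (fun g : M => (N1 (g : 'M[R]_r) `^ d)%R).
Proof. by apply: measurable_fun_powR; apply: measurable_N1; exact: measurable_id. Qed.

Definition momC n := fine (Ex (law n) (fun g : M => (Nb (g : 'M[R]_r) `^ alpha)%R)).

Lemma momC_ge0 n : 0 <= momC n.
Proof. by rewrite fine_ge0// Ex_ge0// => g; exact: powR_ge0. Qed.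

Lemma momCE n : Ex (law n) (fun g : M => (Nb (g : 'M[R]_r) `^ alpha)%R) = (momC n)%:E.
Proof. by rewrite fineK// ge0_fin_numE// Ex_ge0// => g; exact: powR_ge0. Qed.

Lemma N1_unit_gt0 (x : 'rV[R]_r) (g : 'M[R]_r) : g \in unitmx -> N1 x = 1 -> 0 < N1 (x *m g).
Proof.
move=> ug x1; rewrite N1_gt0; apply/negP => /eqP xg0.
move: x1; rewrite -(mulmxK ug x) xg0 mul0mx => /eqP.
by rewrite (_ : N1 _ = 0) ?(eq_sym 0) ?oner_eq0//; apply/eqP; rewrite N1_eq0.
Qed.

Lemma powRN_le (d x y : R) : 0 < x -> 0 <= d -> x <= y -> y `^ (- d) <= x `^ (- d).
Proof.
move=> x0 d0 xy; have y0 := lt_le_trans x0 xy.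
rewrite !powRN lef_pV2 ?posrE ?powR_gt0//.
by apply: ge0_ler_powR; rewrite // nnegrE ltW.
Qed.

Lemma NbV_le (x : 'rV[R]_r) (g : 'M[R]_r) : g \in unitmx -> N1 x = 1 ->
  (Nb g)^-1 <= N1 (x *m g).
Proof.
move=> ug x1; have := N1_mulV x ug; rewrite x1.
have Nb0 : 0 < Nb g by rewrite (lt_le_trans ltr01)// Nb_ge1.
by rewrite -ler_pdivrMr// mul1r.
Qed.

Lemma vec_bound_ex d n : 0 < d -> d <= alpha -> vec_bound law d n (momC n).
Proof.
move=> d0 da x x1; rewrite -momCE; apply: Ex_le_ae => //.
- by move=> g; exact: powR_ge0.
- by move=> g; exact: powR_ge0.
apply: ae_imp (aeU n) => g ug.
have Nb1 := Nb_ge1 r0 ug; have Nb0 : 0 < Nb (g : 'M[R]_r) by rewrite (lt_le_trans ltr01).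
apply: (@le_trans _ _ (Nb (g : 'M[R]_r) `^ d)); last exact: ler_powR.
apply: (le_trans (powRN_le _ (ltW d0) (NbV_le ug x1))).
  by rewrite invr_gt0.
by rewrite -powR_inv1 ?(ltW Nb0)// -powRrM mulN1r opprK.
Qed.

Lemma vec_bound_mul d n k U V : 0 <= U -> 0 <= V -> vec_bound law d n U ->
  vec_bound law d k V -> vec_bound law d (n + k)%N (U * V).
Proof.
move=> U0 V0 bU bV x x1; rewrite mulrC EFinM.
apply: (@le_trans _ _ (V%:E * Ex (law n) (fun g : M => (N1 (x *m (g : 'M[R]_r)) `^ (- d))%R))%E); last first.
  by rewrite lee_wpmul2l ?lee_fin// bU.
apply: (conv_sg_le sg) => //; try by move=> g; exact: powR_ge0.
apply: ae_imp (aeU n) => g ug.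
have xg0 := N1_unit_gt0 ug x1; set c := N1 _ in xg0 *.
pose y := c^-1 *: (x *m (g : 'M[R]_r)).
have y1 : N1 y = 1 by rewrite N1Z ger0_norm ?invr_ge0 ?(ltW xg0)// mulVf// gt_eqF.
have E (h : M) : N1 (x *m ((g : 'M[R]_r) *m (h : 'M[R]_r))) `^ (- d) =
    c `^ (- d) * N1 (y *m (h : 'M[R]_r)) `^ (- d).
  rewrite -powRM ?N1_ge0 ?(ltW xg0)//; congr (_ `^ _).
  rewrite /y -scalemxAl N1Z ger0_norm ?invr_ge0 ?(ltW xg0)// mulmxA.
  by rewrite mulrA divff ?mul1r// gt_eqF.
rewrite (_ : Ex _ _ = Ex (law k) (fun h : M => (c `^ (- d) * N1 (y *m (h : 'M[R]_r)) `^ (- d))%R)); last first.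
  by congr Ex; apply/funext => h; exact: E.
rewrite ExZ ?powR_ge0//; last by move=> h; exact: powR_ge0.
by rewrite mulrC EFinM lee_wpmul2l ?lee_fin ?powR_ge0// bV.
Qed.

Lemma vec_bound_growth d b m : 0 < d -> d <= alpha -> (0 < m)%N ->
  vec_bound law d m (expR (- (d * b) * m%:R)) ->
  exists2 C, 0 <= C & forall n, vec_bound law d n (C * expR (- (d * b) * n%:R)).
Proof.
move=> d0 da m0 H.
apply: (@submult_growth R (vec_bound law d) (- (d * b)) m) => //.
- by move=> n k U V U0 V0; exact: vec_bound_mul.
- by move=> n U V UV bU x x1; rewrite (le_trans (bU x x1))// lee_fin.
- by move=> n; exists (momC n); [exact: momC_ge0|exact: vec_bound_ex].
Qed.

Lemma vec_bound_lower_rate d b m : 0 < d -> d <= alpha -> (0 < m)%N ->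
  vec_bound law d m (expR (- (d * b) * m%:R)) -> lower_rate law b.
Proof.
move=> d0 da m0 H; have [C C0 HC] := vec_bound_growth d0 da m0 H.
exists d => //; exists C => n.
pose x : 'rV[R]_r := delta_mx 0 (Ordinal r0).
have x1 : N1 x = 1.
  rewrite /N1 big_ord1 (bigD1 (Ordinal r0))//= mxE !eqxx normr1 big1 ?addr0// => j jr.
  by rewrite mxE eqxx (negbTE jr) normr0.
apply: le_trans (HC n x x1); apply: Ex_le_ae => //.
- by move=> g; exact: powR_ge0.
- by move=> g; exact: powR_ge0.
apply: ae_imp (aeU n) => g ug; apply: powRN_le; rewrite ?N1_unit_gt0 ?(ltW d0)//.
by rewrite (le_trans (N1M _ _))// x1 mul1r.
Qed.

(** A certificate, at a single time [m], that negative moments decay at rate [b] in every direction;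
    submultiplicativity extends it to all times. *)
Definition slow d m b := [/\ 0 < d, d <= alpha, (0 < m)%N & vec_bound law d m (expR (- (d * b) * m%:R))].

(* Replaces the supremum of the admissible rates: b is admissible, b + eta is not. *)
Lemma slow_threshold theta eta : 0 < eta -> ~ lower_rate law theta ->
  exists b, [/\ b <= theta, exists d m, slow d m b & forall d m, ~ slow d m (b + eta)].
Proof.
move=> eta0 nlow.
(* Chosen so that [expR (- (alpha * t0))] is [1 + momC 1]: the trivial moment bound at time 1 is
   already a certificate, so admissible rates exist. *)
pose t0 := - ln (1 + momC 1) / alpha.
have st0 : slow alpha 1 t0.
  split => // x x1; rewrite (le_trans (vec_bound_ex 1 alpha0 (lexx _) x1))// lee_fin mulr1.
  rewrite /t0 mulrCA divff ?gt_eqF// mulr1 opprK lnK ?posrE ?lerDr//.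
  by rewrite ltr_pwDl// momC_ge0.
have mono d m b b' : b' <= b -> slow d m b -> slow d m b'.
  move=> bb' [d0 da m0 H]; split => // x x1; rewrite (le_trans (H x x1))// lee_fin.
  by rewrite ler_expR ler_wpM2r// lerN2 ler_wpM2l// ltW.
have le_theta d m b : slow d m b -> b <= theta.
  move=> sb; rewrite leNgt; apply/negP => tb; apply: nlow.
  by have [d0 da m0 H] := mono _ _ _ _ (ltW tb) sb; exact: vec_bound_lower_rate H.
apply: contrapT => H.
(* If every admissible rate could be raised by [eta], then all [t0 + eta * k] would be admissible
   and would eventually exceed [theta]. *)
have all k : exists d m, slow d m (t0 + eta * k%:R).
  elim: k => [|k [d [m IH]]]; first by exists alpha, 1%N; rewrite mulr0 addr0.
  apply: contrapT => nS; apply: H; exists (t0 + eta * k%:R); split.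
  - exact: le_theta IH.
  - by exists d, m.
  - move=> d' m' S'; apply: nS; exists d', m'; move: S'.
    by rewrite -addrA -[X in _ + (_ + X)]mulr1 -mulrDr -natr1.
pose k := Num.truncn ((theta - t0) / eta).
have [d [m /le_theta]] := all k.+1.
rewrite leNgt => /negP; apply; rewrite -ltrBlDl -ltr_pdivrMl// mulrC.
exact: truncnS_gt.
Qed.

Lemma ln_bound (v : 'rV[R]_r) (g : 'M[R]_r) : g \in unitmx -> N1 v = 1 ->
  `|ln (N1 (v *m g))| <= ln (Nb g).
Proof.
move=> ug v1; have Nb0 : 0 < Nb g by rewrite (lt_le_trans ltr01)// Nb_ge1.
have p0 := N1_unit_gt0 ug v1.
rewrite ler_norml -lnV ?posrE// !ler_ln ?posrE ?invr_gt0// NbV_le//=.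
by rewrite (le_trans (N1_mul_Nb _ _))// v1 mul1r.
Qed.

Let mln m (L : 'M[R]_(m, r)) c : measurable_fun [set: M]
  (fun g : M => Num.max 0 (ln (N1 (L *m (g : 'M[R]_r))) - c)).
Proof.
apply: measurable_maxr => //; apply: measurable_funB => //.
by apply: measurable_fun_ln; apply: measurable_N1; apply: measurable_mulmx.
Qed.

(** As the rate [b + eta] is refuted at time [n], some direction has a negative moment above
    [1 - d * eta * n] after centring at [b * n]. By [expR_split_le] the mean excess of that
    direction is then small, its downward deviations being paid by the certificate at rate [b]. *)
Lemma slow_vector eta d1 m1 b : 0 < eta -> slow d1 m1 b ->
  (forall d m, ~ slow d m (b + eta)) ->
  exists2 C, 0 <= C & forall n, (0 < n)%N -> exists2 v : 'rV[R]_r, N1 v = 1 &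
  (Ex (law n) (fun g : M => Num.max 0%R (ln (N1 (v *m (g : 'M[R]_r))) - b * n%:R)%R)
     <= (eta * n%:R + C)%:E)%E.
Proof.
move=> eta0 [d10 d1a m10 Hm1] nslow.
have [C1 C10 HC1] := vec_bound_growth d10 d1a m10 Hm1.
exists (1 + 2 / d1 * C1); first by rewrite addr_ge0// mulr_ge0 ?divr_ge0// ltW.
move=> n n0.
pose c := 2 / alpha ^+ 2 * expR (alpha * (`|b| * n%:R)).
have c0 : 0 <= c by rewrite mulr_ge0 ?expR_ge0// divr_ge0 ?sqr_ge0.
pose D := c * momC n.
have D0 : 0 <= D by rewrite mulr_ge0 ?momC_ge0.
(* The exponent may depend on [n]. The first bound is the range of the expansion; the second makes
   the quadratic term cost at most 1 after division by [d], although [D] grows with [n]. The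
   constant [C] is therefore the same for all [n]. *)
pose d := Num.min (d1 / 2) (D + 1)^-1.
have d0 : 0 < d by rewrite lt_min divr_gt0//= invr_gt0 ltr_wpDl.
have dd1 : d <= d1 / 2 by rewrite ge_min lexx.
have dD : d * D <= 1.
  rewrite (@le_trans _ _ ((D + 1)^-1 * D))// ?ler_wpM2r// ?ge_min ?lexx ?orbT//.
  by rewrite mulrC ler_pdivrMr ?ltr_wpDl// mul1r lerDl.
have [v [v1 Hv]] : exists v : 'rV[R]_r, N1 v = 1 /\
   ((expR (- (d * (b + eta)) * n%:R))%:E < Ex (law n) (fun g : M => (N1 (v *m (g : 'M[R]_r)) `^ (- d))%R))%E.
  apply: contrapT => H; apply: (nslow d n); split => //; first by lra.
  move=> x x1; rewrite leNgt; apply/negP => Hx; apply: H.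
  by exists x.
exists v => //.
pose p (g : M) := N1 (v *m (g : 'M[R]_r)).
pose f (g : M) := expR (d * b * n%:R) * p g `^ (- d) + d * Num.max 0 (ln (p g) - b * n%:R).
pose h (g : M) := (1 + d ^+ 2 * c * Nb (g : 'M[R]_r) `^ alpha) +
   d * (2 / d1) * expR (d1 * b * n%:R) * p g `^ (- d1).
have max0 (g : M) : 0 <= Num.max 0 (ln (p g) - b * n%:R) by rewrite le_max lexx.
have k0 : 0 <= d * (2 / d1) * expR (d1 * b * n%:R).
  by rewrite !mulr_ge0 ?expR_ge0 ?invr_ge0 ?(ltW d0) ?(ltW d10).
have k10 : 0 <= d ^+ 2 * c by rewrite mulr_ge0 ?sqr_ge0.
have f0 g : 0 <= f g by rewrite addr_ge0// mulr_ge0 ?expR_ge0 ?powR_ge0// ltW.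
have h10 (g : M) : 0 <= 1 + d ^+ 2 * c * Nb (g : 'M[R]_r) `^ alpha.
  apply: addr_ge0 => //; apply: mulr_ge0; last exact: powR_ge0.
  by apply: mulr_ge0 => //; exact: sqr_ge0.
have h0 g : 0 <= h g by rewrite addr_ge0// mulr_ge0 ?powR_ge0.
have mp e : measurable_fun [set: M] (fun g : M => p g `^ e) by exact: mN1.
have mf1 : measurable_fun [set: M] (fun g : M => expR (d * b * n%:R) * p g `^ (- d)).
  exact: measurable_fun_scale.
have mf2 : measurable_fun [set: M] (fun g : M => d * Num.max 0 (ln (p g) - b * n%:R)).
  by apply: measurable_fun_scale; exact: mln.
have mh1 : measurable_fun [set: M] (fun g : M => 1 + d ^+ 2 * c * Nb (g : 'M[R]_r) `^ alpha).
  by apply: measurable_funD => //; exact: measurable_fun_scale.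
have mh2 : measurable_fun [set: M] (fun g : M => d * (2 / d1) * expR (d1 * b * n%:R) * p g `^ (- d1)).
  exact: measurable_fun_scale.
have Efh : (Ex (law n) f <= Ex (law n) h)%E.
  apply: Ex_le_ae => //; try by apply: measurable_funD.
  apply: ae_imp (aeU n) => g ug.
  have p0 : 0 < p g by exact: N1_unit_gt0.
  have Nb1 := Nb_ge1 r0 ug.
  have lnp := ln_bound ug v1.
  set z := ln (p g) - b * n%:R.
  have zb : `|z| <= ln (Nb (g : 'M[R]_r)) + `|b| * n%:R.
    rewrite (le_trans (ler_normB _ _))// lerD// normrM ler_wpM2l//.
    by rewrite ger0_norm.
  have := expR_split_le d0 dd1 zb.
  have pE e : expR (- (e * z)) = expR (e * b * n%:R) * p g `^ (- e).
    rewrite /powR gt_eqF// -expRD; congr expR; rewrite /z; ring.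
  rewrite !pE => /le_trans; apply; rewrite /h lerD//; last by rewrite !mulrA.
  rewrite lerD2l -mulrA ler_wpM2l ?sqr_ge0//.
  rewrite (le_trans (sqr_le_expR alpha0 _))//.
    by rewrite addr_ge0 ?ln_ge0// mulr_ge0.
  rewrite /c -[leRHS]mulrA ler_wpM2l ?divr_ge0 ?sqr_ge0// mulrDr expRD mulrC ler_wpM2l ?expR_ge0//.
  by rewrite /powR gt_eqF// (lt_le_trans ltr01).
have Eh : (Ex (law n) h <= (1 + d ^+ 2 * D + d * (2 / d1 * C1))%:E)%E.
  rewrite ExD//; last by move=> g; rewrite mulr_ge0 ?powR_ge0.
  rewrite EFinD leeD//.
    rewrite ExD//; last 2 first.
    - by move=> g; exact: mulr_ge0 k10 (powR_ge0 _ _).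
    - exact: measurable_fun_scale.
    rewrite Ex_cst ExZ//; last by move=> g; exact: powR_ge0.
    by rewrite momCE -EFinM -EFinD lee_fin /D !mulrA lexx.
  rewrite ExZ//; last by move=> g; exact: powR_ge0.
  rewrite (@le_trans _ _ ((d * (2 / d1) * expR (d1 * b * n%:R))%:E *
     (C1 * expR (- (d1 * b) * n%:R))%:E)%E)//.
    by rewrite lee_wpmul2l ?lee_fin// HC1.
  have ee : expR (d1 * b * n%:R) * expR (- (d1 * b) * n%:R) = 1.
    by rewrite -expRD mulNr addrN expR0.
  rewrite -EFinM lee_fin le_eqVlt; apply/orP; left; apply/eqP.
  transitivity (d * (2 / d1 * C1) * (expR (d1 * b * n%:R) * expR (- (d1 * b) * n%:R))).
    by ring.
  by rewrite ee mulr1.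
have Ef : ((1 - d * eta * n%:R)%:E + d%:E * Ex (law n) (fun g => Num.max 0%R (ln (p g) - b * n%:R)%R) <= Ex (law n) f)%E.
  rewrite /f ExD//; last 2 first.
  - by move=> g; rewrite mulr_ge0 ?expR_ge0 ?powR_ge0.
  - by move=> g; rewrite mulr_ge0 ?(ltW d0).
  rewrite leeD//; last by rewrite ExZ ?(ltW d0)//; exact: mln.
  rewrite ExZ ?expR_ge0//; last by move=> g; exact: powR_ge0.
  apply: (@le_trans _ _ ((expR (d * b * n%:R))%:E * (expR (- (d * (b + eta)) * n%:R))%:E)%E).
    rewrite -EFinM lee_fin -expRD.
    have -> : d * b * n%:R + - (d * (b + eta)) * n%:R = - (d * eta * n%:R) by ring.
    exact: expR_ge1Dx.
  by rewrite lee_wpmul2l ?lee_fin ?expR_ge0// ltW.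
have := lee_solve d0 (Ex_ge0 _ max0) (le_trans Ef (le_trans Efh Eh)).
move=> /le_trans; apply; rewrite lee_fin ler_pdivrMr//.
have : d * (d * D) <= d * 1 by rewrite ler_pM2l.
lra.
Qed.

End Alternative.

Lemma N1_max_col (R : realType) m n (n0 : (0 < n)%N) (g : 'M[R]_(m, n)) :
  exists j, N1 g <= n%:R * N1 (col j g).
Proof.
pose j := [arg max_(i > Ordinal n0) N1 (col i g)]%O.
have jmax i : N1 (col i g) <= N1 (col j g).
  by rewrite /j; case: arg_maxP => //= k _ kmax; exact: kmax.
exists j; rewrite [leLHS](_ : _ = \sum_i N1 (col i g)); last first.
  rewrite /N1 exchange_big; apply: eq_bigr => k _; apply: eq_bigr => i _.
  by rewrite big_ord1 mxE.
move: (N1 (col j g)) jmax => c jmax.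
by rewrite mulr_natl -[in leRHS](card_ord n) -sumr_const; apply: ler_sum => i _.
Qed.

Lemma N1_col_le (R : realType) m n (g : 'M[R]_(m, n)) j : N1 (col j g) <= N1 g.
Proof.
apply: ler_sum => i _; rewrite big_ord1 mxE (bigD1 j)//= lerDl.
by apply: sumr_ge0.
Qed.

(** * The dichotomy for irreducible laws *)

Section IrreducibleAlternative.
Context (R : realType) (r : nat) (r0 : (0 < r)%N).
Local Notation M := (borel 'M[R]_r).
Variable law : nat -> probability M R.
Hypothesis sg : conv_sg law.
Variable alpha : R.
Hypothesis mom : moments law alpha.
Hypothesis irr : irreducible_law law.

Let alpha0 : 0 < alpha. Proof. by case: mom. Qed.
Let aeU n : {ae law n, forall g, (g : 'M[R]_r) \in unitmx}. Proof. by case: mom. Qed.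
Local Notation momC := (momC law alpha).

Definition excess c (v : 'rV[R]_r) (g : M) : R :=
  Num.max 0 (ln (N1 (v *m (g : 'M[R]_r))) - c).

Lemma excess_ge0 c v g : 0 <= excess c v g. Proof. by rewrite le_max lexx. Qed.

Lemma measurable_excess c v : measurable_fun [set: M] (excess c v).
Proof.
apply: measurable_maxr => //; apply: measurable_funB => //.
by apply: measurable_fun_ln; apply: measurable_N1; apply: measurable_mulmx.
Qed.

(** The division by [r] is the price of replacing the norm by that of the largest column, the only
    part of the matrix that a hit detects. *)
Definition nexcess c (g : M) : R := Num.max 0 (ln (N1 (g : 'M[R]_r) / r%:R) - c).

Lemma nexcess_ge0 c g : 0 <= nexcess c g. Proof. by rewrite le_max lexx. Qed.

Lemma measurable_nexcess c : measurable_fun [set: M] (nexcess c).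
Proof.
apply: measurable_maxr => //; apply: measurable_funB => //.
apply: measurable_fun_ln; apply: measurable_funM => //.
by apply: measurable_N1; exact: measurable_id.
Qed.

(** A right factor [h] raises the logarithm by at most [ln (Nb h)], and this is at most [Nb h] to
    the power [alpha], divided by [alpha]. The increase does not depend on [n] or on the level
    [c]. *)
Lemma excess_step n k c v : N1 v = 1 ->
  (Ex (law (n + k)%N) (excess c v) <= Ex (law n) (excess c v) + (momC k / alpha)%:E)%E.
Proof.
move=> v1.
have mE := measurable_excess c v; have E0 := excess_ge0 c v.
have K0 : 0 <= momC k / alpha by rewrite divr_ge0 ?(ltW alpha0)// momC_ge0.
rewrite -(Ex_cst (law n)) -ExD//.
rewrite -[X in (_ <= X)%E]mul1e.
apply: (conv_sg_le sg) => //.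
- by move=> g; exact: addr_ge0.
- by apply: measurable_funD.
apply: ae_imp (aeU n) => g ug; rewrite mul1r EFinD -{1}(Ex_cst (law k) (excess c v g)).
have mNb : measurable_fun [set: M] (fun h : M => alpha^-1 * Nb (h : 'M[R]_r) `^ alpha).
  apply: measurable_fun_scale; apply: measurable_fun_powR.
  by apply: measurable_Nb; exact: measurable_id.
have -> : (momC k / alpha)%:E = Ex (law k) (fun h : M => alpha^-1 * Nb (h : 'M[R]_r) `^ alpha).
  rewrite ExZ ?invr_ge0 ?(ltW alpha0)//; last 2 first.
  - by move=> h; exact: powR_ge0.
  - by apply: measurable_fun_powR; apply: measurable_Nb; exact: measurable_id.
  by rewrite (momCE mom) -EFinM mulrC.
have p0 (h : M) : 0 <= alpha^-1 * Nb (h : 'M[R]_r) `^ alpha.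
  by rewrite mulr_ge0 ?powR_ge0 ?invr_ge0 ?(ltW alpha0).
rewrite -ExD//.
apply: Ex_le_ae => //.
- by move=> h; exact: addr_ge0.
- by apply: (measurableT_comp mE); apply: measurable_mulmx.
- by apply: measurable_funD.
apply: ae_imp (aeU k) => h uh.
have Nb0 : 0 < Nb (h : 'M[R]_r) by rewrite (lt_le_trans ltr01)// Nb_ge1.
have lnNb : ln (Nb (h : 'M[R]_r)) <= alpha^-1 * Nb (h : 'M[R]_r) `^ alpha.
  by rewrite /powR gt_eqF// (le_expR_scale _ alpha0).
rewrite /excess ge_max addr_ge0 ?le_max ?lexx//=.
apply: (@le_trans _ _ (ln (N1 (v *m (g : 'M[R]_r))) - c + ln (Nb (h : 'M[R]_r)))); last first.
  by rewrite lerD// le_max lexx orbT.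
have pg := N1_unit_gt0 ug v1.
have pgh := N1_unit_gt0 (unitmx_mulmx ug uh) v1.
rewrite addrAC lerD2r -lnM ?posrE// ler_ln ?posrE// ?mulr_gt0//.
by rewrite mulmxA N1_mul_Nb.
Qed.

(** If [h] moves [v] to a vector that pairs with the largest column of [g], then [v *m h *m g] is as
    large as [g] up to the coefficient [s] of the hit. The resulting loss [ln s] is absorbed by the
    weight [s], through [scaled_log_le]. *)
Lemma hits_excess v (g h : M) c j : N1 v = 1 -> (g : 'M[R]_r) \in unitmx ->
  N1 (g : 'M[R]_r) <= r%:R * N1 (col j (g : 'M[R]_r)) ->
  hits v ((N1 (col j (g : 'M[R]_r)))^-1 *: col j (g : 'M[R]_r)) h * nexcess c g <=
  excess c v ((h : 'M[R]_r) *m (g : 'M[R]_r)) + 1.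
Proof.
move=> v1 ug gj; set l := col j _ in gj *.
have g0 : 0 < N1 (g : 'M[R]_r).
  rewrite N1_gt0; apply: contraTneq (N1_unit_gt0 ug v1) => ->.
  by rewrite mulmx0 N1_gt0 eqxx.
have rr0 : 0 < r%:R :> R by rewrite ltr0n.
have l0 : 0 < N1 l by rewrite -(pmulr_rgt0 _ rr0) (lt_le_trans g0).
set s := hits _ _ _.
have s0 : 0 <= s by exact: hits_ge0.
have s1 : s <= 1.
  rewrite (le_trans (hits_bound _ _ _))// v1 mul1r N1Z ger0_norm ?invr_ge0 ?N1_ge0//.
  by rewrite mulVf// gt_eqF.
move: s0; rewrite le_eqVlt => /orP[/eqP <-|s0].
  by rewrite mul0r addr_ge0// excess_ge0.
rewrite (le_trans (scaled_log_le _ s0 s1))// lerD2r /excess.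
rewrite ge_max le_max lexx/= le_max; apply/orP; right.
have h1 : 0 < 1 + N1 (h : 'M[R]_r) by rewrite ltr_wpDr ?N1_ge0.
have sl : s * N1 l <= N1 (v *m (h : 'M[R]_r) *m l).
  rewrite /s /hits -scalemxAr N1Z ger0_norm ?invr_ge0 ?N1_ge0//.
  rewrite mulrAC (mulrC (N1 l)^-1) mulfVK ?gt_eqF// ler_pdivrMr// ler_peMr ?N1_ge0//.
  by rewrite lerDl N1_ge0.
have {}sl : s * N1 l <= N1 (v *m ((h : 'M[R]_r) *m (g : 'M[R]_r))).
  by rewrite (le_trans sl)// /l colE !mulmxA -colE N1_col_le.
have gr0 : 0 < N1 (g : 'M[R]_r) / r%:R by rewrite divr_gt0.
have sl0 := mulr_gt0 s0 l0.
have grs : N1 (g : 'M[R]_r) / r%:R * s <= s * N1 l.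
  by rewrite mulrC ler_pM2l// ler_pdivrMr// mulrC.
have grs0 := mulr_gt0 gr0 s0; have pv := lt_le_trans sl0 sl.
by rewrite addrAC lerD2r -(lnM gr0 s0) ler_ln// (le_trans grs sl).
Qed.

(** Slow growth passes from one direction to the whole norm: put up to [K] extra factors in front of
    [g]. One of them turns [v] into a direction that detects [g], while by [excess_step] the extra
    factors raise the mean excess of [v] only by a constant. *)
Lemma norm_of_vector : exists K Q : R, [/\ 0 <= K, 0 <= Q & forall n v c B, N1 v = 1 -> 0 <= B ->
  (Ex (law n) (excess c v) <= B%:E)%E ->
  (Ex (law n) (nexcess c) <= (K * B + Q)%:E)%E].
Proof.
have [K HK] := uniform_hits sg aeU irr.
pose Q0 : R := \sum_(k < K) (momC k / alpha + 1).
have Q00 : 0 <= Q0.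
  by apply: sumr_ge0 => k _; rewrite addr_ge0// divr_ge0 ?(ltW alpha0)// momC_ge0.
exists (K.+1%:R * K%:R), (K.+1%:R * Q0).
split; [by rewrite mulr_ge0|by rewrite mulr_ge0|] => n v c B v1 B0 HB.
pose F k (g : M) : \bar R := (\int[law k]_h (excess c v ((h : 'M[R]_r) *m (g : 'M[R]_r)) + 1)%:E)%E.
have mE := measurable_excess c v; have E0 := excess_ge0 c v.
have mE1 : measurable_fun [set: M] (fun g : M => excess c v g + 1) by apply: measurable_funD.
have E10 (g : M) : 0 <= excess c v g + 1 by rewrite addr_ge0.
have F0 k g : (0 <= F k g)%E by apply: integral_ge0 => h _; rewrite lee_fin.
have mF k : measurable_fun [set: M] (F k).
  exact: (measurable_inner_swap law k E10 mE1).
have intF k : (\int[law n]_g F k g <= (B + (momC k / alpha + 1))%:E)%E.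
  rewrite -(conv_sg_swap sg k n E10 mE1) ExD// Ex_cst addnC addrA EFinD leeD2r//.
  by rewrite (le_trans (excess_step n k c v1))// EFinD leeD2r.
(* Pointwise in [g]: the hits over all times below [K] add up to at least 1/(K+1), uniformly in the
   direction of the largest column. *)
have pw : {ae law n, forall g : M, ((K.+1%:R^-1 * nexcess c g)%:E <= \sum_(k < K) F k g)%E}.
  apply: ae_imp (aeU n) => g ug.
  have [j gj] := N1_max_col r0 (g : 'M[R]_r).
  pose l := (N1 (col j (g : 'M[R]_r)))^-1 *: col j (g : 'M[R]_r).
  have l1 : N1 l = 1.
    have g0 : 0 < N1 (g : 'M[R]_r).
      rewrite N1_gt0; apply: contraTneq (N1_unit_gt0 ug v1) => ->.
      by rewrite mulmx0 N1_gt0 eqxx.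
    have c0 : 0 < N1 (col j (g : 'M[R]_r)).
      by rewrite -(@pmulr_rgt0 _ r%:R) ?ltr0n// (lt_le_trans g0).
    by rewrite /l N1Z ger0_norm ?invr_ge0 ?N1_ge0// mulVf// gt_eqF.
  apply: (@le_trans _ _ ((\sum_(k < K) fine (Ex (law k) (hits v l))) * nexcess c g)%:E).
    by rewrite lee_fin ler_wpM2r ?nexcess_ge0// HK.
  rewrite mulr_suml -sumEFin; apply: lee_sum => k _.
  rewrite EFinM fineK ?Ex_hits_fin// muleC -ExZ ?nexcess_ge0//; last 2 first.
  - exact: hits_ge0.
  - exact: measurable_hits.
  apply: Ex_le.
  - by move=> h; rewrite mulr_ge0 ?nexcess_ge0 ?hits_ge0.
  - by apply: measurable_fun_scale; exact: measurable_hits.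
  - by apply: (measurableT_comp mE1); apply: measurable_mulmx.
  - by move=> h; rewrite mulrC hits_excess.
have K0 : 0 < K.+1%:R^-1 :> R by rewrite invr_gt0.
have mn := measurable_nexcess c; have n0 := nexcess_ge0 c.
have : ((K.+1%:R^-1)%:E * Ex (law n) (nexcess c) <= (K%:R * B + Q0)%:E)%E.
  rewrite -ExZ ?(ltW K0)//.
  apply: (@le_trans _ _ (\int[law n]_g (\sum_(k < K) F k g))%E).
    apply: ae_ge0_le_integral => //.
    - by move=> g _; rewrite lee_fin mulr_ge0 ?(ltW K0).
    - by apply/measurable_EFinP; exact: measurable_fun_scale.
    - by move=> g _; exact: sume_ge0.
    - exact: emeasurable_sum.
    - by have := @filterS _ _ (ae_filter_ringOfSetsType (law n)) _ _ _ pw; apply => g Hg _.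
  rewrite ge0_integral_sum//.
  apply: (@le_trans _ _ (\sum_(k < K) (B + (momC k / alpha + 1))%:E)%E).
    by apply: lee_sum.
  by rewrite sumEFin lee_fin big_split/= sumr_const card_ord mulr_natl.
move=> H.
have := @lee_solve R 0 (K%:R * B + Q0) _ _ K0 (Ex_ge0 (law n) n0).
rewrite add0e => /(_ H) /le_trans; apply.
by rewrite lee_fin subr0 invrK mulrC le_eqVlt; apply/orP; left; apply/eqP; ring.
Qed.

(** To first order in [d], the moment of exponent [d] is governed by the mean excess. The constants
    are chosen in the order [eta], [n], [D], [d]; then the moment at the single time [n] obeys the
    desired rate and [submult_growth] extends it. *)
Lemma upper_rate_of_nexcess theta theta' : theta < theta' ->
  (forall eta, 0 < eta -> exists b C, [/\ b <= theta, 0 <= C & forall n, (0 < n)%N ->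
     (Ex (law n) (nexcess (b * n%:R)) <= (eta * n%:R + C)%:E)%E]) ->
  upper_rate law theta'.
Proof.
(* The gap is spent twice: one [eta] for the mean excess, the other for the constants
   [C + 1 + ln r], which a large [n] brings below [eta * n]. *)
move=> tt H; pose eta := (theta' - theta) / 2.
have eta0 : 0 < eta by rewrite divr_gt0// subr_gt0.
have [b [C [bt C0 HC]]] := H eta eta0.
pose n := (Num.truncn ((C + 1 + ln r%:R) / eta)).+1.
have nC : C + 1 + ln r%:R <= eta * n%:R.
  by rewrite -ler_pdivrMl// mulrC ltW// truncnS_gt.
have rr0 : 0 < r%:R :> R by rewrite ltr0n.
have lnr : 0 <= ln r%:R :> R by rewrite ln_ge0// ler1n.
pose Z := ln r%:R + `|b| * n%:R.
have Z0 : 0 <= Z by rewrite addr_ge0// mulr_ge0.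
pose D := 8 / alpha ^+ 2 * expR (alpha * Z) * momC n.
have c8 : 0 <= 8 / alpha ^+ 2 by rewrite divr_ge0// sqr_ge0.
have D0 : 0 <= D by rewrite /D mulr_ge0 ?momC_ge0// mulr_ge0 ?expR_ge0.
pose d0 := Num.min (alpha / 2) (D + 1)^-1.
exists d0; first by rewrite lt_min divr_gt0//= invr_gt0 ltr_wpDl.
move=> d d_gt0; rewrite le_min => /andP[da dD1].
have dD : d * D <= 1.
  rewrite (@le_trans _ _ ((D + 1)^-1 * D))// ?ler_wpM2r//.
  by rewrite mulrC ler_pdivrMr ?ltr_wpDl// mul1r lerDl.
pose c := b * n%:R.
have mN : measurable_fun [set: M] (fun g : M => N1 (g : 'M[R]_r) `^ d).
  by apply: measurable_fun_powR; apply: measurable_N1; exact: measurable_id.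
have mNb : measurable_fun [set: M] (fun g : M => Nb (g : 'M[R]_r) `^ alpha).
  by apply: measurable_fun_powR; apply: measurable_Nb; exact: measurable_id.
pose k1 := expR (d * (ln r%:R + c)).
pose k2 := k1 * d; pose k3 := k1 * (d ^+ 2 * (8 / alpha ^+ 2 * expR (alpha * Z))).
have k10 : 0 <= k1 by exact: expR_ge0.
have k20 : 0 <= k2 by rewrite mulr_ge0// ltW.
have k30 : 0 <= k3.
  by rewrite /k3 mulr_ge0// mulr_ge0 ?sqr_ge0// mulr_ge0 ?expR_ge0.
have nx0 := nexcess_ge0 c; have mnx := measurable_nexcess c.
have key : (Ex (law n) (fun g : M => (N1 (g : 'M[R]_r) `^ d)%R) <= (expR (d * theta' * n%:R))%:E)%E.
  apply: (@le_trans _ _ (Ex (law n) (fun g : M => ((k1 + k2 * nexcess c g) + k3 * Nb (g : 'M[R]_r) `^ alpha)%R))%E).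
    apply: Ex_le_ae => //.
    - by move=> g; exact: powR_ge0.
    - by move=> g; rewrite !addr_ge0// mulr_ge0 ?powR_ge0.
    - by apply: measurable_funD; [apply: measurable_funD => //|]; exact: measurable_fun_scale.
    apply: ae_imp (aeU n) => g ug.
    have Nb1 := Nb_ge1 r0 ug.
    have Nb0 : 0 < Nb (g : 'M[R]_r) by rewrite (lt_le_trans ltr01).
    have g1 := N1_unitmx_gt0 r0 ug.
    have yE : ln (N1 (g : 'M[R]_r) / r%:R) - c = ln (N1 (g : 'M[R]_r)) - ln r%:R - c.
      by rewrite ln_div// posrE.
    have yb : `|ln (N1 (g : 'M[R]_r) / r%:R) - c| <= ln (Nb (g : 'M[R]_r)) + Z.
      rewrite yE -addrA -opprD (le_trans (ler_normB _ _))// lerD//.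
        rewrite ler_norml -lnV ?posrE// !ler_ln ?posrE ?invr_gt0// N1_invmx_ge//=.
        exact: N1_le_Nb.
      rewrite (le_trans (ler_normD _ _))// ger0_norm// lerD2l normrM ler_wpM2l//.
      by rewrite ger0_norm.
    have := expR_pos_le d_gt0 da yb => /(ler_wpM2l k10).
    have -> : k1 * expR (d * (ln (N1 (g : 'M[R]_r) / r%:R) - c)) = N1 (g : 'M[R]_r) `^ d.
      rewrite yE /k1 -expRD /powR gt_eqF//; congr expR; ring.
    move/le_trans; apply; rewrite /k2 /k3 /nexcess [alpha * (ln _ + Z)]mulrDr expRD.
    have -> : expR (alpha * ln (Nb (g : 'M[R]_r))) = Nb (g : 'M[R]_r) `^ alpha.
      by rewrite /powR gt_eqF.
    by rewrite le_eqVlt; apply/orP; left; apply/eqP; ring.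
  have m1 : measurable_fun [set: M] (fun g : M => k1 + k2 * nexcess c g).
    by apply: measurable_funD => //; exact: measurable_fun_scale.
  rewrite ExD//; last 3 first.
  - by move=> g; rewrite addr_ge0// mulr_ge0.
  - by move=> g; rewrite mulr_ge0 ?powR_ge0.
  - exact: measurable_fun_scale.
  rewrite ExD//; last 2 first.
  - by move=> g; rewrite mulr_ge0.
  - exact: measurable_fun_scale.
  rewrite Ex_cst !ExZ//; last by move=> g; exact: powR_ge0.
  rewrite (momCE mom).
  apply: (@le_trans _ _ (k1%:E + k2%:E * (eta * n%:R + C)%:E + k3%:E * (momC n)%:E)%E).
    by rewrite leeD2r// leeD2l// lee_wpmul2l ?lee_fin// HC.
  rewrite -!EFinM -!EFinD lee_fin.
  apply: (@le_trans _ _ (k1 * (1 + d * (eta * n%:R + C + 1)))).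
    have -> : k1 + k2 * (eta * n%:R + C) + k3 * momC n =
        k1 * (1 + d * (eta * n%:R + C) + d * (d * D)).
      by rewrite /k2 /k3 /D; ring.
    rewrite ler_wpM2l// -addrA lerD2l [leRHS]mulrDr lerD2l ler_wpM2l// ltW//.
  apply: (@le_trans _ _ (k1 * expR (d * (eta * n%:R + C + 1)))).
    by rewrite ler_wpM2l// expR_ge1Dx.
  rewrite /k1 -expRD ler_expR -mulrDr -mulrA ler_wpM2l ?(ltW d_gt0)//.
  have -> : theta' = theta + 2 * eta by rewrite /eta; field.
  have : b * n%:R <= theta * n%:R by rewrite ler_wpM2r.
  by rewrite /c; lra.
pose Bd n U := (Ex (law n) (fun g : M => (N1 (g : 'M[R]_r) `^ d)%R) <= U%:E)%E.
have p0 (g : M) : 0 <= N1 (g : 'M[R]_r) `^ d by exact: powR_ge0.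
have [|||//||C' C'0 HC'] := @submult_growth R Bd (d * theta') n.
- move=> n' k U V U0 V0 bU bV; rewrite /Bd EFinM.
  apply: (@le_trans _ _ (Ex (law n') (fun g : M => (N1 (g : 'M[R]_r) `^ d)%R) *
     Ex (law k) (fun g : M => (N1 (g : 'M[R]_r) `^ d)%R))%E).
    apply: (conv_sg_submul sg) => //; apply: aeW => g; apply: aeW => h.
    rewrite -powRM ?N1_ge0//; apply: ge0_ler_powR; rewrite ?nnegrE ?mulr_ge0 ?N1_ge0 ?N1M//.
    exact: ltW.
  by apply: lee_pmul => //; exact: Ex_ge0.
- by move=> n' U V UV bU; rewrite /Bd (le_trans bU)// lee_fin.
- move=> n'; exists (momC n'); first exact: momC_ge0.
  rewrite /Bd -(momCE mom); apply: Ex_le_ae => //.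
    by move=> g; exact: powR_ge0.
  apply: ae_imp (aeU n') => g ug.
  apply: (@le_trans _ _ (Nb (g : 'M[R]_r) `^ d)).
    by apply: ge0_ler_powR; rewrite ?nnegrE ?N1_ge0 ?Nb_ge0 ?N1_le_Nb// ltW.
  by apply: ler_powR; rewrite ?Nb_ge1// (le_trans da)// ler_pdivrMr// ler_peMr ?(ltW alpha0)// ler1n.
- exact: key.
- by exists C' => k; exact: HC'.
Qed.

Lemma irreducible_alternative theta theta' : theta < theta' ->
  lower_rate law theta \/ upper_rate law theta'.
Proof.
move=> tt; have [|nlow] := pselect (lower_rate law theta); first by left.
right; have [K [Q [K0 Q0 HK]]] := norm_of_vector.
apply: (upper_rate_of_nexcess tt) => eta eta0.
have K1 : 0 < K + 1 by rewrite ltr_wpDl.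
(* Passing from the vector to the norm multiplies the mean excess by [K]; the division compensates
   this in advance. *)
pose eta' := eta / (K + 1).
have eta'0 : 0 < eta' by rewrite divr_gt0.
have [b [bt [d1 [m1 sb]] nsb]] := slow_threshold r0 sg mom eta'0 nlow.
have [C C0 HC] := slow_vector r0 sg mom eta'0 sb nsb.
exists b, (K * C + Q); split => //; first by rewrite addr_ge0// mulr_ge0.
move=> n n0; have [v v1 Hv] := HC n n0.
have B0 : 0 <= eta' * n%:R + C by rewrite addr_ge0// mulr_ge0// ltW.
apply: le_trans (HK n v _ _ v1 B0 Hv) _; rewrite lee_fin mulrDr -addrA lerD2r.
rewrite mulrA ler_wpM2r// /eta' mulrCA ler_piMr ?(ltW eta0)// ler_pdivrMr// mul1r lerDl//.
Qed.

End IrreducibleAlternative.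

(** * Removing a common invariant subspace *)

Lemma powR_subadd (R : realType) (d x y : R) : 0 < d -> d <= 1 -> 0 <= x -> 0 <= y ->
  (x + y) `^ d <= x `^ d + y `^ d.
Proof.
move=> d0 d1; rewrite le_eqVlt => /orP[/eqP <- y0|x0].
  by rewrite powR0 ?gt_eqF// !add0r.
rewrite le_eqVlt => /orP[/eqP <-|y0]; first by rewrite powR0 ?gt_eqF// !addr0.
have s0 : 0 < x + y by exact: addr_gt0.
have aux z : 0 < z -> z <= x + y -> z / (x + y) * (x + y) `^ d <= z `^ d.
  move=> z0 zs; rewrite -[in leRHS](@divfK _ (x + y) _ z) ?gt_eqF//.
  rewrite powRM ?divr_ge0 ?(ltW z0) ?(ltW s0)// ler_wpM2r ?powR_ge0//.
  by apply: ger1_powR; rewrite // divr_gt0//= ler_pdivrMr// mul1r.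
apply: le_trans (lerD (aux x x0 _) (aux y y0 _)); rewrite ?lerDl ?lerDr ?(ltW x0) ?(ltW y0)//.
by rewrite -mulrDl -mulrDl divff ?gt_eqF// mul1r.
Qed.

Definition mfun_of d d' (T : measurableType d) (T' : measurableType d') (f : T -> T')
  (mf : measurable_fun [set: T] f) : {mfun T >-> T'} :=
  HB.pack_for {mfun T >-> T'} f (isMeasurableFun.Build _ _ _ _ f mf).

Section PushForward.
Context (R : realType) (r k : nat).
Local Notation M := (borel 'M[R]_r).
Local Notation M' := (borel 'M[R]_k).
Variable law : nat -> probability M R.
Hypothesis sg : conv_sg law.
Variable phi : M -> M'.
Hypothesis mphi : measurable_fun [set: M] phi.

Definition push_law n : probability M' R := distribution (law n) (mfun_of mphi).

Lemma Ex_push n (f : M' -> R) : (forall x, 0 <= f x) -> measurable_fun [set: M'] f ->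
  Ex (push_law n) f = Ex (law n) (f \o phi).
Proof. by move=> f0 mf; rewrite Ex_distribution. Qed.

Lemma ae_push n (Q : M' -> Prop) : measurable [set x | Q x] ->
  {ae law n, forall g, Q (phi g)} -> {ae push_law n, forall g, Q g}.
Proof.
move=> mQ [A [mA A0 QA]]; exists (~` [set x | Q x]); split => //.
  exact: measurableC.
rewrite /push_law/= /distribution /pushforward.
apply/eqP; rewrite eq_le measure_ge0 andbT -A0 le_measure ?inE//.
rewrite -[X in measurable X]setTI; apply: mphi => //.
exact: measurableC.
Qed.

(** Multiplicativity is asked only almost everywhere, because taking a diagonal block is
    multiplicative only on matrices that preserve the subspace. *)
Lemma push_conv_sg :
  (forall n m, {ae law n, forall g, {ae law m, forall h,
     phi ((g : 'M[R]_r) *m (h : 'M[R]_r)) = (phi g : 'M[R]_k) *m (phi h : 'M[R]_k)}}) ->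
  conv_sg push_law.
Proof.
move=> H n m f f0 mf; rewrite Ex_push// sg; last 2 first.
- by move=> g; exact: f0.
- exact: (measurableT_comp mf mphi).
rewrite [RHS](ge0_integral_pushforward mphi)//; last 2 first.
- exact: measurable_inner.
- by move=> g _; apply: integral_ge0 => h _; rewrite lee_fin.
have mg (g : M') : measurable_fun [set: M'] (fun h => f ((g : 'M[R]_k) *m (h : 'M[R]_k))).
  by apply: (measurableT_comp mf); apply: measurable_mulmx.
rewrite preimage_setT; apply: ge0_ae_eq_integral => //.
- exact: (measurable_inner law m (fun g => f0 (phi g)) (measurableT_comp mf mphi)).
- exact: (measurableT_comp (measurable_inner push_law m f0 mf) mphi).
- by move=> g _; apply: integral_ge0 => h _; rewrite lee_fin f0.
- by move=> g _; apply: integral_ge0 => h _; rewrite lee_fin.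
have := H n m; apply: ae_imp => g Hg _ /=.
rewrite [RHS](ge0_integral_pushforward mphi)//; last 2 first.
- exact/measurable_EFinP.
- by move=> h _; rewrite lee_fin.
rewrite preimage_setT; apply: ge0_ae_eq_integral => //.
- apply/measurable_EFinP; apply: (measurableT_comp mf); apply: (measurableT_comp mphi).
  by apply: measurable_mulmx.
- by apply/measurable_EFinP; exact: (measurableT_comp (mg _) mphi).
- by move=> h _; rewrite lee_fin.
- by move=> h _; rewrite lee_fin.
by apply: ae_imp Hg => h E _ /=; rewrite E.
Qed.

Lemma measurable_unitmx n : measurable [set g : borel 'M[R]_n | (g : 'M[R]_n) \in unitmx].
Proof.
rewrite (_ : [set _ | _] = ~` [set g : borel 'M[R]_n | `|\det (g : 'M[R]_n)| <= 0]).
  by apply: measurableC; apply: measurable_set_le => //; apply: measurable_fun_norm; exact: measurable_det.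
apply/seteqP; split => g /=; rewrite unitmxE unitfE normr_le0.
  by move=> /negP.
by move=> /negP.
Qed.

(** The power [p] is 1 for diagonal blocks and the degree for exterior powers, whose entries are
    polynomials of that degree. *)
Lemma push_moments beta c p : 0 < beta -> 0 <= c ->
  (forall n, (Ex (law n) (fun g : M => (Nb (g : 'M[R]_r) `^ (p%:R * beta))%R) < +oo)%E) ->
  (forall n, {ae law n, forall g, (phi g : 'M[R]_k) \in unitmx /\
     Nb (phi g : 'M[R]_k) <= c * Nb (g : 'M[R]_r) ^+ p}) ->
  moments push_law beta.
Proof.
move=> b0 c0 mfin H; split => // n.
  apply: ae_push; first exact: measurable_unitmx.
  by apply: ae_imp (H n) => g [].
have mk m e : measurable_fun [set: borel 'M[R]_m] (fun g : borel 'M[R]_m => Nb (g : 'M[R]_m) `^ e).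
  by apply: measurable_fun_powR; apply: measurable_Nb; exact: measurable_id.
rewrite Ex_push//; last by move=> g; exact: powR_ge0.
apply: (@le_lt_trans _ _ ((c `^ beta)%:E * Ex (law n) (fun g : M => (Nb (g : 'M[R]_r) `^ (p%:R * beta))%R))%E).
  rewrite -ExZ ?powR_ge0//; last by move=> g; exact: powR_ge0.
  apply: Ex_le_ae => //.
  - by move=> g; exact: powR_ge0.
  - by move=> g; rewrite mulr_ge0 ?powR_ge0.
  - exact: (measurableT_comp (mk k _) mphi).
  - exact: measurable_fun_scale.
  apply: ae_imp (H n) => g [_ Ng] /=; rewrite powRrM powR_mulrn ?Nb_ge0//.
  rewrite -powRM ?exprn_ge0 ?Nb_ge0//.
  by apply: ge0_ler_powR; rewrite ?nnegrE ?mulr_ge0 ?exprn_ge0 ?Nb_ge0// ltW.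
by rewrite lte_mul_pinfty ?lee_fin ?powR_ge0.
Qed.

Lemma lower_rate_push theta c : (0 < k)%N -> 0 < c ->
  (forall n, {ae law n, forall g, (phi g : 'M[R]_k) \in unitmx /\
     N1 (phi g : 'M[R]_k) <= c * N1 (g : 'M[R]_r)}) ->
  lower_rate push_law theta -> lower_rate law theta.
Proof.
move=> k0 c0 H [d d0 [C HC]]; exists d => //; exists (c `^ d * C) => n.
have mk m e : measurable_fun [set: borel 'M[R]_m] (fun g : borel 'M[R]_m => N1 (g : 'M[R]_m) `^ e).
  by apply: measurable_fun_powR; apply: measurable_N1; exact: measurable_id.
rewrite -mulrA EFinM.
apply: le_trans (lee_wpmul2l (_ : (0 <= (c `^ d)%:E)%E) (HC n)); last by rewrite lee_fin powR_ge0.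
rewrite Ex_push//; last by move=> g; exact: powR_ge0.
have mkphi := measurableT_comp (mk k (- d)) mphi.
rewrite -ExZ ?powR_ge0//; last by move=> g; exact: powR_ge0.
apply: Ex_le_ae => //.
- by move=> g; exact: powR_ge0.
- by move=> g; rewrite mulr_ge0 ?powR_ge0.
- exact: measurable_fun_scale.
apply: ae_imp (H n) => g [ug Ng] /=.
have p0 := N1_unitmx_gt0 k0 ug.
have q0 : 0 < N1 (g : 'M[R]_r) by rewrite -(pmulr_rgt0 _ c0) (lt_le_trans p0).
have := powRN_le p0 (ltW d0) Ng; rewrite powRM ?(ltW c0) ?N1_ge0// => h.
have := ler_wpM2l (powR_ge0 c d) h; apply: le_trans.
by rewrite mulrA powRN divff ?mul1r// gt_eqF// powR_gt0.
Qed.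

End PushForward.

Section Block.
Context (R : realType) (r k s : nat).
Local Notation M := (borel 'M[R]_r).
Variables (Q1 : 'M[R]_(k, r)) (Q2 : 'M[R]_(s, r)) (R1 : 'M[R]_(r, k)) (R2 : 'M[R]_(r, s)).
Hypotheses (QR11 : Q1 *m R1 = 1%:M) (QR22 : Q2 *m R2 = 1%:M).
Hypotheses (QR12 : Q1 *m R2 = 0) (QR21 : Q2 *m R1 = 0).
Hypothesis RQ : R1 *m Q1 + R2 *m Q2 = 1%:M.
Variable law : nat -> probability M R.
Hypothesis sg : conv_sg law.
Variable alpha : R.
Hypothesis mom : moments law alpha.
Hypothesis stab : forall n, {ae law n, forall g, Q1 *m (g : 'M[R]_r) *m R2 = 0}.

(** In the basis formed by the rows of [Q1] and [Q2], invariance of the row space of [Q1] means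
    block lower triangular matrices, with diagonal blocks [bA] and [bD] and corner [bC]. *)
Definition bA (g : M) : borel 'M[R]_k := Q1 *m (g : 'M[R]_r) *m R1.
Definition bD (g : M) : borel 'M[R]_s := Q2 *m (g : 'M[R]_r) *m R2.
Definition bC (g : M) : borel 'M[R]_(s, k) := Q2 *m (g : 'M[R]_r) *m R1.

Lemma measurable_bA : measurable_fun [set: M] bA.
Proof. by do 2 apply: measurable_mulmx => //; exact: measurable_id. Qed.
Lemma measurable_bD : measurable_fun [set: M] bD.
Proof. by do 2 apply: measurable_mulmx => //; exact: measurable_id. Qed.
Lemma measurable_bC : measurable_fun [set: M] bC.
Proof. by do 2 apply: measurable_mulmx => //; exact: measurable_id. Qed.

Lemma splitRQ m n (X : 'M[R]_(m, r)) (Y : 'M[R]_(r, n)) :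
  X *m Y = X *m R1 *m (Q1 *m Y) + X *m R2 *m (Q2 *m Y).
Proof. by rewrite -{1}(mulmx1 X) -RQ mulmxDr mulmxDl !mulmxA. Qed.

Lemma bA_mul (g h : 'M[R]_r) : Q1 *m g *m R2 = 0 -> bA (g *m h) = bA g *m bA h.
Proof.
by move=> g0; rewrite /bA mulmxA -(mulmxA _ h) splitRQ g0 mul0mx addr0 !mulmxA.
Qed.

Lemma bD_mul (g h : 'M[R]_r) : Q1 *m h *m R2 = 0 -> bD (g *m h) = bD g *m bD h.
Proof.
move=> h0; rewrite /bD mulmxA -(mulmxA _ h) splitRQ.
by rewrite [Q1 *m (h *m R2)]mulmxA h0 mulmx0 add0r !mulmxA.
Qed.

Lemma bC_mul (g h : 'M[R]_r) : bC (g *m h) = bC g *m bA h + bD g *m bC h.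
Proof. by rewrite /bC /bA /bD mulmxA -(mulmxA _ h) splitRQ !mulmxA. Qed.

Lemma bA_inv (g : 'M[R]_r) : g \in unitmx -> Q1 *m g *m R2 = 0 ->
  (bA g : 'M[R]_k) \in unitmx /\ invmx (bA g) = bA (invmx g).
Proof.
move=> ug g0; have E : bA g *m bA (invmx g) = 1%:M.
  by rewrite -bA_mul// mulmxV// /bA mulmx1.
have [uA _] := mulmx1_unit E; split => //.
by apply: (can_inj (mulKmx uA)); rewrite mulmxV.
Qed.

Lemma bD_inv (g : 'M[R]_r) : g \in unitmx -> Q1 *m g *m R2 = 0 ->
  (bD g : 'M[R]_s) \in unitmx /\ invmx (bD g) = bD (invmx g).
Proof.
move=> ug g0; have E : bD (invmx g) *m bD g = 1%:M.
  by rewrite -bD_mul// mulVmx// /bD mulmx1.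
have [_ uA] := mulmx1_unit E; split => //.
by apply: (can_inj (mulmxK uA)); rewrite mulVmx.
Qed.

Lemma N1_block n m p (Q : 'M[R]_(n, r)) (g : 'M[R]_(r, m)) (S : 'M[R]_(m, p)) :
  N1 (Q *m g *m S) <= N1 Q * N1 S * N1 g.
Proof.
rewrite (le_trans (N1M _ _))// (le_trans (ler_wpM2r (N1_ge0 _) (N1M _ _)))//.
by rewrite mulrAC.
Qed.

Definition lawA := push_law law measurable_bA.
Definition lawD := push_law law measurable_bD.

Let aeU n : {ae law n, forall g, (g : 'M[R]_r) \in unitmx}. Proof. by case: mom. Qed.

Lemma lawA_conv_sg : conv_sg lawA.
Proof.
apply: push_conv_sg => // n m; apply: ae_imp (stab n) => g g0.
by apply: aeW => h; exact: bA_mul.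
Qed.

Lemma lawD_conv_sg : conv_sg lawD.
Proof.
apply: push_conv_sg => // n m; apply: aeW => g.
by apply: ae_imp (stab m) => h h0; exact: bD_mul.
Qed.

Lemma bA_ae n : {ae law n, forall g, (bA g : 'M[R]_k) \in unitmx /\
  Nb (bA g : 'M[R]_k) <= (N1 Q1 * N1 R1) * Nb (g : 'M[R]_r)}.
Proof.
apply: ae_imp2 (aeU n) (stab n) => g ug g0.
have [uA iA] := bA_inv ug g0; split => //.
by rewrite /Nb iA mulrDr lerD// N1_block.
Qed.

Lemma bD_ae n : {ae law n, forall g, (bD g : 'M[R]_s) \in unitmx /\
  Nb (bD g : 'M[R]_s) <= (N1 Q2 * N1 R2) * Nb (g : 'M[R]_r)}.
Proof.
apply: ae_imp2 (aeU n) (stab n) => g ug g0.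
have [uA iA] := bD_inv ug g0; split => //.
by rewrite /Nb iA mulrDr lerD// N1_block.
Qed.

Lemma lawA_moments : moments lawA alpha.
Proof.
have [a0 _ mfin] := mom.
apply: (@push_moments _ _ _ _ _ _ _ _ 1%N a0 _ _ bA_ae) => [|n].
  by rewrite mulr_ge0 ?N1_ge0.
by rewrite mul1r.
Qed.

Lemma lawD_moments : moments lawD alpha.
Proof.
have [a0 _ mfin] := mom.
apply: (@push_moments _ _ _ _ _ _ _ _ 1%N a0 _ _ bD_ae) => [|n].
  by rewrite mulr_ge0 ?N1_ge0.
by rewrite mul1r.
Qed.

Lemma lawA_lower theta : (0 < k)%N -> lower_rate lawA theta -> lower_rate law theta.
Proof.
move=> k0; apply: (@lower_rate_push _ _ _ _ _ _ _ (1 + N1 Q1 * N1 R1)) => //.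
  by rewrite ltr_wpDr// mulr_ge0 ?N1_ge0.
move=> n; apply: ae_imp (bA_ae n) => g [ug _]; split => //.
by rewrite (le_trans (N1_block _ _ _))// ler_wpM2r ?N1_ge0// lerDr.
Qed.

Lemma lawD_lower theta : (0 < s)%N -> lower_rate lawD theta -> lower_rate law theta.
Proof.
move=> k0; apply: (@lower_rate_push _ _ _ _ _ _ _ (1 + N1 Q2 * N1 R2)) => //.
  by rewrite ltr_wpDr// mulr_ge0 ?N1_ge0.
move=> n; apply: ae_imp (bD_ae n) => g [ug _]; split => //.
by rewrite (le_trans (N1_block _ _ _))// ler_wpM2r ?N1_ge0// lerDr.
Qed.

Definition Kb := N1 R1 * N1 Q1 + N1 R2 * N1 Q1 + N1 R2 * N1 Q2.

Lemma N1_le_blocks (g : 'M[R]_r) : Q1 *m g *m R2 = 0 ->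
  N1 g <= Kb * (N1 (bA g : 'M[R]_k) + N1 (bD g : 'M[R]_s) + N1 (bC g : 'M[R]_(s, k))).
Proof.
move=> g0.
have E : g = R1 *m bA g *m Q1 + (R2 *m bC g *m Q1 + R2 *m bD g *m Q2).
  have e1 : Q1 *m g = bA g *m Q1.
    by rewrite -[LHS]mulmx1 -RQ mulmxDr !mulmxA g0 mul0mx addr0.
  have e2 : Q2 *m g = bC g *m Q1 + bD g *m Q2.
    by rewrite -[LHS]mulmx1 -RQ mulmxDr !mulmxA.
  move: (bA g : 'M[R]_k) (bC g : 'M[R]_(s, k)) (bD g : 'M[R]_s) e1 e2 => A C D e1 e2.
  by rewrite -[LHS]mul1mx -RQ mulmxDl -!mulmxA e1 e2 mulmxDr.
have bnd n m (X : 'M[R]_(r, n)) (Y : 'M[R]_(n, m)) (Z : 'M[R]_(m, r)) :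
    N1 (X *m Y *m Z) <= N1 X * N1 Z * N1 Y.
  rewrite (le_trans (N1M _ _))// (le_trans (ler_wpM2r (N1_ge0 _) (N1M _ _)))//.
  by rewrite mulrAC.
rewrite {1}E; move: (bA g : 'M[R]_k) (bC g : 'M[R]_(s, k)) (bD g : 'M[R]_s) => A C D.
rewrite (le_trans (N1D _ _))// (le_trans (lerD (lexx _) (N1D _ _)))//.
rewrite (le_trans (lerD (bnd _ _ _ _ _) (lerD (bnd _ _ _ _ _) (bnd _ _ _ _ _))))//.
rewrite /Kb -subr_ge0 (_ : _ - _ = N1 R1 * N1 Q1 * (N1 D + N1 C) +
  N1 R2 * N1 Q1 * (N1 A + N1 D) + N1 R2 * N1 Q2 * (N1 A + N1 C)); last by ring.
by rewrite !addr_ge0 ?mulr_ge0 ?addr_ge0 ?N1_ge0.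
Qed.

(** Submultiplicative for every weight [eps] of the corner, by subadditivity of the power [d <= 1].
    A tiny weight makes the corner negligible at one chosen time, and changing the weight costs only
    a constant factor. *)
Definition wblock d eps (g : M) : R := N1 (bA g : 'M[R]_k) `^ d + N1 (bD g : 'M[R]_s) `^ d +
   eps * N1 (bC g : 'M[R]_(s, k)) `^ d.

Lemma wblock_mul d eps (g h : 'M[R]_r) : 0 < d -> d <= 1 -> 0 <= eps ->
  Q1 *m g *m R2 = 0 -> Q1 *m h *m R2 = 0 ->
  wblock d eps (g *m h) <= wblock d eps g * wblock d eps h.
Proof.
move=> d0 d1 e0 g0 h0; rewrite /wblock bA_mul// bD_mul// bC_mul.
have pmul n m p (X : 'M[R]_(n, m)) (Y : 'M[R]_(m, p)) : N1 (X *m Y) `^ d <= N1 X `^ d * N1 Y `^ d.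
  rewrite -powRM ?N1_ge0//; apply: ge0_ler_powR; rewrite ?nnegrE ?mulr_ge0 ?N1_ge0 ?N1M//.
  exact: ltW.
have cc : N1 ((bC g : 'M[R]_(s, k)) *m (bA h : 'M[R]_k) + (bD g : 'M[R]_s) *m (bC h : 'M[R]_(s, k))) `^ d <=
    N1 (bC g : 'M[R]_(s, k)) `^ d * N1 (bA h : 'M[R]_k) `^ d +
    N1 (bD g : 'M[R]_s) `^ d * N1 (bC h : 'M[R]_(s, k)) `^ d.
  rewrite (@le_trans _ _ ((N1 ((bC g : 'M[R]_(s, k)) *m (bA h : 'M[R]_k)) + N1 ((bD g : 'M[R]_s) *m (bC h : 'M[R]_(s, k)))) `^ d))//.
    by apply: ge0_ler_powR; rewrite ?nnegrE ?addr_ge0 ?N1_ge0 ?N1D// ltW.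
  by rewrite (le_trans (powR_subadd d0 d1 (N1_ge0 _) (N1_ge0 _)))// lerD.
have aa := pmul _ _ _ (bA g : 'M[R]_k) (bA h : 'M[R]_k).
have dd := pmul _ _ _ (bD g : 'M[R]_s) (bD h : 'M[R]_s).
move: aa dd cc.
have := (powR_ge0 (N1 (bA g : 'M[R]_k)) d, powR_ge0 (N1 (bA h : 'M[R]_k)) d,
  powR_ge0 (N1 (bC g : 'M[R]_(s, k))) d, powR_ge0 (N1 (bC h : 'M[R]_(s, k))) d,
  powR_ge0 (N1 (bD g : 'M[R]_s)) d, powR_ge0 (N1 (bD h : 'M[R]_s)) d).
move: (N1 (bA g : 'M[R]_k) `^ d) (N1 (bA h : 'M[R]_k) `^ d) (N1 (bC g : 'M[R]_(s, k)) `^ d)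
  (N1 (bC h : 'M[R]_(s, k)) `^ d) (N1 (bD g : 'M[R]_s) `^ d) (N1 (bD h : 'M[R]_s) `^ d).
move: (N1 (_ *m _) `^ d) (N1 (_ *m _) `^ d) (N1 (_ + _) `^ d).
move=> x y z ag ah cg ch dg dh [[[[[ag0 ah0] cg0] ch0] dg0] dh0] xa yd zc.
have ez : eps * z <= eps * (cg * ah + dg * ch) by rewrite ler_wpM2l.
apply: (le_trans (lerD (lerD xa yd) ez)).
rewrite -subr_ge0 (_ : _ - _ = ag * dh + dg * ah + ag * (eps * ch) + eps * cg * dh + (eps * cg) * (eps * ch)); last by ring.
by rewrite !addr_ge0 ?mulr_ge0.
Qed.

Let mpow m n (f : M -> 'M[R]_(m, n)) d : measurable_fun [set: M] (f : M -> borel 'M[R]_(m, n)) ->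
  measurable_fun [set: M] (fun g : M => N1 (f g) `^ d).
Proof. by move=> mf; apply: measurable_fun_powR; exact: measurable_N1. Qed.

Lemma measurable_wblock d eps : measurable_fun [set: M] (wblock d eps).
Proof.
apply: measurable_funD; last by apply: measurable_fun_scale; apply: mpow; exact: measurable_bC.
by apply: measurable_funD; apply: mpow; [exact: measurable_bA|exact: measurable_bD].
Qed.

Lemma wblock_ge0 d eps g : 0 <= eps -> 0 <= wblock d eps g.
Proof. by move=> e0; rewrite !addr_ge0 ?mulr_ge0 ?powR_ge0. Qed.

Lemma Ex_wblock n d eps a b c : 0 <= eps ->
  (Ex (lawA n) (fun g => (N1 (g : 'M[R]_k) `^ d)%R) <= a%:E)%E ->
  (Ex (lawD n) (fun g => (N1 (g : 'M[R]_s) `^ d)%R) <= b%:E)%E ->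
  (Ex (law n) (fun g => (N1 (bC g : 'M[R]_(s, k)) `^ d)%R) <= c%:E)%E ->
  (Ex (law n) (wblock d eps) <= (a + b + eps * c)%:E)%E.
Proof.
move=> e0 ha hb hc.
have mN m : measurable_fun [set: borel 'M[R]_m] (fun g : borel 'M[R]_m => N1 (g : 'M[R]_m) `^ d).
  by apply: measurable_fun_powR; apply: measurable_N1; exact: measurable_id.
rewrite Ex_push// in ha; last by move=> g; exact: powR_ge0.
rewrite Ex_push// in hb; last by move=> g; exact: powR_ge0.
have mA := mpow d measurable_bA; have mD := mpow d measurable_bD; have mC := mpow d measurable_bC.
rewrite /wblock ExD; [|by move=> g; rewrite addr_ge0 ?powR_ge0|by move=> g; rewrite mulr_ge0 ?powR_ge0|
  exact: measurable_funD|exact: measurable_fun_scale].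
rewrite ExD//; [|by move=> g; exact: powR_ge0|by move=> g; exact: powR_ge0].
rewrite ExZ//; last by move=> g; exact: powR_ge0.
by rewrite !EFinD EFinM leeD// ?leeD// lee_wpmul2l// lee_fin.
Qed.

Lemma Ex_bC_le n d : 0 < d -> d <= alpha -> (0 < r)%N ->
  (Ex (law n) (fun g => (N1 (bC g : 'M[R]_(s, k)) `^ d)%R) <=
   ((N1 Q2 * N1 R1) `^ d * momC law alpha n)%:E)%E.
Proof.
move=> d0 da r0; rewrite EFinM -(momCE mom) -ExZ ?powR_ge0//; last 2 first.
- by move=> g; exact: powR_ge0.
- by apply: measurable_fun_powR; apply: measurable_Nb; exact: measurable_id.
apply: Ex_le_ae.
- by move=> g; exact: powR_ge0.
- by move=> g; rewrite mulr_ge0 ?powR_ge0.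
- by apply: mpow; exact: measurable_bC.
- apply: measurable_fun_scale; apply: measurable_fun_powR; apply: measurable_Nb; exact: measurable_id.
apply: ae_imp (aeU n) => g ug.
apply: (@le_trans _ _ ((N1 Q2 * N1 R1 * Nb (g : 'M[R]_r)) `^ d)).
  apply: ge0_ler_powR; rewrite ?nnegrE ?mulr_ge0 ?N1_ge0 ?Nb_ge0 ?(ltW d0)//.
  by rewrite (le_trans (N1_block _ _ _))// ler_wpM2l ?mulr_ge0 ?N1_ge0 ?N1_le_Nb.
rewrite powRM ?mulr_ge0 ?N1_ge0 ?Nb_ge0// ler_wpM2l ?powR_ge0//.
by apply: ler_powR; rewrite ?Nb_ge1.
Qed.

Lemma N1_le_wblock d eps (g : 'M[R]_r) : 0 < d -> d <= 1 -> 0 < eps -> eps <= 1 ->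
  Q1 *m g *m R2 = 0 -> N1 g `^ d <= Kb `^ d * eps^-1 * wblock d eps g.
Proof.
move=> d0 d1 e0 e1 g0.
have Kb0 : 0 <= Kb by rewrite !addr_ge0 ?mulr_ge0 ?N1_ge0.
have a0 := N1_ge0 (bA g : 'M[R]_k); have b0 := N1_ge0 (bD g : 'M[R]_s).
have c0 := N1_ge0 (bC g : 'M[R]_(s, k)).
apply: (@le_trans _ _ ((Kb * (N1 (bA g : 'M[R]_k) + N1 (bD g : 'M[R]_s) + N1 (bC g : 'M[R]_(s, k)))) `^ d)).
  apply: ge0_ler_powR; [exact: ltW|by rewrite nnegrE N1_ge0| |exact: N1_le_blocks].
  by rewrite nnegrE mulr_ge0// addr_ge0// addr_ge0.
rewrite powRM; [|exact: Kb0|by rewrite addr_ge0// addr_ge0].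
rewrite -mulrA ler_wpM2l ?powR_ge0//.
apply: (le_trans (powR_subadd d0 d1 (addr_ge0 a0 b0) c0)).
apply: (le_trans (lerD (powR_subadd d0 d1 a0 b0) (lexx _))).
rewrite /wblock mulrDr mulKf ?gt_eqF// lerD2r ler_peMl ?addr_ge0 ?powR_ge0//.
by rewrite invf_ge1.
Qed.

Lemma upper_rate_block theta theta' : (0 < r)%N -> theta < theta' ->
  upper_rate lawA theta -> upper_rate lawD theta -> upper_rate law theta'.
Proof.
move=> r0 tt [dA dA0 HA] [dD dD0 HD].
have alpha0 : 0 < alpha by case: mom.
exists (Num.min (Num.min dA dD) (Num.min 1 alpha)); first by rewrite !lt_min dA0 dD0 ltr01.
move=> d d0; rewrite !le_min => /andP[/andP[ddA ddD] /andP[d1 da]].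
have [CA HCA] := HA d d0 ddA; have [CD HCD] := HD d d0 ddD.
have CA0 : 0 <= CA.
  have := le_trans (Ex_ge0 _ (fun g => powR_ge0 _ _)) (HCA 0%N).
  by rewrite lee_fin pmulr_lge0// expR_gt0.
have CD0 : 0 <= CD.
  have := le_trans (Ex_ge0 _ (fun g => powR_ge0 _ _)) (HCD 0%N).
  by rewrite lee_fin pmulr_lge0// expR_gt0.
pose cn n := (N1 Q2 * N1 R1) `^ d * momC law alpha n.
have cn0 n : 0 <= cn n by rewrite mulr_ge0 ?powR_ge0// momC_ge0.
have Hcn n := Ex_bC_le n d0 da r0.
have dt0 : 0 < d * (theta' - theta) by rewrite mulr_gt0// subr_gt0.
(* At this time the gap between the two rates beats the constants, so that the diagonal blocks
   contribute at most half of [E]. The weight [eps] is chosen afterwards, since the moment of the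
   corner depends on [m], and leaves the other half to the corner. *)
pose m := (Num.truncn (2 * (CA + CD) / (d * (theta' - theta)))).+1.
have Hm : 2 * (CA + CD) <= expR (d * (theta' - theta) * m%:R).
  rewrite (le_trans _ (le_expR _))// -ler_pdivrMl// mulrC ltW//.
  exact: truncnS_gt.
pose E := expR (d * theta' * m%:R).
have E0 : 0 < E by exact: expR_gt0.
pose eps := Num.min 1 (E / (2 * (cn m + 1))).
have eps0 : 0 < eps by rewrite lt_min ltr01/= divr_gt0// mulr_gt0// ltr_wpDl.
have eps1 : eps <= 1 by rewrite ge_min lexx.
have epsc : eps * cn m <= E / 2.
  apply: (@le_trans _ _ (E / (2 * (cn m + 1)) * cn m)).
    by rewrite ler_wpM2r// ge_min lexx orbT.
  have c1 : 0 < cn m + 1 by rewrite ltr_wpDl.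
  have -> : E / (2 * (cn m + 1)) * cn m = E / 2 * (cn m / (cn m + 1)).
    by field; rewrite gt_eqF.
  by rewrite ler_piMr ?divr_ge0 ?(ltW E0)// ler_pdivrMr// mul1r lerDl.
pose Bd n U := (Ex (law n) (wblock d eps) <= U%:E)%E.
have [|||//||C' C'0 HC'] := @submult_growth R Bd (d * theta') m.
- move=> n n' U V U0 V0 bU bV; rewrite /Bd EFinM.
  apply: (@le_trans _ _ (Ex (law n) (wblock d eps) * Ex (law n') (wblock d eps))%E).
    have mw := measurable_wblock d eps.
    have w0 g := wblock_ge0 d g (ltW eps0).
    apply: (conv_sg_submul sg) => //.
    apply: ae_imp (stab n) => g g0; apply: ae_imp (stab n') => h h0.
    by rewrite wblock_mul// ltW.
  by apply: lee_pmul => //; apply: Ex_ge0 => g; rewrite wblock_ge0// ltW.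
- by move=> n U V UV bU; rewrite /Bd (le_trans bU)// lee_fin.
- move=> n; eexists; last exact: Ex_wblock (ltW eps0) (HCA n) (HCD n) (Hcn n).
  by rewrite !addr_ge0 ?mulr_ge0 ?expR_ge0 ?(ltW eps0) ?powR_ge0 ?momC_ge0.
- apply: le_trans (Ex_wblock (ltW eps0) (HCA m) (HCD m) (Hcn m)) _.
  rewrite lee_fin -mulrDl -/E.
  have E2 : expR (d * theta * m%:R) * expR (d * (theta' - theta) * m%:R) = E.
    by rewrite -expRD /E; congr expR; ring.
  have := ler_wpM2l (expR_ge0 (d * theta * m%:R)) Hm; rewrite E2 => H2.
  by move: epsc; rewrite /cn => epsc; lra.
exists (Kb `^ d * eps^-1 * C') => n.
have Kb0 : 0 <= Kb `^ d * eps^-1 by rewrite mulr_ge0 ?powR_ge0// invr_ge0 ltW.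
rewrite -mulrA EFinM; apply: le_trans (lee_wpmul2l (_ : (0 <= (Kb `^ d * eps^-1)%:E)%E) (HC' n)); last first.
  by rewrite lee_fin.
have w0 g := wblock_ge0 d g (ltW eps0).
have mw := measurable_wblock d eps.
rewrite -ExZ//; apply: Ex_le_ae => //.
- by move=> g; exact: powR_ge0.
- by move=> g; rewrite mulr_ge0.
- by apply: mpow; exact: measurable_id.
- exact: measurable_fun_scale.
by apply: ae_imp (stab n) => g g0; exact: N1_le_wblock.
Qed.

End Block.

(** Induction on the dimension. A lower rate for one diagonal block is inherited by the whole
    matrix; otherwise both blocks have an upper rate, and so has the triangular matrix. *)
Lemma growth_alternative (R : realType) r (law : nat -> probability (borel 'M[R]_r) R) alpha theta theta' :
  conv_sg law -> moments law alpha -> theta < theta' ->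
  lower_rate law theta \/ upper_rate law theta'.
Proof.
elim/ltn_ind: r law theta theta' => r IH law theta theta' sg mom tt.
have [r0|] := posnP r.
  (* In dimension 0 the norm is an empty sum, and zero to a positive power is zero. *)
  right; exists 1 => // d d0 _; exists 1 => n.
  apply: (@le_trans _ _ 0%E); last by rewrite lee_fin mul1r expR_ge0.
  rewrite /Ex integral0_eq// => g _.
  rewrite (_ : N1 _ = 0) ?powR0 ?gt_eqF//.
  by rewrite /N1 big1// => i; have := ltn_ord i; rewrite {2}r0.
move=> r0.
have [irr|nirr] := pselect (irreducible_law law).
  exact (irreducible_alternative r0 sg mom irr tt).
have [N [stabN [N0 Nfull]]] : exists N : 'M[R]_r,
    (forall n, {ae law n, forall g, (N *m (g : 'M[R]_r) <= N)%MS}) /\ N != 0 /\ ~~ row_full N.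
  apply: contrapT => H; apply: nirr => N stabN N0; apply: contrapT => /negP Nf.
  by apply: H; exists N.
pose k := \rank N; pose s := \rank (N^C)%MS.
have k0 : (0 < k)%N by rewrite /k lt0n mxrank_eq0.
have kr : (k < r)%N by rewrite /k ltn_neqAle rank_leq_col andbT.
have ks : (k + s)%N = r by rewrite /k /s mxrank_compl subnKC// ltnW.
have s0 : (0 < s)%N by rewrite -(ltn_add2l k) addn0 ks.
have sr : (s < r)%N by rewrite -ks -[X in (X < _)%N]add0n ltn_add2r.
pose Q := col_mx (row_base N) (row_base (N^C)%MS).
have Qfull : row_full Q.
  rewrite -sub1mx -(addsmxE (row_base N) (row_base (N^C)%MS)).
  by rewrite (adds_eqmx (eq_row_base _) (eq_row_base _)) sub1mx addsmx_compl_full.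
have Qfree : row_free Q.
  by apply/eqP; rewrite (eqP Qfull); exact: esym ks.
pose S := pinvmx Q.
have QS : Q *m S = 1%:M by rewrite mulmxVp.
have SQ : S *m Q = 1%:M by rewrite mulVpmx.
pose Q1 := row_base N; pose Q2 := row_base (N^C)%MS; pose R1 := lsubmx S; pose R2 := rsubmx S.
have SE : S = row_mx R1 R2 by rewrite hsubmxK.
move: QS; rewrite SE mul_col_row -/Q1 -/Q2 scalar_mx_block => /eq_block_mx[QR11 QR12 QR21 QR22].
have RQ : R1 *m Q1 + R2 *m Q2 = 1%:M by rewrite -SQ SE mul_row_col.
have stab n : {ae law n, forall g, Q1 *m (g : 'M[R]_r) *m R2 = 0}.
  apply: ae_imp (stabN n) => g gN.
  have /submxP[X ->] : (Q1 *m (g : 'M[R]_r) <= Q1)%MS.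
    rewrite (eqmxMr _ (eq_row_base N)) (submx_trans gN)//.
    by rewrite eq_row_base.
  by rewrite -mulmxA QR12 mulmx0.
(* The blocks are compared at an intermediate rate, because reassembling two upper rates gives only
   a strictly larger one. *)
pose th := (theta + theta') / 2.
have t1 : theta < th by rewrite /th; lra.
have t2 : th < theta' by rewrite /th; lra.
have sgA := lawA_conv_sg RQ sg stab; have sgD := lawD_conv_sg RQ sg stab.
have momA := lawA_moments QR11 RQ mom stab; have momD := lawD_moments QR22 RQ mom stab.
have [lA|uA] := IH k kr _ theta th sgA momA t1.
  by left; exact (lawA_lower QR11 RQ mom stab k0 lA).
have [lD|uD] := IH s sr _ theta th sgD momD t1.
  by left; exact (lawD_lower QR22 RQ mom stab s0 lD).
right; exact (upper_rate_block RQ sg mom stab r0 t2 uA uD).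
Qed.

(** * Exterior powers and singular values *)

Section Compound.
Variables (F : numFieldType) (k : nat).

Definition cidx d := {ffun 'I_k -> 'I_d}.

Definition minor m n (A : 'M[F]_(m, n)) (f : cidx m) (h : cidx n) : F :=
  \det (\matrix_(i, j) A (f i) (h j)).

(* Indexing by all maps rather than by increasing ones counts every minor with
   multiplicity, which the normalisation 1/k! compensates in the products; the
   price is that the image of the identity is only an idempotent. *)
Definition compound m n (A : 'M[F]_(m, n)) : 'M[F]_(#|{: cidx m}|, #|{: cidx n}|) :=
  \matrix_(a, b) ((k`!)%:R^-1 * minor A (enum_val a) (enum_val b)).

Lemma det_mul_expand n (A : 'M[F]_(k, n)) (B : 'M[F]_(n, k)) :
  \det (A *m B) = \sum_(h : cidx n) (\prod_i A i (h i)) * \det (\matrix_(i, j) B (h i) j).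
Proof.
transitivity (\sum_(s : 'S_k) \sum_(h : cidx n) (-1) ^+ s * \prod_i (A i (h i) * B (h i) (s i))).
  apply: eq_bigr => s _; rewrite -big_distrr/=; congr (_ * _).
  rewrite -(bigA_distr_bigA (fun i j => A i j * B j (s i))).
  by apply: eq_bigr => i _; rewrite mxE.
rewrite exchange_big; apply: eq_bigr => h _ /=.
rewrite /determinant mulr_sumr; apply: eq_bigr => s _.
rewrite big_split/= mulrCA; congr (_ * (_ * _)).
by apply: eq_bigr => i _; rewrite mxE.
Qed.

(** Composing [h] with a permutation multiplies the second determinant by a sign and completes the
    product of entries to the corresponding term of the first determinant. Summing over all
    permutations produces the factor [k!]. *)
Lemma cauchy_binet n (A : 'M[F]_(k, n)) (B : 'M[F]_(n, k)) :
  (k`!)%:R * \det (A *m B) =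
  \sum_(h : cidx n) \det (\matrix_(i, j) A i (h j)) * \det (\matrix_(i, j) B (h i) j).
Proof.
transitivity (\sum_(s : 'S_k) \det (A *m B)).
  by rewrite sumr_const card_Sn mulr_natl.
transitivity (\sum_(s : 'S_k) \sum_(h : cidx n)
   (-1) ^+ s * (\prod_i A i (h (s i))) * \det (\matrix_(i, j) B (h i) j)).
  apply: eq_bigr => s _; rewrite det_mul_expand.
  pose act (t : 'S_k) (h : cidx n) : cidx n := [ffun i => h (t i)].
  have actK t : cancel (act t) (act t^-1%g).
    by move=> h; apply/ffunP => i; rewrite !ffunE permKV.
  rewrite (reindex_inj (can_inj (actK s))); apply: eq_bigr => h _.
  rewrite -mulrA mulrCA; congr (_ * _); first by apply: eq_bigr => i _; rewrite ffunE.
  have -> : (\matrix_(i, j) B (act s h i) j) = row_perm s (\matrix_(i, j) B (h i) j).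
    by apply/matrixP => i j; rewrite !mxE ffunE.
  by rewrite row_permE det_mulmx det_perm.
rewrite exchange_big; apply: eq_bigr => h _ /=.
rewrite -mulr_suml; congr (_ * _); apply: eq_bigr => s _.
by congr (_ * _); apply: eq_bigr => i _; rewrite mxE.
Qed.

Lemma compound_mul m n p (A : 'M[F]_(m, n)) (B : 'M[F]_(n, p)) :
  compound (A *m B) = compound A *m compound B.
Proof.
have k0 : (k`!)%:R != 0 :> F by rewrite pnatr_eq0 -lt0n fact_gt0.
apply/matrixP => a b; rewrite !mxE.
transitivity ((k`!)%:R^-1 * (k`!)%:R^-1 *
  \sum_(h : cidx n) minor A (enum_val a) h * minor B h (enum_val b)); last first.
  rewrite mulr_sumr (big_enum_val (fun h : cidx n => (k`!)%:R^-1 * (k`!)%:R^-1 *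
    (minor A (enum_val a) h * minor B h (enum_val b)))).
  by apply: eq_bigr => c _; rewrite !mxE mulrACA.
set f := enum_val a; set h := enum_val b.
have := @cauchy_binet n (\matrix_(i, j) A (f i) j) (\matrix_(i, j) B i (h j)).
have -> : (\matrix_(i, j) A (f i) j) *m (\matrix_(i, j) B i (h j)) =
    \matrix_(i, j) (A *m B) (f i) (h j).
  by apply/matrixP => i j; rewrite !mxE; apply: eq_bigr => l _; rewrite !mxE.
rewrite -/(minor (A *m B) f h) => E.
transitivity ((k`!)%:R^-1 * (k`!)%:R^-1 * ((k`!)%:R * minor (A *m B) f h)).
  by rewrite mulrA mulfVK.
rewrite E; congr (_ * _); apply: eq_bigr => l _.
by congr (_ * _); congr (\det _); apply/matrixP => i j; rewrite !mxE.
Qed.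

Lemma compound_tr m n (A : 'M[F]_(m, n)) : compound A^T = (compound A)^T.
Proof.
apply/matrixP => a b; rewrite !mxE; congr (_ * _); rewrite /minor -det_tr.
by congr (\det _); apply/matrixP => i j; rewrite !mxE.
Qed.

Lemma tr_compound_similar d (P D : 'M[F]_d) : P \in unitmx ->
  \tr (compound (invmx P *m D *m P)) = \tr (compound D).
Proof.
move=> uP; rewrite !compound_mul -mulmxA mxtrace_mulC -mulmxA -compound_mul.
by rewrite mulmxV// -compound_mul mulmx1.
Qed.

Lemma tr_compound_diag d (x : 'rV[F]_d) :
  \tr (compound (diag_mx x)) =
  (k`!)%:R^-1 * \sum_(f : cidx d | injectiveb f) \prod_i x 0 (f i).
Proof.
rewrite /mxtrace; under eq_bigr do rewrite mxE.
rewrite -mulr_sumr -(big_enum_val (fun f : cidx d => minor (diag_mx x) f f)).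
congr (_ * _); rewrite [RHS]big_mkcond/=; apply: eq_bigr => f _.
case: ifPn => [/injectiveP finj|/injectivePn[i1 [i2 i12 f12]]].
  transitivity (\det (diag_mx (\row_i x 0 (f i)))).
    by congr (\det _); apply/matrixP => i j; rewrite !mxE (inj_eq finj).
  by rewrite det_diag; apply: eq_bigr => i _; rewrite mxE.
by rewrite /minor (determinant_alternate i12)// => j; rewrite !mxE f12.
Qed.

End Compound.

Lemma map_compound (F F' : numFieldType) (h : {rmorphism F -> F'}) k m n (A : 'M[F]_(m, n)) :
  map_mx h (compound k A) = compound k (map_mx h A).
Proof.
apply/matrixP => a b; rewrite !mxE rmorphM fmorphV rmorph_nat; congr (_ * _).
rewrite /minor -det_map_mx; congr (\det _).
by apply/matrixP => i j; rewrite !mxE.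
Qed.

Lemma prod_XsubC_perm (F : idomainType) (s t : seq F) :
  \prod_(a <- s) ('X - a%:P) = \prod_(a <- t) ('X - a%:P) -> perm_eq s t.
Proof.
elim: s t => [|a s IH] t.
  rewrite big_nil => E; have := congr1 (fun p : {poly F} => size p) E.
  by rewrite size_prod_XsubC size_poly1 => -[]; case: t {E}.
move=> E; have at_ : a \in t.
  by rewrite -root_prod_XsubC -E big_cons rootM root_XsubC eqxx.
rewrite perm_sym (permPl (perm_to_rem at_)) perm_cons perm_sym; apply: IH.
move: E; rewrite (perm_big _ (perm_to_rem at_))/= !big_cons => /mulfI; apply.
by rewrite polyXsubC_eq0.
Qed.

Lemma char_poly_similar (F : fieldType) n (P D : 'M[F]_n) : P \in unitmx ->
  char_poly (invmx P *m D *m P) = char_poly D.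
Proof.
move=> uP; rewrite /char_poly /char_poly_mx !map_mxM.
set Pi := map_mx _ (invmx P); set P' := map_mx _ P; set D' := map_mx _ D.
have PP : Pi *m P' = 1%:M by rewrite -map_mxM mulVmx// map_mx1.
have -> : 'X%:M - Pi *m D' *m P' = Pi *m ('X%:M - D') *m P'.
  by rewrite mulmxBr mulmxBl scalar_mxC -(mulmxA _ Pi P') PP mulmx1.
by rewrite !det_mulmx mulrAC -det_mulmx PP det1 mul1r.
Qed.

Section Spectrum.
Variable R : realType.
Local Notation toC := (real_complex R).

(** The spectral theorem is applied over the complex numbers to the hermitian Gram matrix: its
    eigenvalues are real, and nonnegative since each is a diagonal entry of a Gram matrix in the
    unitary basis. A complex diagonalisation suffices, as only traces and determinants are computed
    from it. *)
Lemma spectral_gram d (g : 'M[R]_d) : exists x : 'rV[R]_d,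
  [/\ forall i, 0 <= x 0 i, char_poly (g^T *m g) = \prod_(i < d) ('X - (x 0 i)%:P) &
   exists2 P : 'M[R[i]]_d, P \in unitmx &
     map_mx toC (g^T *m g) = invmx P *m diag_mx (map_mx toC x) *m P].
Proof.
pose A := map_mx toC (g^T *m g); pose P := spectralmx A; pose sp := spectral_diag A.
pose G := map_mx toC g.
have AG : A = G^T *m G by rewrite /A map_mxM map_trmx.
have GR : map_mx (@Num.conj _) G = G.
  by apply: realmxC; apply/mxOverP => i j; rewrite mxE; apply/complex_realP; exists (g i j).
have Aherm : A \is hermsymmx.
  apply/is_hermitianmxP; rewrite expr0 scale1r AG trmx_mul trmxK map_mxM/=.
  by rewrite -(map_trmx (@Num.conj _) G) GR.
have Pu : P \is unitarymx by exact: spectral_unitarymx.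
have uP : P \in unitmx by exact: unitarymx_unit.
have AE : A = invmx P *m diag_mx sp *m P.
  exact/orthomx_spectralP/hermitian_normalmx.
have spR : sp \is a realmx by exact: hermitian_spectral_diag_real.
pose x := map_mx (@complex.Re R) sp.
have spx : map_mx toC x = sp.
  by apply/matrixP => i j; rewrite !mxE; apply: RRe_real; apply: (mxOverP spR).
exists x; split.
- move=> i; rewrite -ler0c.
  have -> : (x 0 i)%:C%C = sp 0 i by rewrite -spx !mxE.
  have -> : sp 0 i = (P *m A *m invmx P) i i.
    by rewrite AE !mulmxA mulmxV// mul1mx mulmxK// mxE eqxx.
  rewrite invmx_unitary// AG !mulmxA.
  pose B := P *m G^T.
  have -> : P *m G^T *m G *m map_mx (@Num.conj _) P^T = B *m map_mx (@Num.conj _) B^T.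
    by rewrite /B trmx_mul trmxK map_mxM/= GR !mulmxA.
  by rewrite mxE; apply: sumr_ge0 => j _; rewrite !mxE mul_conjC_ge0.
- apply: (map_inj_poly (@complexI R) (rmorph0 _)).
  rewrite map_char_poly -/A AE.
  have -> : char_poly (invmx P *m diag_mx sp *m P) = char_poly (diag_mx sp).
    exact: char_poly_similar.
  rewrite char_poly_trig ?diag_mx_is_trig// rmorph_prod; apply: eq_bigr => i _.
  by rewrite rmorphB/= map_polyX map_polyC/= mxE eqxx mulr1n -spx !mxE.
- by exists P; rewrite ?spx.
Qed.

Definition gram_ev d (g : 'M[R]_d) : seq R := eigenvalues (g^T *m g).

(** The list chosen in [eigenvalues] exists by sorting the spectrum, and unique factorisation makes
    it a permutation of that spectrum; this permutation is then absorbed into the diagonalising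
    matrix. *)
Lemma gram_evP d (g : 'M[R]_d) :
  [/\ size (gram_ev g) = d, sorted >=%R (gram_ev g),
      {in gram_ev g, forall a, 0 <= a} &
   exists2 P : 'M[R[i]]_d, P \in unitmx &
     map_mx toC (g^T *m g) =
     invmx P *m diag_mx (map_mx toC (\row_i nth 0 (gram_ev g) i)) *m P].
Proof.
have [x [x0 cx [P uP AE]]] := spectral_gram g.
pose xs := [tuple x 0 i | i < d].
have [so ce] : sorted >=%R (gram_ev g) /\
    char_poly (g^T *m g) = \prod_(a <- gram_ev g) ('X - a%:P).
  pose S := [set s : seq R | sorted >=%R s /\ char_poly (g^T *m g) = \prod_(a <- s) ('X - a%:P)].
  suff : S (xget [::] S) by [].
  apply: xgetPex; exists (sort >=%R xs); split; first exact/sort_sorted/ge_total.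
  by rewrite (perm_big xs) ?perm_sort// cx big_tuple; apply: eq_bigr => i _; rewrite tnth_mktuple.
have pe : perm_eq (gram_ev g) xs.
  by apply: prod_XsubC_perm; rewrite -ce cx big_tuple; apply: eq_bigr => i _; rewrite tnth_mktuple.
have sz : size (gram_ev g) = d by rewrite (perm_size pe) size_tuple.
split => //.
  by move=> a; rewrite (perm_mem pe) => /mapP[i _ ->].
have /tuple_permP[p pE] := pe.
exists (perm_mx p *m P); first by rewrite unitmx_mul unitmx_perm.
have -> : invmx (perm_mx p *m P) = invmx P *m (perm_mx p)^T.
  have u : perm_mx p *m P \in unitmx by rewrite unitmx_mul unitmx_perm.
  apply: (can_inj (mulKmx u)); rewrite mulmxV// mulmxA -(mulmxA _ P) mulmxV// mulmx1.
  by rewrite tr_perm_mx -perm_mxM mulgV perm_mx1.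
rewrite AE -!mulmxA; congr (_ *m _); rewrite !mulmxA; congr (_ *m _).
have lamE (l : 'I_d) : nth 0 (gram_ev g) l = x 0 (p l).
  rewrite pE/= (nth_map l) ?size_enum_ord// nth_ord_enum.
  by rewrite tnth_mktuple.
set D := diag_mx (map_mx _ (\row_i _)).
have -> : (perm_mx p)^T *m D *m perm_mx p = row_perm p^-1%g (col_perm p^-1%g D).
  by rewrite row_permE col_permE invgK tr_perm_mx mulmxA.
by apply/matrixP => i j; rewrite !mxE (inj_eq perm_inj) lamE permKV.
Qed.

End Spectrum.

Section SymmetricSums.
Variables (R : realType) (lam : nat -> R).
Hypothesis lam0 : forall n, 0 <= lam n.
Hypothesis lam_noninc : forall m n, (m <= n)%N -> lam n <= lam m.

(** Among [n.+1] distinct natural numbers one is at least [n]; remove it and use induction. *)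
Lemma prod_uniq_le (s : seq nat) : uniq s ->
  \prod_(x <- s) lam x <= \prod_(i < size s) lam i.
Proof.
move En : (size s) => n; elim: n s En => [|n IH] s sn us.
  by rewrite (size0nil sn) big_nil big_ord0.
have [x xs nx] : exists2 x, x \in s & (n <= x)%N.
  apply/hasP; apply: contraT; rewrite -all_predC => /allP sm.
  have /(uniq_leq_size us) : {subset s <= iota 0 n}.
    by move=> y /sm /=; rewrite -ltnNge mem_iota.
  by rewrite size_iota sn ltnn.
rewrite (perm_big _ (perm_to_rem xs))/= big_cons big_ord_recr/= mulrC.
apply: ler_pM => //; first by apply: prodr_ge0.
- by apply: IH; rewrite ?rem_uniq// size_rem// sn.
- exact: lam_noninc.
Qed.

Lemma prod_uniq_le_tail (s : seq nat) k x : uniq s -> size s = k -> x \in s -> (k <= x)%N ->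
  \prod_(x <- s) lam x <= (\prod_(i < k.-1) lam i) * lam k.
Proof.
move=> us sk xs kx.
rewrite (perm_big _ (perm_to_rem xs))/= big_cons mulrC.
apply: ler_pM => //; first by apply: prodr_ge0.
- by have := prod_uniq_le (rem_uniq x us); rewrite size_rem// sk.
- exact: lam_noninc.
Qed.

(** The elementary symmetric polynomial of degree [k] in the first [d] values: each subset of size
    [k] is enumerated by [k!] injections. *)
Definition elem_sum k d : R :=
  (k`!)%:R^-1 * \sum_(f : cidx k d | injectiveb f) \prod_i lam (f i).

Lemma card_inj_below k d : (k <= d)%N ->
  #|[pred f : cidx k d | injectiveb f & [forall i, (f i < k)%N]]| = k`!.
Proof.
move=> kd; pose A := [pred j : 'I_d | (j < k)%N].
have cA : #|A| = k.
  have wi : injective (widen_ord kd) by move=> i j /(congr1 val)/= /val_inj.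
  rewrite -[RHS]card_ord -(@fintype.card_image _ _ _ wi).
  apply: eq_card => j; rewrite !inE; apply/idP/fintype.imageP => [jk|[i _ ->]]; last exact (ltn_ord i).
  by exists (Ordinal jk); rewrite ?inE//; apply: val_inj.
rewrite -ffactnn -[X in X ^_ _]cA -[X in _ ^_ X]card_ord -card_inj_ffuns_on.
by apply: eq_card => f; rewrite !inE andbC; congr (_ && _).
Qed.

(** The subset of the [k] first indices gives the main product. Any other subset has an index that
    is at least [k], so its product is at most the second largest one; there are at most [d ^ k] of
    them. *)
Lemma elem_sum_split k d : (k <= d)%N ->
  exists2 E, 0 <= E <= (d ^ k)%:R * ((\prod_(i < k.-1) lam i) * lam k) &
    elem_sum k d = \prod_(i < k) lam i + E.
Proof.
move=> kd.
pose b (f : cidx k d) := [forall i, (f i < k)%N].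
have k0 : 0 < (k`!)%:R :> R by rewrite ltr0n fact_gt0.
exists ((k`!)%:R^-1 * \sum_(f : cidx k d | injectiveb f && ~~ b f) \prod_i lam (f i)).
  apply/andP; split.
    by rewrite mulr_ge0 ?invr_ge0 ?(ltW k0)//; apply: sumr_ge0 => f _; apply: prodr_ge0.
  set c := _ * lam k.
  set S := (\sum_(f | _) _).
  have c0 : 0 <= c by rewrite mulr_ge0// prodr_ge0.
  apply: (@le_trans _ _ S).
    rewrite ler_piMl//; first by apply: sumr_ge0 => f _; apply: prodr_ge0.
    by rewrite invf_le1// ler1n fact_gt0.
  apply: (@le_trans _ _ (\sum_(f : cidx k d) c)); last first.
    by rewrite sumr_const card_ffun !card_ord mulr_natl.
  rewrite /S big_mkcond/=; apply: ler_sum => f _; case: ifP => // /andP[/injectiveP fi].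
  rewrite negb_forall => /existsP[i0]; rewrite -leqNgt => kfi.
  have := @prod_uniq_le_tail [seq val (f i) | i <- enum 'I_k] k (f i0).
  rewrite big_map big_enum/=; apply => //.
  - by rewrite map_inj_uniq ?enum_uniq// => i j /val_inj/fi.
  - by rewrite size_map size_enum_ord.
  - by apply/mapP; exists i0; rewrite ?mem_enum.
rewrite /elem_sum (bigID b)/= mulrDr; congr (_ + _).
transitivity ((k`!)%:R^-1 * \sum_(f : cidx k d | injectiveb f && b f) \prod_(i < k) lam i).
  congr (_ * _); apply: eq_bigr => f /andP[/injectiveP fi /forallP fb].
  pose h (i : 'I_k) : 'I_k := Ordinal (fb i).
  have hi : injective h by move=> i j /(congr1 val)/= /val_inj/fi.
  by rewrite [RHS](reindex_inj hi).
by rewrite sumr_const card_inj_below// -[X in _ * X]mulr_natr mulrCA mulVf ?mulr1// gt_eqF.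
Qed.

End SymmetricSums.

Section CompoundNorm.
Variables (R : realType).
Local Notation toC := (real_complex R).

Definition frob m n (A : 'M[R]_(m, n)) : R := \sum_i \sum_j A i j ^+ 2.

Lemma frob_trE m n (A : 'M[R]_(m, n)) : frob A = \tr (A^T *m A).
Proof.
rewrite /frob exchange_big; apply: eq_bigr => j _ /=.
by rewrite mxE; apply: eq_bigr => i _; rewrite mxE expr2.
Qed.

Lemma frob_le_N1 m n (A : 'M[R]_(m, n)) : frob A <= N1 A ^+ 2.
Proof.
have sq (I : finType) (x : I -> R) : (forall i, 0 <= x i) ->
    \sum_i x i ^+ 2 <= (\sum_i x i) ^+ 2.
  move=> x0; rewrite expr2 mulr_suml; apply: ler_sum => i _.
  rewrite expr2 ler_wpM2l//; rewrite (bigD1 i)//= lerDl sumr_ge0//.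
rewrite /frob /N1; apply: le_trans (sq _ _ _); last by move=> i; apply: sumr_ge0.
apply: ler_sum => i _; apply: le_trans (sq _ _ _); last by move=> j; apply: normr_ge0.
by apply: ler_sum => j _; rewrite real_normK// num_real.
Qed.

Lemma sqr_sum_le (I : finType) (x : I -> R) :
  (\sum_i x i) ^+ 2 <= #|I|%:R * \sum_i x i ^+ 2.
Proof.
rewrite expr2 mulr_suml.
under eq_bigr do rewrite mulr_sumr.
apply: (@le_trans _ _ (\sum_i \sum_j (x i ^+ 2 + x j ^+ 2) / 2)).
  by apply: ler_sum => i _; apply: ler_sum => j _; have := sqr_ge0 (x i - x j); rewrite sqrrB; lra.
set S := \sum_i x i ^+ 2; set n := #|I|%:R.
under eq_bigr do rewrite -mulr_suml big_split/= sumr_const -/S.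
rewrite -mulr_suml big_split/= sumrMnl -/S sumr_const -mulrnDl.
have -> : S + S = S * 2 by ring.
by rewrite -[X in X / _]mulr_natl mulrA mulfK.
Qed.

Lemma N1_le_frob m n (A : 'M[R]_(m, n)) : N1 A ^+ 2 <= (m * n)%:R * frob A.
Proof.
rewrite /N1 /frob natrM -mulrA.
apply: le_trans (sqr_sum_le _) _; rewrite card_ord ler_wpM2l// mulr_sumr.
apply: ler_sum => i _; apply: le_trans (sqr_sum_le _) _; rewrite card_ord ler_wpM2l//.
by apply: ler_sum => j _; rewrite real_normK// num_real.
Qed.

Section Fixed.
Variables (d : nat) (g : 'M[R]_d).
Let lam l := nth 0 (gram_ev g) l.

(** The square of the Euclidean operator norm of the [k]-th exterior power, hence the comparison
    with the square of [N1 (compound k g)]. *)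
Definition gram_prod k := \prod_(i < k) nth 0 (gram_ev g) i.

Lemma gram_ev_ge0 l : 0 <= lam l.
Proof.
have [sz so ge0 _] := gram_evP g; rewrite /lam.
by have [ls|sl] := ltnP l (size (gram_ev g)); [apply/ge0/mem_nth|rewrite nth_default].
Qed.

Lemma gram_ev_noninc m n : (m <= n)%N -> lam n <= lam m.
Proof.
have [sz so ge0 _] := gram_evP g; move=> mn.
have [ns|sn] := ltnP n (size (gram_ev g)); last by rewrite {1}/lam nth_default ?gram_ev_ge0.
have := sorted_leq_nth (ge_trans) (@lexx _ R) 0 so.
by apply; rewrite ?inE// (leq_ltn_trans mn).
Qed.

Lemma tr_compound_gram k : \tr (compound k (g^T *m g)) = elem_sum lam k d.
Proof.
have [sz so ge0 [P uP AE]] := gram_evP g.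
apply: (@complexI R); rewrite -[LHS]/(toC _) -trace_map_mx map_compound AE.
rewrite tr_compound_similar// -map_diag_mx -map_compound trace_map_mx tr_compound_diag.
congr (toC (_ * _)); apply: eq_bigr => f _; apply: eq_bigr => i _; by rewrite mxE.
Qed.

Lemma tr_compound_gram_sq k :
  \tr (compound k ((g^T *m g) *m (g^T *m g))) = elem_sum (fun l => lam l ^+ 2) k d.
Proof.
have [sz so ge0 [P uP AE]] := gram_evP g.
apply: (@complexI R); rewrite -[LHS]/(toC _) -trace_map_mx map_compound map_mxM AE.
set D := diag_mx _.
have -> : invmx P *m D *m P *m (invmx P *m D *m P) = invmx P *m (D *m D) *m P.
  by rewrite !mulmxA mulmxK.
rewrite tr_compound_similar//.
have -> : D *m D = map_mx toC (diag_mx (\row_i (lam i ^+ 2))).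
  rewrite /D mulmx_diag map_diag_mx; congr (diag_mx _).
  by apply/rowP => i; rewrite !mxE -rmorphM -expr2.
rewrite -map_compound trace_map_mx tr_compound_diag.
congr (toC (_ * _)); apply: eq_bigr => f _; apply: eq_bigr => i _; by rewrite mxE.
Qed.

Lemma frob_compound k : frob (compound k g) = elem_sum lam k d.
Proof. by rewrite frob_trE -compound_tr -compound_mul tr_compound_gram. Qed.

Lemma gram_prod_ge0 k : 0 <= gram_prod k.
Proof. by apply: prodr_ge0 => i _; apply: gram_ev_ge0. Qed.

Lemma gram_prod_le_compound k : (k <= d)%N -> gram_prod k <= N1 (compound k g) ^+ 2.
Proof.
move=> kd; apply: le_trans (frob_le_N1 _); rewrite frob_compound.
have [E /andP[E0 _] ->] := elem_sum_split gram_ev_ge0 gram_ev_noninc kd.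
by rewrite lerDl.
Qed.

Lemma gram_prod_exchange k : (0 < k)%N ->
  (\prod_(i < k.-1) lam i) * lam k <= gram_prod k.
Proof.
case: k => // k _; rewrite /gram_prod big_ord_recr/= ler_wpM2l//.
  by apply: prodr_ge0 => i _; apply: gram_ev_ge0.
exact: gram_ev_noninc.
Qed.

Lemma compound_le_gram_prod k : (0 < k <= d)%N ->
  N1 (compound k g) ^+ 2 <= (#|{: cidx k d}| * #|{: cidx k d}|)%:R * (1 + (d ^ k)%:R) * gram_prod k.
Proof.
move=> /andP[k0 kd]; apply: le_trans (N1_le_frob _) _; rewrite -mulrA ler_wpM2l//.
rewrite frob_compound.
have [E /andP[E0 EC] ->] := elem_sum_split gram_ev_ge0 gram_ev_noninc kd.
rewrite mulrDl mul1r lerD2l (le_trans EC)// ler_wpM2l//.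
exact: gram_prod_exchange.
Qed.

End Fixed.
End CompoundNorm.

(** * Closeness to rank one and the avalanche inequality *)

Section Avalanche.
Variable R : realType.

Definition minor2 m n (B : 'M[R]_(m, n)) p k q j := B p j * B k q - B p q * B k j.

(** Measures the distance from rank one: it vanishes exactly for matrices of rank at most one. *)
Definition m2 m n (B : 'M[R]_(m, n)) : R :=
  \sum_p \sum_k \sum_q \sum_j `|minor2 B p k q j|.

Lemma m2_ge0 m n (B : 'M[R]_(m, n)) : 0 <= m2 B.
Proof. by do 4 (apply: sumr_ge0 => ? _). Qed.

Lemma minor2_le_m2 m n (B : 'M[R]_(m, n)) p q :
  \sum_k \sum_j `|minor2 B p k q j| <= m2 B.
Proof.
rewrite /m2 [leRHS](bigD1 p)//= ler_wpDr//; first by do 4 (apply: sumr_ge0 => ? _).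
apply: ler_sum => k _; rewrite [leRHS](bigD1 q)//= ler_wpDr//.
by do 2 (apply: sumr_ge0 => ? _).
Qed.

Lemma N1_mul_entries m n p q (A : 'M[R]_(m, n)) (B : 'M[R]_(p, q)) :
  N1 A * N1 B = \sum_i \sum_j \sum_k \sum_l `|A i j * B k l|.
Proof.
rewrite /N1 mulr_suml; apply: eq_bigr => i _; rewrite mulr_suml; apply: eq_bigr => j _.
rewrite mulr_sumr; apply: eq_bigr => k _; rewrite mulr_sumr; apply: eq_bigr => l _.
by rewrite normrM.
Qed.

(* Expanding entrywise, exchange B p j * B k q for B p q * B k j: the error is a
   2 x 2 minor of B and the main term is a product of entries of ABC and B. *)
Lemma avalanche a r s c (A : 'M[R]_(a, r)) (B : 'M[R]_(r, s)) (C : 'M[R]_(s, c)) :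
  N1 (A *m B) * N1 (B *m C) <= N1 (A *m B *m C) * N1 B + N1 A * N1 C * m2 B.
Proof.
have E i j k l : (A *m B) i j * (B *m C) k l = (A *m B *m C) i l * B k j +
    \sum_p \sum_q A i p * C q l * minor2 B p k q j.
  rewrite -mulmxA [(A *m B) i j]mxE [(B *m C) k l]mxE [(A *m _) i l]mxE.
  rewrite mulr_suml [X in X + _]mulr_suml -big_split/=; apply: eq_bigr => p _.
  rewrite mxE mulr_sumr mulr_sumr mulr_suml -big_split/=; apply: eq_bigr => q _.
  rewrite /minor2; ring.
rewrite (N1_mul_entries (A *m B)) (N1_mul_entries (A *m B *m C)).
apply: (@le_trans _ _ (\sum_i \sum_j \sum_k \sum_l (`|(A *m B *m C) i l * B k j| +
    \sum_p \sum_q `|A i p| * `|C q l| * `|minor2 B p k q j|))).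
  do 4 (apply: ler_sum => ? _); rewrite E; apply: le_trans (ler_normD _ _) _.
  rewrite lerD2l; apply: le_trans (ler_norm_sum _ _ _) _; apply: ler_sum => p _.
  apply: le_trans (ler_norm_sum _ _ _) _; apply: ler_sum => q _.
  by rewrite !normrM.
under eq_bigr do under eq_bigr do under eq_bigr do rewrite big_split/=.
under eq_bigr do under eq_bigr do rewrite big_split/=.
under eq_bigr do rewrite big_split/=.
rewrite big_split/=; apply: lerD.
  apply: ler_sum => i _; rewrite exchange_big/=.
  under eq_bigr do rewrite exchange_big/=.
  rewrite exchange_big/=; apply: ler_sum => l _; rewrite exchange_big/=.
  by apply: ler_sum => k _; apply: ler_sum.
pose mm p q := \sum_k \sum_j `|minor2 B p k q j|.
apply: (@le_trans _ _ (\sum_i \sum_l \sum_p \sum_q `|A i p| * `|C q l| * mm p q)).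
  apply: ler_sum => i _.
  under eq_bigr do rewrite exchange_big/=.
  rewrite exchange_big/=; apply: ler_sum => l _.
  rewrite (eq_bigr (fun j => \sum_p \sum_k \sum_q `|A i p| * `|C q l| * `|minor2 B p k q j|)); last first.
    by move=> j _; rewrite exchange_big.
  rewrite exchange_big/=; apply: ler_sum => p _.
  rewrite (eq_bigr (fun j => \sum_q \sum_k `|A i p| * `|C q l| * `|minor2 B p k q j|)); last first.
    by move=> j _; rewrite exchange_big.
  rewrite exchange_big/=; apply: ler_sum => q _.
  rewrite exchange_big/= /mm mulr_sumr; apply: ler_sum => k _.
  by rewrite mulr_sumr.
rewrite /N1 -mulrA mulr_suml; apply: ler_sum => i _.
rewrite [X in _ <= X](_ : _ = \sum_p \sum_q \sum_l `|A i p| * `|C q l| * m2 B); last first.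
  rewrite mulr_suml; apply: eq_bigr => p _.
  rewrite mulr_suml mulr_sumr; apply: eq_bigr => q _.
  rewrite mulr_suml mulr_sumr; apply: eq_bigr => l _; exact: mulrA.
rewrite exchange_big/=; apply: ler_sum => p _.
rewrite exchange_big/=; apply: ler_sum => q _; apply: ler_sum => l _.
by rewrite ler_wpM2l ?mulr_ge0// minor2_le_m2.
Qed.

(** Cauchy-Schwarz, followed by the expansion of the squared minors: the two products of squares sum
    to the squared trace of the Gram matrix, the mixed terms to the trace of its square. *)
Lemma m2_sqr m n (B : 'M[R]_(m, n)) :
  m2 B ^+ 2 <= ((m * n) ^ 2)%:R * (2 * (\tr (B^T *m B) ^+ 2 - \tr ((B^T *m B) *m (B^T *m B)))).
Proof.
set S := (2 * _).
have -> : S = \sum_p \sum_k \sum_q \sum_j minor2 B p k q j ^+ 2.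
  transitivity (\sum_p \sum_k \sum_q \sum_j
     (B p j ^+ 2 * B k q ^+ 2 + B p q ^+ 2 * B k j ^+ 2 - 2 * (B p j * B k j * (B p q * B k q)))); last first.
    by do 4 (apply: eq_bigr => ? _); rewrite /minor2; ring.
  have F1 : \sum_p \sum_k \sum_q \sum_j (B p j ^+ 2 * B k q ^+ 2) = frob B ^+ 2.
    rewrite expr2 /frob mulr_suml; apply: eq_bigr => p _; rewrite mulr_sumr; apply: eq_bigr => k _.
    rewrite mulr_sumr; apply: eq_bigr => q _; rewrite mulr_suml; apply: eq_bigr => j _; ring.
  have F2 : \sum_p \sum_k \sum_q \sum_j (B p q ^+ 2 * B k j ^+ 2) = frob B ^+ 2.
    rewrite -F1; apply: eq_bigr => p _; apply: eq_bigr => k _; rewrite exchange_big/=.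
    by apply: eq_bigr => ? _; apply: eq_bigr => ? _; ring.
  have F3 : \sum_p \sum_k \sum_q \sum_j (B p j * B k j * (B p q * B k q)) =
      \tr ((B^T *m B) *m (B^T *m B)).
    rewrite -mulmxA mxtrace_mulC -!mulmxA mulmxA [LHS](_ : _ = \sum_p \sum_k (B *m B^T) p k ^+ 2).
      rewrite /mxtrace; apply: eq_bigr => p _; rewrite mxE; apply: eq_bigr => k _.
      rewrite expr2; congr (_ * _).
      by rewrite !mxE; apply: eq_bigr => j _; rewrite !mxE mulrC.
    apply: eq_bigr => p _; apply: eq_bigr => k _; rewrite mxE expr2 mulr_suml.
    rewrite exchange_big/=; apply: eq_bigr => q _; rewrite mulr_sumr; apply: eq_bigr => j _.
    by rewrite !mxE.
  rewrite /S -frob_trE -F3.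
  transitivity (\sum_p \sum_k \sum_q \sum_j (B p j ^+ 2 * B k q ^+ 2) +
    \sum_p \sum_k \sum_q \sum_j (B p q ^+ 2 * B k j ^+ 2) -
    2 * \sum_p \sum_k \sum_q \sum_j (B p j * B k j * (B p q * B k q))).
    rewrite F1 F2; ring.
  rewrite mulr_sumr -big_split -sumrB; apply: eq_bigr => p _ /=.
  rewrite mulr_sumr -big_split -sumrB; apply: eq_bigr => k _ /=.
  rewrite mulr_sumr -big_split -sumrB; apply: eq_bigr => q _ /=.
  by rewrite mulr_sumr -big_split -sumrB; apply: eq_bigr => j _ /=.
rewrite /m2.
have -> : ((m * n) ^ 2)%N = (m * (m * (n * (n * 1))))%N by ring.
rewrite !natrM.
have sq a (x y : 'I_a -> R) c : (forall i, x i ^+ 2 <= c * y i) ->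
    (\sum_i x i) ^+ 2 <= a%:R * c * \sum_i y i.
  move=> xy; apply: le_trans (sqr_sum_le _) _; rewrite card_ord -mulrA ler_wpM2l// mulr_sumr.
  exact: ler_sum.
do 4 (apply: (sq _) => ?).
by rewrite mul1r real_normK// num_real.
Qed.

(** The Gram matrix of the exterior power has the products of [k] distinct [lam i] as eigenvalues,
    so the squared trace minus the trace of the square retains only cross terms. The largest is the
    product of the two top eigenvalues, which equals [gram_prod g k.-1 * gram_prod g k.+1]. *)
Lemma m2_compound_le d k : (0 < k < d)%N -> exists2 C : R, 0 < C &
  forall g : 'M[R]_d, m2 (compound k g) ^+ 2 <= C * (gram_prod g k.-1 * gram_prod g k.+1).
Proof.
move=> /andP[k0 kd].
set D : R := (d ^ k)%:R; set M : R := ((#|{: cidx k d}| * #|{: cidx k d}|) ^ 2)%:R.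
have D0 : 0 <= D by rewrite ler0n.
have M0 : 0 <= M by rewrite ler0n.
exists (1 + M * (2 * (2 * D + D ^+ 2))).
  by rewrite ltr_pwDl// mulr_ge0// mulr_ge0// addr_ge0 ?sqr_ge0// mulr_ge0.
move=> g; apply: le_trans (m2_sqr _) _; rewrite -/M.
have l0 := gram_ev_ge0 g; have ln := gram_ev_noninc g.
pose lam l := nth 0 (gram_ev g) l.
have [E /andP[E0 EC] TE] := elem_sum_split l0 ln (ltnW kd).
have l20 l : 0 <= nth 0 (gram_ev g) l ^+ 2 by rewrite sqr_ge0.
have l2n m n : (m <= n)%N -> nth 0 (gram_ev g) n ^+ 2 <= nth 0 (gram_ev g) m ^+ 2.
  by move=> mn; rewrite ler_pXn2r ?nnegrE// ln.
have [E' /andP[E'0 _] TE'] := elem_sum_split l20 l2n (ltnW kd).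
rewrite -compound_tr -compound_mul tr_compound_gram -compound_mul tr_compound_gram_sq TE TE'.
rewrite prodrXl -/(gram_prod g k).
set pk := gram_prod g k in TE *; set x := gram_prod g k.-1.
have x0 : 0 <= x by exact: gram_prod_ge0.
have pkE : pk = x * lam k.-1.
  by rewrite /pk /x -[in LHS](prednK k0) /gram_prod big_ord_recr.
have pk1E : gram_prod g k.+1 = pk * lam k by rewrite /gram_prod big_ord_recr.
have a0 : 0 <= lam k := l0 k.
have ab : lam k <= lam k.-1 by exact: ln (leq_pred k).
rewrite pk1E; set a := lam k in ab a0 EC *; set b := lam k.-1 in ab pkE.
rewrite -/x in EC.
have b0 : 0 <= b by exact: l0.
have pk0 : 0 <= pk by exact: gram_prod_ge0.
have W0 : 0 <= x * (pk * a) by rewrite !mulr_ge0.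
(* The square of the leading eigenvalue [pk] cancels and [E'] is dropped by its sign; what remains
   is linear or quadratic in [E], which is at most [D] times the second eigenvalue [x * a]. *)
have key : 2 * ((pk + E) ^+ 2 - (pk ^+ 2 + E')) <= 2 * (2 * D + D ^+ 2) * (x * (pk * a)).
  have h1 : pk * E <= pk * (D * (x * a)) by rewrite ler_wpM2l.
  have h2 : E ^+ 2 <= (D * (x * a)) ^+ 2 by rewrite ler_pXn2r ?nnegrE// !mulr_ge0.
  have h3 : (D * (x * a)) ^+ 2 <= D ^+ 2 * (x * (pk * a)).
    rewrite exprMn ler_wpM2l ?sqr_ge0// pkE expr2.
    have -> : x * (x * b * a) = (x * a) * (x * b) by ring.
    by rewrite ler_wpM2l ?mulr_ge0// ler_wpM2l.
  have -> : (pk + E) ^+ 2 = pk ^+ 2 + 2 * (pk * E) + E ^+ 2 by ring.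
  have -> : 2 * (2 * D + D ^+ 2) * (x * (pk * a)) =
     2 * (2 * (pk * (D * (x * a))) + D ^+ 2 * (x * (pk * a))) by ring.
  rewrite ler_pM2l//; lra.
apply: le_trans (ler_wpM2l M0 key) _.
by rewrite [leRHS]mulrDl mul1r -(mulrA M) lerDr.
Qed.

End Avalanche.

(** * Singular values and the operator norm *)

Section Singular.
Variables (R : realType) (d : nat).
Local Notation toC := (real_complex R).

Lemma gram_prod_det (g : 'M[R]_d) : gram_prod g d = \det g ^+ 2.
Proof.
have [sz so ge0 [P uP AE]] := gram_evP g.
apply: (@complexI R); rewrite -[RHS]/(toC _).
have -> : \det g ^+ 2 = \det (g^T *m g) by rewrite det_mulmx det_tr expr2.
rewrite -det_map_mx AE !det_mulmx mulrAC -det_mulmx mulVmx// det1 mul1r det_diag.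
rewrite -[LHS]/(toC _) rmorph_prod; apply: eq_bigr => i _; by rewrite !mxE.
Qed.

Lemma frob_gram_ev (g : 'M[R]_d) : frob g = \sum_(i < d) nth 0 (gram_ev g) i.
Proof.
have [sz so ge0 [P uP AE]] := gram_evP g.
apply: (@complexI R); rewrite frob_trE -[LHS]/(toC _) -trace_map_mx AE.
rewrite -mulmxA mxtrace_mulC mulmxK// mxtrace_diag -[RHS]/(toC _) rmorph_sum.
by apply: eq_bigr => i _; rewrite !mxE.
Qed.

Section Unimodular.
Variable g : 'M[R]_d.
Hypothesis g1 : \det g = 1.

Lemma gram_ev_gt0 (i : 'I_d) : 0 < nth 0 (gram_ev g) i.
Proof.
rewrite lt_neqAle gram_ev_ge0 andbT eq_sym; apply/eqP => E.
have := gram_prod_det g; rewrite g1 expr1n /gram_prod (bigD1 i)//= E mul0r => /esym/eqP.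
by rewrite oner_eq0.
Qed.

Lemma singular_value_gt0 (i : 'I_d) : 0 < singular_value g i.
Proof. by rewrite sqrtr_gt0 gram_ev_gt0. Qed.

Lemma singular_value_noninc (i j : 'I_d) : (i <= j)%N ->
  singular_value g j <= singular_value g i.
Proof. by move=> ij; rewrite ler_sqrt ?gram_ev_ge0//; exact: gram_ev_noninc. Qed.

Lemma gram_prod_gt0 k : (k <= d)%N -> 0 < gram_prod g k.
Proof.
by move=> kd; apply: prodr_gt0 => i _; exact: (gram_ev_gt0 (widen_ord kd i)).
Qed.

Lemma ln_gram_prod k : (k <= d)%N ->
  ln (gram_prod g k) = 2 * \sum_(i < d | (i < k)%N) ln (singular_value g i).
Proof.
move=> kd; rewrite /gram_prod (big_ord_widen _ (nth 0 (gram_ev g)) kd) mulr_sumr.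
suff [] : 0 < \prod_(i < d | (i < k)%N) nth 0 (gram_ev g) i /\
    ln (\prod_(i < d | (i < k)%N) nth 0 (gram_ev g) i) =
    \sum_(i < d | (i < k)%N) 2 * ln (singular_value g i) by [].
apply: (big_rec2 (fun a b => 0 < a /\ ln a = b)); first by rewrite ln1.
move=> i x y ik [y0 E]; have i0 := gram_ev_gt0 i; split; first exact: mulr_gt0.
rewrite lnM ?posrE// E; congr (_ + _).
rewrite /singular_value mulr_natl -lnXn ?sqrtr_gt0//.
by rewrite sqr_sqrtr ?ltW.
Qed.

End Unimodular.
End Singular.

Section Opnorm.
Variables (R : realType) (d : nat).
Implicit Types (x : 'cV[R]_d) (g : 'M[R]_d).

Lemma enorm_le_N1 x : enorm x <= N1 x.
Proof.
have := frob_le_N1 x; rewrite /frob /enorm => h.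
rewrite -[leRHS]ger0_norm ?N1_ge0// -sqrtr_sqr ler_sqrt ?sqr_ge0//.
by apply: le_trans h; apply: ler_sum => i _; rewrite big_ord1.
Qed.

Lemma entry_le_enorm x i : `|x i 0| <= enorm x.
Proof.
rewrite -sqrtr_sqr ler_sqrt ?sumr_ge0// => [|j _]; last exact: sqr_ge0.
by rewrite (bigD1 i)//= lerDl sumr_ge0// => j _; rewrite sqr_ge0.
Qed.

Lemma enorm_gt0 x : x != 0 -> 0 < enorm x.
Proof.
rewrite -N1_gt0 => x0; rewrite lt_neqAle sqrtr_ge0 andbT eq_sym; apply/eqP => E.
move: x0; rewrite lt_neqAle => /andP[/eqP n0 _]; apply: n0; apply/esym/eqP; rewrite N1_eq0.
apply/eqP/matrixP => i j; rewrite ord1 mxE; apply/eqP; rewrite -normr_le0 -E.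
exact: entry_le_enorm.
Qed.

Lemma enorm_mul_le g x : enorm (g *m x) <= N1 g * enorm x.
Proof.
apply: le_trans (enorm_le_N1 _) _; rewrite /N1 mulr_suml; apply: ler_sum => i _.
rewrite big_ord1 mxE mulr_suml; apply: le_trans (ler_norm_sum _ _ _) _.
by apply: ler_sum => j _; rewrite normrM ler_wpM2l// entry_le_enorm.
Qed.

Lemma opnorm_has_sup g : (0 < d)%N ->
  has_sup [set r | exists2 x : 'cV[R]_d, x != 0 & r = enorm (g *m x) / enorm x].
Proof.
move=> d0; split.
  exists (enorm (g *m const_mx 1) / enorm (const_mx 1 : 'cV[R]_d)) => /=; exists (const_mx 1) => //.
  apply/eqP => /matrixP/(_ (Ordinal d0) 0)/eqP; by rewrite !mxE oner_eq0.
exists (N1 g) => r /= [x x0 ->]; rewrite ler_pdivrMr ?enorm_gt0//.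
exact: enorm_mul_le.
Qed.

Lemma opnorm_le_N1 g : (0 < d)%N -> opnorm g <= N1 g.
Proof.
move=> d0; have [ne _] := opnorm_has_sup g d0; apply: ge_sup => // r /= [x x0 ->].
by rewrite ler_pdivrMr ?enorm_gt0// enorm_mul_le.
Qed.

Lemma entry_le_opnorm g i j : `|g i j| <= opnorm g.
Proof.
have d0 : (0 < d)%N by case: d i => [[]|].
have [_ ub] := opnorm_has_sup g d0.
pose x : 'cV[R]_d := delta_mx j 0.
have x0 : x != 0 by apply/eqP => /matrixP/(_ j 0)/eqP; rewrite !mxE !eqxx oner_eq0.
have ex : enorm x = 1.
  rewrite /enorm (bigD1 j)//= !mxE !eqxx expr1n big1 ?addr0 ?sqrtr1// => l lj.
  by rewrite !mxE (negbTE lj) expr0n.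
have : enorm (g *m x) / enorm x <= opnorm g by apply: ub_le_sup => //; exists x.
rewrite ex divr1; apply: le_trans.
have -> : g i j = (g *m x) i 0.
  by rewrite -colE mxE.
exact: entry_le_enorm.
Qed.

Lemma N1_le_opnorm g : N1 g <= (d * d)%:R * opnorm g.
Proof.
rewrite natrM -mulrA /N1.
apply: (@le_trans _ _ (\sum_(i < d) \sum_(j < d) opnorm g)).
  by do 2 (apply: ler_sum => ? _); exact: entry_le_opnorm.
by rewrite !sumr_const !card_ord !mulr_natl.
Qed.

Lemma singular_value0_ge g (d0 : (0 < d)%N) :
  opnorm g <= d%:R * (d * d)%:R * singular_value g (Ordinal d0).
Proof.
apply: le_trans (opnorm_le_N1 _ d0) _.
set s := singular_value _ _.
have s0 : 0 <= s by exact: sqrtr_ge0.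
rewrite -(@ler_pXn2r _ 2)// ?nnegrE ?mulr_ge0 ?N1_ge0//.
have ss : s ^+ 2 = nth 0 (gram_ev g) 0%N by rewrite sqr_sqrtr ?gram_ev_ge0.
apply: le_trans (N1_le_frob g) _; rewrite exprMn ss.
apply: (@le_trans _ _ ((d * d)%:R * (d%:R * nth 0 (gram_ev g) 0%N))).
  rewrite ler_wpM2l// frob_gram_ev.
  apply: (@le_trans _ _ (\sum_(i < d) nth 0 (gram_ev g) 0%N)).
    by apply: ler_sum => i _; exact: gram_ev_noninc.
  by rewrite sumr_const card_ord mulr_natl.
rewrite mulrA ler_wpM2r ?gram_ev_ge0// -!natrM -natrX ler_nat.
by rewrite mulnC expnS expn1 leq_pmulr// !muln_gt0 d0.
Qed.

Lemma singular_value0_le g (d0 : (0 < d)%N) :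
  singular_value g (Ordinal d0) <= (d * d)%:R * opnorm g.
Proof.
apply: le_trans (N1_le_opnorm g).
have e0 : nth 0 (gram_ev g) (Ordinal d0) <= N1 g ^+ 2.
  apply: le_trans (frob_le_N1 g); rewrite frob_gram_ev (bigD1 (Ordinal d0))//= lerDl.
  by apply: sumr_ge0 => i _; exact: gram_ev_ge0.
rewrite -[leRHS]ger0_norm ?N1_ge0// -sqrtr_sqr ler_sqrt ?sqr_ge0//.
Qed.

End Opnorm.

Section DetBound.
Variable R : realType.

Lemma det_le n (A : 'M[R]_n) c : (forall i j, `|A i j| <= c) -> `|\det A| <= (n`!)%:R * c ^+ n.
Proof.
move=> Ac; apply: le_trans (ler_norm_sum _ _ _) _.
apply: (@le_trans _ _ (\sum_(s : 'S_n) c ^+ n)); last first.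
  by rewrite sumr_const card_Sn mulr_natl.
apply: ler_sum => s _; rewrite normrM normrX normrN1 expr1n mul1r normr_prod.
rewrite -[X in _ <= _ ^+ X]card_ord -prodr_const; apply: ler_prod => i _.
by rewrite normr_ge0 Ac.
Qed.

Lemma N1_le_const m n (A : 'M[R]_(m, n)) c : (forall i j, `|A i j| <= c) ->
  N1 A <= (m * n)%:R * c.
Proof.
move=> Ac; apply: (@le_trans _ _ (\sum_(i < m) \sum_(j < n) c)).
  by do 2 (apply: ler_sum => ? _); exact: Ac.
by rewrite !sumr_const !card_ord natrM -mulrA !mulr_natl.
Qed.

Lemma N1_compound_le k d : exists2 c : R, 0 < c &
  forall g : 'M[R]_d, N1 (compound k g) <= c * N1 g ^+ k.
Proof.
set n := #|{: cidx k d}|; exists (1 + (n * n)%:R * (k`!)%:R).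
  by rewrite ltr_pwDl// mulr_ge0.
move=> g; apply: (@le_trans _ _ ((n * n)%:R * ((k`!)%:R * N1 g ^+ k))); last first.
  by rewrite mulrA ler_wpM2r ?exprn_ge0 ?N1_ge0// lerDr.
apply: N1_le_const => a b; rewrite mxE normrM.
have k1 : `|(k`!)%:R^-1| <= 1 :> R.
  by rewrite ger0_norm ?invr_ge0// invf_le1 ?ler1n ?ltr0n fact_gt0.
rewrite -[leRHS]mul1r ler_pM//; apply: det_le => i j; rewrite mxE.
exact: entry_le_N1.
Qed.

(** With determinant 1 the inverse is the adjugate, whose entries are minors of size [d.-1]. *)
Lemma N1_invmx_le d : exists2 c : R, 0 < c &
  forall g : 'M[R]_d, \det g = 1 -> N1 (invmx g) <= c * N1 g ^+ d.-1.
Proof.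
exists (1 + (d * d)%:R * (d.-1`!)%:R); first by rewrite ltr_pwDl// mulr_ge0.
move=> g g1; apply: (@le_trans _ _ ((d * d)%:R * ((d.-1`!)%:R * N1 g ^+ d.-1))); last first.
  by rewrite mulrA ler_wpM2r ?exprn_ge0 ?N1_ge0// lerDr.
have ug : g \in unitmx by rewrite unitmxE g1 unitr1.
apply: N1_le_const => i j; rewrite /invmx ug g1 invr1 scale1r mxE.
rewrite /cofactor normrM normrX normrN1 expr1n mul1r; apply: det_le => a b.
by rewrite !mxE entry_le_N1.
Qed.

End DetBound.

(** * Exterior powers as representations by invertible matrices *)

Lemma idempotent_factor (F : fieldType) n r (A : 'M[F]_(n, r)) (B : 'M[F]_(r, n)) L C :
  L *m A = 1%:M -> B *m C = 1%:M -> (A *m B) *m (A *m B) = A *m B -> B *m A = 1%:M.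
Proof.
move=> LA BC /(congr1 (fun X => L *m X *m C)) /=.
by rewrite !mulmxA LA !mul1mx -mulmxA BC mulmx1.
Qed.

Section CompoundRepresentation.
Variables (R : realType) (k d : nat).
Local Notation n := #|{: cidx k d}|.
Let P : 'M[R]_n := compound k 1%:M.

Definition crank : nat := \rank P.

(* compound k 1%:M is only idempotent; compressing to its image turns compound k
   into a genuine representation by invertible matrices. *)
Definition crep (g : 'M[R]_d) : 'M[R]_crank := row_base P *m compound k g *m col_base P.

Lemma crep_mul g h : crep (g *m h) = crep g *m crep h.
Proof.
have E : compound k (g *m h) = compound k g *m (col_base P *m row_base P) *m compound k h.
  by rewrite mulmx_base -compound_mul mulmx1 -compound_mul.
by rewrite /crep E !mulmxA.
Qed.

Lemma crep1 : crep 1%:M = 1%:M.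
Proof.
have [B BA] := row_fullP (col_base_full P); have [C RC] := row_freeP (row_base_free P).
have PP : P *m P = P by rewrite -compound_mul mulmx1.
have E : row_base P *m col_base P = 1%:M.
  by apply: (idempotent_factor BA RC); rewrite mulmx_base.
transitivity (row_base P *m (col_base P *m row_base P) *m col_base P).
  by rewrite mulmx_base.
by rewrite mulmxA E mul1mx E.
Qed.

Lemma compound_crep g : compound k g = col_base P *m crep g *m row_base P.
Proof.
transitivity ((col_base P *m row_base P) *m compound k g *m (col_base P *m row_base P)).
  by rewrite mulmx_base -compound_mul mul1mx -compound_mul mulmx1.
rewrite /crep; move: (col_base P) (row_base P) => A B; by rewrite !mulmxA.
Qed.

Lemma crep_inv g : g \in unitmx -> crep g \in unitmx /\ invmx (crep g) = crep (invmx g).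
Proof.
move=> ug; have E : crep g *m crep (invmx g) = 1%:M by rewrite -crep_mul mulmxV ?crep1.
have [u _] := mulmx1_unit E; split => //.
by apply: (can_inj (mulKmx u)); rewrite mulmxV.
Qed.

Lemma N1_crep_le : exists2 c : R, 0 < c & forall g : 'M[R]_d, N1 (crep g) <= c * N1 (compound k g).
Proof.
exists (1 + N1 (row_base P) * N1 (col_base P)).
  by rewrite ltr_pwDl// mulr_ge0 ?N1_ge0.
move=> g; apply: le_trans (N1M _ _) _.
apply: le_trans (ler_wpM2r (N1_ge0 _) (N1M _ _)) _.
by rewrite mulrAC ler_wpM2r ?N1_ge0// lerDr.
Qed.

Lemma N1_compound_crep : exists2 c : R, 0 < c &
  forall g : 'M[R]_d, N1 (compound k g) <= c * N1 (crep g).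
Proof.
exists (1 + N1 (col_base P) * N1 (row_base P)).
  by rewrite ltr_pwDl// mulr_ge0 ?N1_ge0.
move=> g; rewrite compound_crep; apply: le_trans (N1M _ _) _.
apply: le_trans (ler_wpM2r (N1_ge0 _) (N1M _ _)) _.
by rewrite mulrAC ler_wpM2r ?N1_ge0// lerDr.
Qed.

Lemma Nb_crep_le : exists2 c : R, 0 < c &
  forall g : 'M[R]_d, g \in unitmx -> Nb (crep g) <= c * Nb g ^+ k.
Proof.
have [c1 c10 H1] := N1_crep_le; have [c2 c20 H2] := N1_compound_le R k d.
have H g : N1 (crep g) <= c1 * c2 * N1 g ^+ k.
  by apply: le_trans (H1 g) _; rewrite -mulrA ler_pM2l.
have c0 : 0 < c1 * c2 by exact: mulr_gt0.
exists (c1 * c2 + c1 * c2); first exact: addr_gt0.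
move=> g ug; have [_ iE] := crep_inv ug; rewrite /Nb iE mulrDl.
by apply: lerD; apply: le_trans (H _) _; rewrite ler_pM2l//;
  apply: lerXn2r; rewrite ?nnegrE ?N1_ge0 ?Nb_ge0 ?N1_le_Nb ?N1V_le_Nb.
Qed.

Lemma measurable_compound : measurable_fun [set: borel 'M[R]_d]
  ((fun g : 'M[R]_d => compound k g) : borel 'M[R]_d -> borel 'M[R]_n).
Proof.
apply: measurable_fun_mx => a b.
rewrite (_ : (fun g => _) = (fun g : borel 'M[R]_d => (k`!)%:R^-1 * minor (g : 'M[R]_d) (enum_val a) (enum_val b))); last first.
  by apply/funext => g; rewrite mxE.
apply: measurable_fun_scale; rewrite /minor.
apply: (measurableT_comp (@measurable_det R k)).
exact: measurable_mxsub.
Qed.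

Lemma measurable_crep : measurable_fun [set: borel 'M[R]_d]
  (crep : borel 'M[R]_d -> borel 'M[R]_crank).
Proof.
have m1 : measurable_fun [set: borel 'M[R]_d]
    ((fun g : 'M[R]_d => row_base P *m compound k g) : borel 'M[R]_d -> borel 'M[R]_(_, _)).
  apply: measurable_mulmx; first exact: measurable_cst.
  exact: measurable_compound.
by apply: (measurable_mulmx m1); exact: measurable_cst.
Qed.

End CompoundRepresentation.

(* The measurability of the operator norm is never needed, because the integral of
   a nonnegative function is a supremum over simple functions below it. *)
Lemma Ex_le_nonmeas d (T : measurableType d) (R : realType) (P : probability T R) (f g : T -> R) :
  (forall x, 0 <= f x <= g x) -> (Ex P f <= Ex P g)%E.
Proof.
move=> fg; have g0 x : 0 <= g x by case/andP: (fg x) => /le_trans; apply.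
have fE0 x : (0 <= (f x)%:E)%E by rewrite lee_fin; case/andP: (fg x).
have gE0 x : (0 <= (g x)%:E)%E by rewrite lee_fin.
rewrite /Ex (ge0_integralTE _ fE0) (ge0_integralTE _ gE0).
apply: ge_ereal_sup => _ [h /= hf <-]; apply: ereal_sup_ubound; exists h => //= x.
by apply: le_trans (hf x) _; rewrite lee_fin; case/andP: (fg x).
Qed.

(** * Laws of i.i.d. products *)

Section MatrixLaw.
Context (R : realType) (d : nat).
Local Notation M := (borel 'M[R]_d).
Variable mu : probability M R.

Lemma measurable_mul : measurable_fun [set: M * M]
  ((fun gh => (gh.1 : 'M[R]_d) *m (gh.2 : 'M[R]_d)) : M * M -> M).
Proof. by apply: measurable_mulmx; [exact: measurable_fst|exact: measurable_snd]. Qed.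

(** The newest factor is multiplied on the left, in agreement with [lprod]. *)
Fixpoint mlaw n : probability M R :=
  if n is n'.+1 then distribution (mu \x mlaw n')%E (mfun_of measurable_mul)
  else dirac (1%:M : M).

Lemma Ex_mlaw0 (f : M -> R) : measurable_fun [set: M] f -> Ex (mlaw 0) f = (f 1%:M)%:E.
Proof.
by move=> mf; rewrite /Ex /= integral_dirac//; [rewrite diracT mul1e|exact/measurable_EFinP].
Qed.

Lemma Ex_mlawS n (f : M -> R) : (forall g, 0 <= f g) -> measurable_fun [set: M] f ->
  Ex (mlaw n.+1) f = (\int[mu]_g \int[mlaw n]_h (f ((g : 'M[R]_d) *m (h : 'M[R]_d)))%:E)%E.
Proof.
move=> f0 mf; rewrite Ex_distribution//= /Ex.
rewrite (@fubini_tonelli1 _ _ _ _ _ mu (mlaw n)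
  (fun gh : M * M => (f ((gh.1 : 'M[R]_d) *m (gh.2 : 'M[R]_d)))%:E))//.
  by apply/measurable_EFinP; exact: measurable_mulmx2.
by move=> gh; rewrite lee_fin.
Qed.

Lemma mlaw_conv_sg : conv_sg mlaw.
Proof.
move=> n; elim: n => [|n IH] k f f0 mf.
  rewrite add0n /= integral_dirac//; last exact: measurable_inner.
  by rewrite diracT mul1e; apply: eq_integral => h _; rewrite mul1mx.
have mF : measurable_fun [set: M * M]
    ((fun gw : M * M => \int[mlaw k]_h (f ((gw.1 : 'M[R]_d) *m (gw.2 : 'M[R]_d) *m (h : 'M[R]_d)))%:E)%E).
  have := @measurable_inner R d mlaw k f f0 mf.
  by move=> /(measurableT_comp)/(_ measurable_mul).
rewrite addSn Ex_mlawS//.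
rewrite [RHS](ge0_integral_pushforward measurable_mul)//; last 2 first.
- exact: measurable_inner.
- by move=> g _; apply: integral_ge0 => h _; rewrite lee_fin.
rewrite preimage_setT (@fubini_tonelli1 _ _ _ _ _ mu (mlaw n) (fun gw : M * M =>
  (\int[mlaw k]_h (f ((gw.1 : 'M[R]_d) *m (gw.2 : 'M[R]_d) *m (h : 'M[R]_d)))%:E)%E))//; last first.
  by move=> gw; apply: integral_ge0 => h _; rewrite lee_fin.
apply: eq_integral => g _ /=.
pose fg (w : M) := f ((g : 'M[R]_d) *m (w : 'M[R]_d)).
have mfg : measurable_fun [set: M] fg.
  by apply: (measurableT_comp mf); apply: measurable_mulmx => //; exact: measurable_cst.
have := IH k fg (fun w => f0 _) mfg; rewrite /Ex /fg /fubini_F /= => ->.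
apply: eq_integral => w _ /=; apply: eq_integral => h _ /=.
by rewrite mulmxA.
Qed.

Lemma Ex_mlaw1 (f : M -> R) : (forall g, 0 <= f g) -> measurable_fun [set: M] f ->
  Ex (mlaw 1) f = Ex mu f.
Proof.
move=> f0 mf; rewrite Ex_mlawS//; apply: eq_integral => g _.
rewrite -[LHS]/(Ex (mlaw 0) (fun h => f ((g : 'M[R]_d) *m (h : 'M[R]_d)))) Ex_mlaw0 ?mulmx1//.
by apply: (measurableT_comp mf); apply: measurable_mulmx => //; exact: measurable_cst.
Qed.

Hypothesis mu_SL : {ae mu, forall g, \det (g : 'M[R]_d) = 1}.

Lemma mlaw_SL n : {ae mlaw n, forall g, \det (g : 'M[R]_d) = 1}.
Proof.
pose f (g : M) : R := `|\det (g : 'M[R]_d) - 1|.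
have f0 g : 0 <= f g by exact: normr_ge0.
have mf : measurable_fun [set: M] f.
  by apply: measurable_fun_norm; apply: measurable_funB => //; exact: measurable_det.
suff E : Ex (mlaw n) f = 0%E.
  have := ae_Ex_fin f0 E mf; apply: ae_imp => g /eqP; rewrite normr_eq0 subr_eq0 => /eqP //.
elim: n => [|n IH]; first by rewrite Ex_mlaw0// /f det1 subrr normr0.
rewrite Ex_mlawS//; transitivity (\int[mu]_g (0%:E : \bar R))%E; last by rewrite integral0.
apply: ge0_ae_eq_integral => //.
- exact: (@measurable_inner R d mlaw n f f0 mf).
- by move=> g _; apply: integral_ge0 => h _; rewrite lee_fin.
apply: ae_imp mu_SL => g g1 _ /=; transitivity (Ex (mlaw n) f); last by rewrite IH.
apply: eq_integral => h _.
by rewrite /f det_mulmx g1 mul1r.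
Qed.

Lemma Ex_mlaw_submul (f : M -> R) : (forall g, 0 <= f g) -> measurable_fun [set: M] f ->
  (forall g h, f ((g : 'M[R]_d) *m (h : 'M[R]_d)) <= f g * f h) ->
  (Ex mu f < +oo)%E -> forall n, (Ex (mlaw n) f < +oo)%E.
Proof.
move=> f0 mf fM fin; elim=> [|n IH]; first by rewrite Ex_mlaw0// ltry.
have H := conv_sg_submul mlaw_conv_sg (n := 1%N) (k := n) f0 f0 f0 mf mf mf.
rewrite -[n.+1]add1n; apply: le_lt_trans (H _) _.
  by apply: aeW => g; apply: aeW => h.
by rewrite Ex_mlaw1// lte_mul_pinfty ?Ex_ge0// ge0_fin_numE// Ex_ge0.
Qed.

End MatrixLaw.

Lemma markov_ae d (T : measurableType d) (R : realType) (mu : probability T R)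
    (A : set T) (f : T -> R) (t : R) :
  0 < t -> measurable A -> (forall x, 0 <= f x) -> measurable_fun [set: T] f ->
  {ae mu, forall x, A x -> t <= f x} -> (mu A <= (t^-1)%:E * Ex mu f)%E.
Proof.
move=> t0 mA f0 mf H.
have -> : mu A = Ex mu (\1_A : T -> R) by rewrite /Ex integral_indic// setIT.
have ti : 0 <= t^-1 by rewrite invr_ge0 ltW.
rewrite -ExZ//; apply: Ex_le_ae => //.
- by move=> x; rewrite mulr_ge0.
- exact: measurable_fun_scale.
apply: ae_imp H => x Hx; rewrite indicE; have [/set_mem/Hx tf|_] := boolP (x \in A).
  by rewrite -(mulVf (lt0r_neq0 t0)) ler_wpM2l.
by rewrite mulr_ge0.
Qed.

Lemma exp_decay_absurd (R : realType) (c C : R) n0 : 0 < c ->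
  ~ (forall n, (n0 <= n)%N -> 2^-1 <= C * expR (- c * n%:R)).
Proof.
move=> c0 H.
pose n := (n0 + (Num.truncn (2 * C / c)).+1)%N.
have := H n (leq_addr _ _); apply/negP; rewrite -ltNge mulNr expRN ltr_pdivrMr ?expR_gt0//.
have nC : 2 * C / c < n%:R.
  by apply: lt_le_trans (truncnS_gt _) _; rewrite ler_nat leq_addl.
rewrite ltr_pdivrMr// in nC.
have := expR_ge1Dx (c * n%:R); lra.
Qed.

(** * Exponential concentration from typicality *)

Section LargeDeviations.
Context (R : realType) (r : nat).
Local Notation M := (borel 'M[R]_r).
Variables (law : nat -> probability M R) (alpha : R).
Hypotheses (sg : conv_sg law) (mom : moments law alpha) (r0 : (0 < r)%N).

Definition in_range (t e : R) n := [set g : M |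
  expR ((t - e) * n%:R) <= N1 (g : 'M[R]_r) <= expR ((t + e) * n%:R)].

Let mN1 : measurable_fun [set: M] (fun g : M => N1 (g : 'M[R]_r)).
Proof. by apply: measurable_N1; exact: measurable_id. Qed.

Lemma measurable_in_range t e n : measurable (in_range t e n).
Proof.
rewrite (_ : in_range t e n = [set g : M | expR ((t - e) * n%:R) <= N1 (g : 'M[R]_r)] `&`
  [set g : M | N1 (g : 'M[R]_r) <= expR ((t + e) * n%:R)]).
  by apply: measurableI; apply: measurable_set_le => //; exact: mN1.
by apply/seteqP; split => g /=; [move=> /andP|move=> H; apply/andP].
Qed.

Lemma N1_ae_gt0 n : {ae law n, forall g, 0 < N1 (g : 'M[R]_r)}.
Proof. by have [_ H _] := mom; apply: ae_imp (H n) => g /(N1_unitmx_gt0 r0). Qed.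

Lemma lower_tail theta t : lower_rate law theta -> t < theta ->
  exists2 c, 0 < c & exists C, forall n,
  (law n [set g : M | (N1 (g : 'M[R]_r) <= expR (t * n%:R))%R] <= (C * expR (- c * n%:R))%:E)%E.
Proof.
move=> [d d0 [C HC]] tt; exists (d * (theta - t)); first by rewrite mulr_gt0// subr_gt0.
exists C => n.
have mf : measurable_fun [set: M] (fun g : M => N1 (g : 'M[R]_r) `^ (- d)).
  by apply: measurable_fun_powR; exact: mN1.
have e0 : 0 < expR (- (d * t) * n%:R) by exact: expR_gt0.
apply: (@le_trans _ _ ((expR (- (d * t) * n%:R))^-1%:E *
    Ex (law n) (fun g : M => (N1 (g : 'M[R]_r) `^ (- d))%R))%E).
  apply: markov_ae => //.
  - by apply: measurable_set_le => //; exact: measurable_cst.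
  - by move=> g; exact: powR_ge0.
  (* Zero to a nonzero real power is zero by convention, so Markov's inequality for negative moments
     compares correctly only where the norm is positive, that is almost everywhere. *)
  apply: ae_imp (N1_ae_gt0 n) => g g0 /= gt.
  have := powRN_le g0 (ltW d0) gt; rewrite -expRM; apply: le_trans.
  by rewrite ler_expR le_eqVlt; apply/orP; left; apply/eqP; ring.
apply: le_trans (lee_wpmul2l (_ : (0 <= (expR (- (d * t) * n%:R))^-1%:E)%E) (HC n)) _.
  by rewrite lee_fin invr_ge0 expR_ge0.
rewrite -EFinM lee_fin mulrCA -expRN -expRD le_eqVlt; apply/orP; left; apply/eqP.
by congr (_ * expR _); ring.
Qed.

Lemma upper_tail theta t : upper_rate law theta -> theta < t ->
  exists2 c, 0 < c & exists C, forall n,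
  (law n [set g : M | (expR (t * n%:R) <= N1 (g : 'M[R]_r))%R] <= (C * expR (- c * n%:R))%:E)%E.
Proof.
move=> [d d0 /(_ d d0 (lexx _))[C HC]] tt.
exists (d * (t - theta)); first by rewrite mulr_gt0// subr_gt0.
exists C => n.
have mf : measurable_fun [set: M] (fun g : M => N1 (g : 'M[R]_r) `^ d).
  by apply: measurable_fun_powR; exact: mN1.
have e0 : 0 < expR (d * t * n%:R) by exact: expR_gt0.
apply: (@le_trans _ _ ((expR (d * t * n%:R))^-1%:E *
    Ex (law n) (fun g : M => (N1 (g : 'M[R]_r) `^ d)%R))%E).
  apply: markov_ae => //.
  - by apply: measurable_set_le => //; exact: measurable_cst.
  - by move=> g; exact: powR_ge0.
  apply: aeW => g /= gt.
  have := @ge0_ler_powR _ d (ltW d0) _ _ (expR_ge0 _) (N1_ge0 _) gt; rewrite -expRM; apply: le_trans.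
  by rewrite ler_expR le_eqVlt; apply/orP; left; apply/eqP; ring.
apply: le_trans (lee_wpmul2l (_ : (0 <= (expR (d * t * n%:R))^-1%:E)%E) (HC n)) _.
  by rewrite lee_fin invr_ge0 expR_ge0.
rewrite -EFinM lee_fin mulrCA -expRN -expRD le_eqVlt; apply/orP; left; apply/eqP.
by congr (_ * expR _); ring.
Qed.

(** Any positive constant in place of one half would serve: it only has to contradict exponential
    decay. *)
Definition typical (Gam : R) := forall e, 0 < e -> exists n0, forall n, (n0 <= n)%N ->
  ((2^-1)%:E <= law n (in_range Gam e n))%E.

(* The alternative is decided by typicality: the wrong branch would make an event
   of probability at least 1/2 exponentially unlikely. *)
Lemma typical_upper_rate Gam theta : typical Gam -> Gam < theta -> upper_rate law theta.
Proof.
move=> typ Gt; pose theta1 := (Gam + theta) / 2; pose t := (Gam + theta1) / 2.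
have [h1 h2 h3] : [/\ Gam < t, t < theta1 & theta1 < theta].
  by rewrite /t /theta1; split; lra.
have [low|//] := growth_alternative sg mom h3.
have [c c0 [C HC]] := lower_tail low h2.
have e0 : 0 < t - Gam by rewrite subr_gt0.
have [n0 Hn] := typ _ e0.
exfalso; apply: (@exp_decay_absurd _ c C n0 c0) => n n0n.
rewrite -lee_fin; apply: le_trans (Hn _ n0n) _; apply: le_trans (HC n).
apply: le_measure; rewrite ?inE; [exact: measurable_in_range| |].
  by apply: measurable_set_le => //; exact: measurable_cst.
move=> g /andP[_]; by rewrite addrC subrK.
Qed.

Lemma typical_lower_rate Gam theta : typical Gam -> theta < Gam -> lower_rate law theta.
Proof.
move=> typ Gt; pose theta1 := (Gam + theta) / 2; pose t := (Gam + theta1) / 2.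
have [h1 h2 h3] : [/\ t < Gam, theta1 < t & theta < theta1].
  by rewrite /t /theta1; split; lra.
have [//|up] := growth_alternative sg mom h3.
have [c c0 [C HC]] := upper_tail up h2.
have e0 : 0 < Gam - t by rewrite subr_gt0.
have [n0 Hn] := typ _ e0.
exfalso; apply: (@exp_decay_absurd _ c C n0 c0) => n n0n.
rewrite -lee_fin; apply: le_trans (Hn _ n0n) _; apply: le_trans (HC n).
apply: le_measure; rewrite ?inE; [exact: measurable_in_range| |].
  by apply: measurable_set_le => //; exact: measurable_cst.
move=> g /andP[+ _]; by rewrite subKr.
Qed.

Lemma large_deviations Gam e : typical Gam -> 0 < e ->
  exists2 c, 0 < c & exists C, forall n,
  (law n (~` in_range Gam e n) <= (C * expR (- c * n%:R))%:E)%E.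
Proof.
move=> typ e0.
have l1 : Gam - e / 2 < Gam by rewrite ltrBlDr ltrDl divr_gt0.
have l2 : Gam - e < Gam - e / 2 by rewrite ltrD2l ltrN2 ltr_pdivrMr// ltr_pMr// ltr1n.
have u1 : Gam < Gam + e / 2 by rewrite ltrDl divr_gt0.
have u2 : Gam + e / 2 < Gam + e by rewrite ltrD2l ltr_pdivrMr// ltr_pMr// ltr1n.
have [c1 c10 [C1 H1]] := lower_tail (typical_lower_rate typ l1) l2.
have [c2 c20 [C2 H2]] := upper_tail (typical_upper_rate typ u1) u2.
exists (Num.min c1 c2); first by rewrite lt_min c10 c20.
exists (`|C1| + `|C2|) => n.
set A := [set g : M | (N1 (g : 'M[R]_r) <= expR ((Gam - e) * n%:R))%R] in H1.
set B := [set g : M | (expR ((Gam + e) * n%:R) <= N1 (g : 'M[R]_r))%R] in H2.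
have mA : measurable [set g : M | (N1 (g : 'M[R]_r) <= expR ((Gam - e) * n%:R))%R].
  by apply: measurable_set_le => //; exact: measurable_cst.
have mB : measurable [set g : M | (expR ((Gam + e) * n%:R) <= N1 (g : 'M[R]_r))%R].
  by apply: measurable_set_le => //; exact: measurable_cst.
apply: (@le_trans _ _ (law n ([set g : M | (N1 (g : 'M[R]_r) <= expR ((Gam - e) * n%:R))%R] `|`
   [set g : M | (expR ((Gam + e) * n%:R) <= N1 (g : 'M[R]_r))%R]))).
  apply: le_measure; rewrite ?inE.
  - by apply: measurableC; exact: measurable_in_range.
  - exact: measurableU.
  - move=> g /= /negP; rewrite negb_and -!ltNge => /orP[h|h]; [left|right]; exact: ltW.
have aux c' C : Num.min c1 c2 <= c' -> C * expR (- c' * n%:R) <= `|C| * expR (- Num.min c1 c2 * n%:R).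
  move=> cc; apply: (@le_trans _ _ (`|C| * expR (- c' * n%:R))).
    by rewrite ler_wpM2r ?expR_ge0// ler_norm.
  by rewrite ler_wpM2l// ler_expR ler_wpM2r// lerN2.
apply: le_trans (measureU2 _ mA mB) _; rewrite [X in (_ <= X%:E)%E]mulrDl EFinD; apply: leeD.
  by apply: le_trans (H1 n) _; rewrite lee_fin aux// ge_min lexx.
by apply: le_trans (H2 n) _; rewrite lee_fin aux// ge_min lexx orbT.
Qed.

End LargeDeviations.

(** * Independence of windows *)

Section Independence.
Context d d' (T : measurableType d) (T' : measurableType d') (R : realType).
Variables (P : probability T R) (Z : nat -> {RV P >-> T'}).
Hypothesis Zind : independent_family Z.

(** Uniqueness of measures on a pi-system, for the restriction of [P] to [C] and for [P] multiplied
    by the constant [P C]. *)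
Lemma product_rule_generated (G : set (set T)) (C : set T) :
  G `<=` measurable -> setI_closed G -> G setT -> measurable C ->
  (forall B, G B -> P (B `&` C) = (P B * P C)%E) ->
  forall B, <<s G >> B -> P (B `&` C) = (P B * P C)%E.
Proof.
move=> Gm GI GT mC H.
have PC0 : 0 <= fine (P C) by rewrite fine_ge0.
have PCE : P C = (fine (P C))%:E by rewrite fineK// fin_num_measure.
have cov : \bigcup_(k in [set: nat]) [set: T] = [set: T].
  by apply/seteqP; split => // x _; exists 0%N.
move=> B sB.
suff : mrestr P mC B = mscale (NngNum PC0) P B.
  by rewrite /mrestr /mscale/= -PCE muleC.
apply: (@g_sigma_algebra_measure_unique _ R T G Gm (fun=> setT) (fun=> GT) cov) => //.
- move=> A GA; have := H _ GA; rewrite muleC {1}PCE; exact.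
- move=> _; have : (P (setT `&` C) < +oo)%E by rewrite setTI ltey_eq fin_num_measure.
  exact.
Qed.

(** A pi-system generating the sigma-algebra of the coordinates in [J]. Measurability with respect
    to it encodes that a variable depends on these coordinates only. *)
Definition cylinders (J : set nat) : set (set T) := [set B |
  exists (S : {fset nat}) (A : nat -> set T'),
  [/\ forall j, j \in S -> J j, forall j, measurable (A j) &
      B = \bigcap_(j in [set` S]) (Z j @^-1` A j)]].

Let mZ j (A : set T') : measurable A -> measurable (Z j @^-1` A).
Proof. by move=> mA; rewrite -[X in measurable X]setTI; exact: measurable_funP. Qed.

Lemma cylinders_measurable J : cylinders J `<=` measurable.
Proof.
move=> _ [S [A [_ mA ->]]]; apply: fin_bigcap_measurable; first exact: finite_fset.
by move=> j _; exact: mZ.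
Qed.

Lemma cylindersT J : cylinders J setT.
Proof.
exists fset0, (fun=> setT); split => //.
by apply/seteqP; split => // x _ j.
Qed.

Lemma cylinders_setI J : setI_closed (cylinders J).
Proof.
move=> _ _ [S1 [A1 [J1 mA1 ->]]] [S2 [A2 [J2 mA2 ->]]].
exists (S1 `|` S2)%fset, (fun j => (if j \in S1 then A1 j else setT) `&`
  (if j \in S2 then A2 j else setT)); split.
- by move=> j; rewrite inE => /orP[/J1|/J2].
- by move=> j; apply: measurableI; case: ifP.
apply/seteqP; split => x /=.
  move=> [h1 h2] j /=; rewrite inE => jS; split; case: ifP => // js; [exact: h1|exact: h2].
move=> h; split => j /= js.
  by have /= := h j; rewrite inE js/= => -[].
by have /= := h j; rewrite inE js orbT/= => -[].
Qed.

Lemma cylinders_indep J K B C : (forall j, J j -> K j -> False) ->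
  cylinders J B -> cylinders K C -> P (B `&` C) = (P B * P C)%E.
Proof.
move=> JK [S1 [A1 [J1 mA1 ->]]] [S2 [A2 [J2 mA2 ->]]].
pose A j := if j \in S1 then A1 j else A2 j.
have mA j : measurable (A j) by rewrite /A; case: ifP.
have S12 j : j \in S2 -> j \in S1 = false.
  by move=> j2; apply/negP => /J1 /JK; apply; exact: J2.
have E1 : \bigcap_(j in [set` S1]) (Z j @^-1` A1 j) = \bigcap_(j in [set` S1]) (Z j @^-1` A j).
  by apply: eq_bigcapr => j /= js; rewrite /A js.
have E2 : \bigcap_(j in [set` S2]) (Z j @^-1` A2 j) = \bigcap_(j in [set` S2]) (Z j @^-1` A j).
  by apply: eq_bigcapr => j /= js; rewrite /A S12.
rewrite E1 E2 -bigcap_setU.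
have -> : [set` S1] `|` [set` S2] = [set` (S1 `|` S2)%fset].
  by apply/seteqP; split => j /=; rewrite inE => /orP.
rewrite !Zind//.
transitivity (\prod_(j <- enum_fset S1 ++ enum_fset S2) P (Z j @^-1` A j))%E; last by rewrite big_cat.
apply: perm_big; apply: uniq_perm; first exact: fset_uniq.
  rewrite cat_uniq !fset_uniq andbT/=; apply/hasPn => j /= /S12 js.
  by apply/negP; rewrite js.
by move=> j; rewrite mem_cat inE.
Qed.

Lemma generated_indep J K B C : (forall j, J j -> K j -> False) ->
  <<s cylinders J >> B -> <<s cylinders K >> C -> P (B `&` C) = (P B * P C)%E.
Proof.
move=> JK sB sC.
have sm L A : <<s cylinders L >> A -> measurable A.
  apply: smallest_sub; first exact: sigma_algebra_measurable.
  exact: cylinders_measurable.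
apply: (@product_rule_generated (cylinders J)) sB => //.
- exact: cylinders_measurable.
- exact: cylinders_setI.
- exact: cylindersT.
- exact: sm sC.
move=> {}B cB; rewrite setIC muleC.
apply: (@product_rule_generated (cylinders K)) sC => //.
- exact: cylinders_measurable.
- exact: cylinders_setI.
- exact: cylindersT.
- exact: cylinders_measurable cB.
move=> {}C cC; rewrite setIC muleC; exact: cylinders_indep cB cC.
Qed.

Lemma measurable_coord (J : set nat) j : J j ->
  measurable_fun [set: g_sigma_algebraType (cylinders J)] (Z j : g_sigma_algebraType (cylinders J) -> T').
Proof.
move=> Jj _ A mA; rewrite setTI; apply: sub_sigma_algebra.
exists [fset j]%fset, (fun=> A); split => //.
  by move=> i; rewrite inE => /eqP ->.
by apply/seteqP; split => x /=; [move=> h i /=; rewrite inE => /eqP -> //|apply; rewrite /= inE].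
Qed.

End Independence.

Section ProductLaw.
Context d (T : measurableType d) (R : realType) (P : probability T R) (r : nat).
Local Notation M := (borel 'M[R]_r).
Variables (mu nu : probability M R) (X W : T -> M).
Hypotheses (mX : measurable_fun [set: T] X) (mW : measurable_fun [set: T] W).
Hypothesis XW : forall A B, measurable A -> measurable B ->
  P ((X @^-1` A) `&` (W @^-1` B)) = (mu A * nu B)%E.

Lemma mul_law A : measurable A ->
  P ((fun w => (X w : 'M[R]_r) *m (W w : 'M[R]_r) : M) @^-1` A) =
  distribution (mu \x nu)%E (mfun_of (@measurable_mul R r)) A.
Proof.
move=> mA.
have mXW : measurable_fun [set: T] (fun w => (X w, W w)) by exact: measurable_fun_pair.
have E := @product_measure_unique _ _ _ _ _ mu nu (distribution P (mfun_of mXW)).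
rewrite /distribution /pushforward /= E//.
by rewrite -[X in measurable X]setTI; exact: measurable_mul.
Qed.

End ProductLaw.

Section WindowLaw.
Context d d' (T : measurableType d) (T' : measurableType d') (R : realType).
Variables (P : probability T R) (Z : nat -> {RV P >-> T'}).
Hypothesis Zind : independent_family Z.
Context (r : nat).
Local Notation M := (borel 'M[R]_r).
Variables (mu : probability M R) (X : nat -> T -> M) (J : nat -> set nat).
Local Notation sub K := (g_sigma_algebraType (cylinders Z K)).
Hypothesis mX : forall n, (0 < n)%N -> measurable_fun [set: sub (J n)] (X n : sub (J n) -> M).
Hypothesis Xmu : forall n A, (0 < n)%N -> measurable A -> P (X n @^-1` A) = mu A.

Lemma measurable_sub (K L : set nat) (f : T -> M) : K `<=` L ->
  measurable_fun [set: sub K] (f : sub K -> M) -> measurable_fun [set: sub L] (f : sub L -> M).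
Proof.
move=> KL mf _ A mA; have := mf measurableT A mA.
apply: sub_smallest2r; first exact: smallest_sigma_algebra.
by move=> _ [S [B [SK mB ->]]]; exists S, B; split => // j /SK/KL.
Qed.

Lemma measurable_sub_T (K : set nat) (f : T -> M) :
  measurable_fun [set: sub K] (f : sub K -> M) -> measurable_fun [set: T] f.
Proof.
move=> mf _ A mA; have := mf measurableT A mA.
apply: smallest_sub; first exact: sigma_algebra_measurable.
exact: cylinders_measurable.
Qed.

Definition window n len w : 'M[R]_r := lprod (fun m => X (n + m)%N w : 'M[R]_r) len.

Lemma measurable_window n len : measurable_fun
  [set: sub (\bigcup_(m in `]n, (n + len)%N]) J m)] (window n len : sub _ -> M).
Proof.
elim: len => [|len IH]; first exact: measurable_cst.
apply: measurable_mulmx.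
  apply: (measurable_sub _ (mX _)); last by rewrite addnS.
  move=> j Jj; exists (n + len.+1)%N => //=; rewrite in_itv/= lexx andbT.
  by rewrite ltEnat/= addnS ltnS leq_addr.
apply: (measurable_sub _ IH) => j [m /=]; rewrite in_itv/= => /andP[nm ml] Jm.
by exists m => //=; rewrite in_itv/= nm/=; apply: (le_trans ml); rewrite leEnat addnS leqnSn.
Qed.

Lemma measurable_window_T n len : measurable_fun [set: T] (window n len : T -> M).
Proof. exact: (measurable_sub_T (@measurable_window n len)). Qed.

(** The leftmost factor and the shorter window depend on disjoint sets of coordinates, hence are
    independent, and the law follows the recursion of [mlaw]. Disjointness is used only inside the
    window. *)
Lemma window_law n len (A : set M) : (forall m m', (n < m < m')%N -> (m' <= n + len)%N ->
    forall j, J m j -> J m' j -> False) ->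
  measurable A -> P ((window n len : T -> M) @^-1` A) = mlaw mu len A.
Proof.
elim: len A => [|len IH] A disj mA.
  rewrite /window /= /dirac indicE.
  have [h|h] := boolP (1%:M \in A).
    by rewrite (_ : _ @^-1` _ = setT) ?probability_setT//; apply/seteqP; split => // w _; exact: set_mem.
  rewrite (_ : _ @^-1` _ = set0) ?measure0//; apply/seteqP; split => // w /= wA.
  by move/negP: h; apply; exact: mem_set.
apply: (@mul_law _ _ _ P r mu (mlaw mu len) (X (n + len.+1)%N) (window n len)) => //.
- by apply: (measurable_sub_T (mX _)); rewrite addnS.
- exact: measurable_window_T.
move=> B C mB mC.
have h0 : (0 < n + len.+1)%N by rewrite addnS.
rewrite -(Xmu h0 mB) -IH//; last by move=> m m' mm ml; apply: disj => //; rewrite addnS (leq_trans ml).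
apply: (@generated_indep _ _ T T' R P Z Zind (J (n + len.+1)%N) (\bigcup_(m in `]n, (n + len)%N]) J m)).
- move=> j Jj [m /=]; rewrite in_itv/= => /andP[nm ml] Jm.
  apply: (disj m (n + len.+1)%N _ _ j) => //.
  by apply/andP; split => //; rewrite addnS ltnS.
- by have := mX h0 measurableT mB; rewrite setTI.
- by have := @measurable_window n len measurableT C mC; rewrite setTI.
Qed.

End WindowLaw.

Section RowLaw.
Context d (T : measurableType d) (R : realType).
Variables (P : probability T R) (Z : nat -> {RV P >-> R}).
Hypothesis Ziid : iid Z.
Variable l : nat.
Local Notation V := (borel 'rV[R]_l).

Definition zrow (e : 'I_l -> nat) (w : T) : 'rV[R]_l := \row_i Z (e i) w.

Definition boxes : set (set V) := [set B | exists A : 'I_l -> set R,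
  (forall i, measurable (A i)) /\ B = [set x | forall i, A i ((x : 'rV[R]_l) 0 i)]].

Lemma boxes_measurable : (@measurable _ V) = <<s boxes >>.
Proof.
apply/seteqP; split.
  pose f := (id : g_sigma_algebraType boxes -> 'rV[R]_l).
  have mf : measurable_fun [set: g_sigma_algebraType boxes] (f : _ -> V).
    apply: measurable_fun_mx => i0 i _ A mA; rewrite setTI; apply: sub_sigma_algebra.
    exists (fun k => if k == i then A else setT); split; first by move=> k; case: ifP.
    apply/seteqP; split => x /=.
      by move=> xA k; case: ifPn => // /eqP ->; rewrite -(ord1 i0).
    by move=> /(_ i); rewrite eqxx (ord1 i0).
  move=> A mA; have := mf measurableT A mA; by rewrite setTI.
apply: smallest_sub; first exact: sigma_algebra_measurable.
move=> _ [A [mA ->]].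
rewrite (_ : [set _ | _] = \bigcap_(i in [set: 'I_l]) ((fun x : V => (x : 'rV[R]_l) 0 i) @^-1` A i)).
  apply: fin_bigcap_measurable; first exact: finite_finset.
  by move=> i _; rewrite -[X in measurable X]setTI; exact: measurable_entry.
by apply/seteqP; split => x /= h i; [move=> _; exact: h|exact: (h i I)].
Qed.

Lemma measurable_zrow e : measurable_fun [set: T] (zrow e : T -> V).
Proof.
apply: measurable_fun_mx => i j; under eq_fun do rewrite mxE.
exact: measurable_funP.
Qed.

(** At distinct indices the probability of a box is the product of the probabilities of its sides,
    whatever the indices are, and boxes form a pi-system generating the Borel sets. *)
Lemma zrow_law e e' : injective e -> injective e' -> forall B : set V, measurable B ->
  P (zrow e @^-1` B) = P (zrow e' @^-1` B).
Proof.
move=> ei ei' B mB.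
have cov : \bigcup_(k in [set: nat]) [set: V] = [set: V].
  by apply/seteqP; split => // x _; exists 0%N.
have boxI : setI_closed boxes.
  move=> _ _ [A1 [m1 ->]] [A2 [m2 ->]]; exists (fun i => A1 i `&` A2 i); split.
    by move=> i; exact: measurableI.
  apply/seteqP; split => x /=; first by move=> [h1 h2] i; split; [exact: h1|exact: h2].
  by move=> h; split => i; case: (h i).
have boxT : boxes setT by exists (fun=> setT); split => //; apply/seteqP; split.
have boxP (f : 'I_l -> nat) (A : 'I_l -> set R) : injective f -> (forall i, measurable (A i)) ->
    P (zrow f @^-1` [set x | forall i, A i ((x : 'rV[R]_l) 0 i)]) = (\prod_(i < l) distribution P (Z 0%N) (A i))%E.
  move=> fi mA; have [Zind Zid] := Ziid.
  pose S := [fset f i | i in 'I_l]%fset.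
  (* Rewrites a condition on the coordinate [i] as one on the index [f i]; injectivity makes the
     intersection trivial at these indices. *)
  pose A' j := \bigcap_(i in [set i | f i = j]) A i.
  have mA' j : measurable (A' j).
    by apply: fin_bigcap_measurable => //; exact: finite_finset.
  have A'f i : A' (f i) = A i.
    apply/seteqP; split => x /=; first by apply.
    by move=> Ax k /fi ->.
  have -> : zrow f @^-1` [set x | forall i, A i ((x : 'rV[R]_l) 0 i)] =
      \bigcap_(j in [set` S]) (Z j @^-1` A' j).
    apply/seteqP; split => w /=.
      move=> h j /= /imfsetP[i _ ->] /=; rewrite A'f; have := h i; by rewrite mxE.
    move=> h i; rewrite mxE -A'f; apply: h => /=; exact: in_imfset.
  rewrite Zind// big_imfset/=; last by move=> i j _ _; exact: fi.
  rewrite big_enum/=; apply: eq_bigr => i _.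
  by rewrite A'f (Zid 0%N (f i)).
apply: (@measure_unique _ R V boxes (fun=> setT) boxes_measurable boxI (fun=> boxT) cov
  (distribution P (mfun_of (measurable_zrow e))) (distribution P (mfun_of (measurable_zrow e')))) => //.
  move=> _ [A [mA ->]]; exact (etrans (boxP e A ei mA) (esym (boxP e' A ei' mA))).
by move=> _; rewrite /= ltey_eq fin_num_measure.
Qed.

End RowLaw.

(** * Disjoint arguments in the nonconventional products *)

Section Nonconventional.
Context (R : realType) (d l : nat) (hl : (1 < l)%N).
Context (disp : measure_display) (T : measurableType disp) (P : probability T R).
Variables (xi : nat -> {RV P >-> R}) (F : 'rV[R]_l -> 'M[R]_d) (q : 'I_l -> nat -> nat).
Hypothesis xi_iid : iid (fun n => xi n.+1).
Hypothesis F_meas : measurable_fun [set: borel 'rV[R]_l] (F : borel 'rV[R]_l -> borel 'M[R]_d).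
Hypothesis q_incr : forall (i : 'I_l) (m n : nat), (0 < m)%N -> (m < n)%N -> (q i m < q i n)%N.
Hypothesis q_lt : forall (i j : 'I_l) (n : nat), (i < j)%N -> (0 < n)%N -> (q i n < q j n)%N.
Hypothesis q_ge1 : (1 <= q (Ordinal (ltnW hl)) 1)%N.
Local Notation M := (borel 'M[R]_d).
Local Notation Z := (fun n => xi n.+1).
Local Notation X := (nonconventional F q (fun n => xi n : T -> R)).

Lemma q_gt0 i n : (0 < n)%N -> (0 < q i n)%N.
Proof.
move=> n0; apply: leq_trans q_ge1 _.
apply: (@leq_trans (q i 1)).
  have [i0|i0] := posnP i; last by apply: ltnW; apply: q_lt.
  by rewrite (_ : i = Ordinal (ltnW hl))//; exact: val_inj.
by case: n n0 => // -[|n] _ //; apply/ltnW/q_incr.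
Qed.

Lemma q_le (i j : 'I_l) n : (i <= j)%N -> (0 < n)%N -> (q i n <= q j n)%N.
Proof.
move=> ij n0; have [->//|nij] := eqVneq i j.
by apply/ltnW/q_lt => //; rewrite ltn_neqAle ij andbT.
Qed.

(* Indices refer to the shifted sequence n |-> xi n.+1, since xi 0 is a junk value. *)
Definition past (n : nat) : set nat := [set j | exists i, j = (q i n).-1].

Lemma nonconventional_zrow n : (0 < n)%N ->
  X n = (fun w => F (zrow Z (fun i => (q i n).-1) w)).
Proof.
move=> n0; apply/funext => w; congr F; apply/rowP => i; rewrite !mxE.
by rewrite prednK ?q_gt0.
Qed.

Lemma measurable_nonconventional n : (0 < n)%N ->
  measurable_fun [set: g_sigma_algebraType (cylinders Z (past n))]
    (X n : g_sigma_algebraType (cylinders Z (past n)) -> M).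
Proof.
move=> n0; rewrite nonconventional_zrow//; apply: (measurableT_comp F_meas).
apply: measurable_fun_mx => i j.
rewrite (_ : (fun w => _) = (xi (q j n).-1.+1 : T -> R)); last by apply/funext => w; rewrite mxE.
by apply: (measurable_coord (Z := Z)); exists j.
Qed.

Lemma nonconventional_law m n (A : set M) : (0 < m)%N -> (0 < n)%N -> measurable A ->
  P ((X m : T -> M) @^-1` A) = P ((X n : T -> M) @^-1` A).
Proof.
move=> m0 n0 mA; rewrite !nonconventional_zrow//.
have inj k : (0 < k)%N -> injective (fun i => (q i k).-1).
  move=> k0 i j /(congr1 S); rewrite !prednK ?q_gt0// => E.
  apply: val_inj; case: (ltngtP i j) => // h.
    by have := q_lt h k0; rewrite E ltnn.
  by have := q_lt h k0; rewrite E ltnn.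
have mB : measurable ((F : borel 'rV[R]_l -> M) @^-1` A).
  by rewrite -[X in measurable X]setTI; exact: F_meas.
exact (zrow_law xi_iid (inj m m0) (inj n n0) mB).
Qed.

(** Suppose that [q i m] equals [q i' m']. If [i <= i'], strict growth in the argument already gives
    [q i m < q i' m']. If [i' < i], the spreading gives [q i' m' < q i' (m + s) <= q i'.+1 m <= q i
    m]. *)
Lemma past_disjoint (s : nat) m m' j : (0 < m < m')%N -> (m' < m + s)%N ->
  (forall i i' : 'I_l, i' = i.+1 :> nat -> (q i (m + s) <= q i' m)%N) ->
  past m j -> past m' j -> False.
Proof.
move=> /andP[m0 mm] ms H [i ->] [i'].
have m'0 : (0 < m')%N by rewrite (leq_trans m0)// ltnW.
move=> /(congr1 S); rewrite !prednK ?q_gt0// => E.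
have [ii'|ii'] := leqP i i'.
  have := q_le ii' m0; rewrite E leqNgt => /negP; apply; exact: q_incr.
have lt : (i'.+1 < l)%N by apply: leq_ltn_trans ii' (ltn_ord i).
have h1 := H i' (Ordinal lt) erefl.
have h2 : (q (Ordinal lt) m <= q i m)%N by exact: q_le.
have h3 : (q i' m' < q i' (m + s))%N by exact: q_incr.
by have := leq_ltn_trans (leq_trans h1 h2) (eq_ind_r (fun z => z < _)%N h3 E); rewrite ltnn.
Qed.

End Nonconventional.

(** * Growth along blocks *)

Section Chain.
Variable R : realType.

(** By induction each new factor multiplies the norm by at least [rho]. The condition on [rho] says
    that the norm of two consecutive factors exceeds the gain to be proved by more than the error
    from the minors. *)
Lemma avalanche_chain n (D M : nat -> 'M[R]_n) J a b m rho : 0 < rho ->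
  M 0%N = D 0%N -> (forall j, M j.+1 = D j.+1 *m M j) -> rho <= N1 (D 0%N) ->
  (forall j, (j <= J)%N -> N1 (D j) <= a) ->
  (forall j, (j <= J)%N -> m2 (D j) <= m) ->
  (forall j, (j < J)%N -> b <= N1 (D j.+1 *m D j)) ->
  rho * a + a * m / rho <= b ->
  rho ^+ J.+1 <= N1 (M J).
Proof.
move=> rho0 M0 MS D0 Da Dm Db H.
have a0 : 0 < a by exact: (lt_le_trans rho0 (le_trans D0 (Da 0%N _))).
have m0 : 0 <= m by exact: (le_trans (m2_ge0 _) (Dm 0%N _)).
have e0 : 0 <= a * m / rho by rewrite divr_ge0 ?mulr_ge0 ?(ltW a0) ?(ltW rho0).
have b0 : 0 < b by apply: lt_le_trans H; rewrite ltr_pwDl// mulr_gt0.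
have step j : (j < J)%N -> rho * N1 (M j) <= N1 (M j.+1).
  elim: j => [|j IH] jJ.
    rewrite MS M0; apply: le_trans (Db _ jJ); apply: le_trans H.
    by rewrite ler_wpDr// ler_pM2l// Da.
  have {}IH := IH (ltnW jJ).
  have al0 : 0 < N1 (D j.+1).
    rewrite lt_neqAle N1_ge0 andbT; apply/eqP => E.
    have := le_trans (Db _ jJ) (N1M _ _); rewrite -E mulr0 leNgt => /negP; exact.
  (* The middle factor is [D j.+1]. The error involves the norm of [M j], which the previous step
     bounds by that of [M j.+1] divided by [rho], so it is relative to the current norm. *)
  have av := avalanche (D j.+2) (D j.+1) (M j).
  rewrite -mulmxA -!MS in av.
  have h1 : b * N1 (M j.+1) <= N1 (D j.+2 *m D j.+1) * N1 (M j.+1).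
    by rewrite ler_wpM2r ?N1_ge0// Db.
  have h2 : N1 (D j.+2) * N1 (M j) * m2 (D j.+1) <= a * m / rho * N1 (M j.+1).
    have -> : a * m / rho * N1 (M j.+1) = a * (N1 (M j.+1) / rho) * m by ring.
    apply: ler_pM; rewrite ?m2_ge0 ?mulr_ge0 ?N1_ge0 ?(Dm _ (ltnW jJ))//.
    by apply: ler_pM; rewrite ?N1_ge0 ?(Da _ jJ)// ler_pdivlMr// mulrC.
  have h3 : (rho * a + a * m / rho) * N1 (M j.+1) <= b * N1 (M j.+1).
    by rewrite ler_wpM2r ?N1_ge0.
  have h4 : rho * N1 (D j.+1) * N1 (M j.+1) <= rho * a * N1 (M j.+1).
    by rewrite ler_wpM2r ?N1_ge0// ler_wpM2l ?(ltW rho0)// Da// ltnW.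
  have h5 : rho * N1 (M j.+1) * N1 (D j.+1) <= N1 (M j.+2) * N1 (D j.+1).
    rewrite mulrAC; rewrite mulrDl in h3; lra.
  by rewrite ler_pM2r in h5.
suff: forall j, (j <= J)%N -> rho ^+ j.+1 <= N1 (M j) by apply.
elim=> [|j IH] jJ; first by rewrite expr1 M0.
by apply: le_trans (step _ jJ); rewrite exprS ler_pM2l// IH// ltnW.
Qed.

Variables (d : nat) (x : nat -> 'M[R]_d).
(** The factors have indices [n + 1] to [n + len], since [lprod] ignores the index 0; consecutive
    windows therefore neither overlap nor leave a gap. *)
Definition wdw n len := lprod (fun m => x (n + m)%N) len.

Lemma lprod_split n len : lprod x (n + len) = wdw n len *m lprod x n.
Proof.
elim: len => [|len IH]; first by rewrite addn0 mul1mx.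
by rewrite addnS /= IH mulmxA /wdw /= addnS.
Qed.

Lemma wdw_split n len len' : wdw n (len + len') = wdw (n + len) len' *m wdw n len.
Proof.
elim: len' => [|k IH]; first by rewrite addn0 mul1mx.
have -> : wdw n (len + k.+1) = x (n + (len + k.+1))%N *m wdw n (len + k) by rewrite addnS.
by rewrite IH mulmxA addnA.
Qed.

Lemma chain_upper k p L J U : 0 <= U ->
  (forall j, (j < J)%N -> N1 (compound k (wdw (p + j * L) L)) <= U) ->
  N1 (compound k (lprod x (p + J * L))) <= U ^+ J * N1 (compound k (lprod x p)).
Proof.
move=> U0; elim: J => [|J IH] H; first by rewrite mul0n addn0 expr0 mul1r.
rewrite mulSn addnCA addnC lprod_split compound_mul.
apply: le_trans (N1M _ _) _; rewrite exprS -mulrA; apply: ler_pM; rewrite ?N1_ge0//.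
  exact: H.
by apply: IH => j jJ; apply: H; exact: ltnW.
Qed.

Lemma chain_lower k p L J a b m rho : 0 < rho ->
  rho <= N1 (compound k (wdw p L)) ->
  (forall j, (j <= J)%N -> N1 (compound k (wdw (p + j * L) L)) <= a) ->
  (forall j, (j <= J)%N -> m2 (compound k (wdw (p + j * L) L)) <= m) ->
  (forall j, (j < J)%N -> b <= N1 (compound k (wdw (p + j * L) (L + L)))) ->
  rho * a + a * m / rho <= b ->
  rho ^+ J.+1 <= N1 (compound k (wdw p (J.+1 * L))).
Proof.
move=> rho0 D0 Da Dm Db H.
apply: (@avalanche_chain _ (fun j => compound k (wdw (p + j * L) L))
  (fun j => compound k (wdw p (j.+1 * L))) J a b m rho) => //.
- by rewrite mul1n addn0.
- by move=> j; rewrite -compound_mul -wdw_split (mulSn j.+1) addnC.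
- by rewrite addn0.
- move=> j jJ; have := Db j jJ.
  by rewrite wdw_split compound_mul -addnA -mulSnr.
Qed.

Lemma N1_lprod_le B n : 1 <= B -> (forall i, (0 < i <= n)%N -> N1 (x i) <= B) ->
  N1 (lprod x n) <= d%:R * B ^+ n.
Proof.
move=> B1; elim: n => [|n IH] H; first by rewrite N1_1 mulr1.
apply: le_trans (N1M _ _) _; rewrite exprS mulrCA; apply: ler_pM; rewrite ?N1_ge0 ?H ?leqnn//.
by apply: IH => i /andP[i0 ilen]; rewrite H// i0 ltnW.
Qed.

Lemma det_lprod n : (forall i, (0 < i)%N -> \det (x i) = 1) -> \det (lprod x n) = 1.
Proof. by move=> H; elim: n => [|n IH] /=; rewrite ?det1// det_mulmx IH H// mulr1. Qed.

End Chain.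

Lemma compound_N1_gt0 (R : realType) d k (g : 'M[R]_d) : (k <= d)%N -> \det g = 1 ->
  0 < N1 (compound k g).
Proof.
move=> kd g1; rewrite lt_neqAle N1_ge0 andbT; apply/eqP => E.
have := gram_prod_le_compound g kd; rewrite -E expr0n/= leNgt => /negP; apply.
exact: gram_prod_gt0.
Qed.

Lemma expR_dominates (R : realType) (c e : R) : 0 < e ->
  exists n0, forall n, (n0 <= n)%N -> c <= expR (e * n%:R).
Proof.
move=> e0; exists (Num.truncn (c / e)).+1 => n h.
have := expR_ge1Dx (e * n%:R).
have : c / e < n%:R by apply: lt_le_trans (truncnS_gt _) _; rewrite ler_nat.
rewrite ltr_pdivrMr//; lra.
Qed.

(** * Concentration in every exterior power *)

Section CompoundDeviations.
Context (R : realType) (d : nat) (d0 : (0 < d)%N).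
Local Notation M := (borel 'M[R]_d).
Variables (mu : probability M R) (alpha : R).
Hypothesis mu_SL : {ae mu, forall g, \det (g : 'M[R]_d) = 1}.
Hypothesis alpha0 : 0 < alpha.
Hypothesis mu_mom : (Ex mu (fun g : M => (N1 (g : 'M[R]_d) `^ alpha)%R) < +oo)%E.

Let mN1 : measurable_fun [set: M] (fun g : M => N1 (g : 'M[R]_d)).
Proof. by apply: measurable_N1; exact: measurable_id. Qed.

(** Adding 1 preserves submultiplicativity and makes the base at least 1, so that smaller exponents
    give smaller moments. *)
Let h (g : M) : R := (1 + N1 (g : 'M[R]_d)) `^ alpha.

Let mh : measurable_fun [set: M] h.
Proof. by apply: measurable_fun_powR; apply: measurable_funD. Qed.

Lemma mlaw_N1_moment n : (Ex (mlaw mu n) h < +oo)%E.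
Proof.
apply: Ex_mlaw_submul => //.
- by move=> g; exact: powR_ge0.
- move=> g g'; rewrite /h -powRM ?addr_ge0 ?N1_ge0//.
  apply: ge0_ler_powR; rewrite ?nnegrE ?(ltW alpha0) ?mulr_ge0 ?addr_ge0 ?N1_ge0//.
  apply: le_trans (_ : 1 + N1 (g : 'M[R]_d) * N1 (g' : 'M[R]_d) <= _).
    by rewrite lerD2l N1M.
  by rewrite mulrDl !mulrDr !mul1r mulr1 -!addrA lerD2l addrA lerDr addr_ge0 ?N1_ge0.
pose c := (2 : R) `^ alpha; have c0 : 0 <= c by exact: powR_ge0.
have mNa : measurable_fun [set: M] (fun g : M => N1 (g : 'M[R]_d) `^ alpha).
  exact: measurable_fun_powR.
have mc1 : measurable_fun [set: M] (fun g : M => 1 + N1 (g : 'M[R]_d) `^ alpha).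
  by apply: measurable_funD.
apply: (@le_lt_trans _ _ (Ex mu (fun g : M => (c * (1 + N1 (g : 'M[R]_d) `^ alpha))%R))).
  apply: Ex_le => //.
  - by move=> g; exact: powR_ge0.
  - exact: measurable_fun_scale.
  move=> g; rewrite /h; have [g1|g1] := leP (N1 (g : 'M[R]_d)) 1.
    apply: (@le_trans _ _ (2 `^ alpha)); last by rewrite ler_peMr// lerDl powR_ge0.
    apply: ge0_ler_powR; rewrite ?nnegrE ?addr_ge0 ?N1_ge0 ?(ltW alpha0)//; lra.
  apply: (@le_trans _ _ ((2 * N1 (g : 'M[R]_d)) `^ alpha)).
    apply: ge0_ler_powR; rewrite ?nnegrE ?addr_ge0 ?mulr_ge0 ?N1_ge0 ?(ltW alpha0)//; lra.
  by rewrite powRM ?N1_ge0// ler_wpM2l// lerDr.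
rewrite ExZ//; last by move=> g; rewrite addr_ge0 ?powR_ge0.
rewrite ExD//; last by move=> g; exact: powR_ge0.
rewrite Ex_cst; apply: lte_mul_pinfty => //; apply: lte_add_pinfty => //; exact: ltry.
Qed.

Lemma Nb_SL_le : exists2 c : R, 0 < c & forall g : 'M[R]_d, \det g = 1 ->
  Nb g <= c * (1 + N1 g) ^+ d.
Proof.
have [c c0 H] := N1_invmx_le R d; exists (1 + c); first exact: addr_gt0.
move=> g g1; rewrite /Nb mulrDl mul1r.
have u1 : 1 <= 1 + N1 g by rewrite lerDl N1_ge0.
have u0 : 0 <= 1 + N1 g by exact: le_trans u1.
apply: lerD.
  by apply: (@le_trans _ _ (1 + N1 g)); rewrite ?lerDr// -[leLHS]expr1 ler_weXn2l.
apply: le_trans (H _ g1) _; rewrite ler_pM2l//.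
apply: (@le_trans _ _ ((1 + N1 g) ^+ d.-1)).
  by apply: lerXn2r; rewrite ?nnegrE ?N1_ge0// lerDr.
by rewrite ler_weXn2l// leq_pred.
Qed.

Section FixedDegree.
Variable k : nat.
Hypothesis kd : (k <= d)%N.
Let claw := push_law (mlaw mu) (@measurable_crep R k d).

Lemma claw_conv_sg : conv_sg claw.
Proof.
apply: push_conv_sg; first exact: mlaw_conv_sg.
by move=> n m; apply: aeW => g; apply: aeW => g'; exact: crep_mul.
Qed.

Lemma claw_moments : moments claw (alpha / (d * k).+1%:R).
Proof.
(* The size of the exterior power is at most a constant times [1 + N1 g] to the power [d * k];
   dividing [alpha] by slightly more than [d * k] keeps the moment finite and also covers the degree
   0. *)
set beta := alpha / _; have b0 : 0 < beta by rewrite divr_gt0.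
have [c c0 Hc] := Nb_crep_le R k d; have [c' c'0 Hc'] := Nb_SL_le.
apply: (@push_moments _ _ _ _ _ _ _ c k b0 (ltW c0)) => n; last first.
  apply: ae_imp (mlaw_SL mu_SL n) => g g1.
  have ug : (g : 'M[R]_d) \in unitmx by rewrite unitmxE g1 unitr1.
  by split; [exact: (crep_inv k ug).1|exact: Hc].
have kb0 : 0 <= k%:R * beta by rewrite mulr_ge0// ltW.
apply: (@le_lt_trans _ _ ((c' `^ (k%:R * beta))%:E * Ex (mlaw mu n) h)%E); last first.
  by rewrite lte_mul_pinfty ?lee_fin ?powR_ge0// mlaw_N1_moment.
rewrite -ExZ ?powR_ge0//; last by move=> g; exact: powR_ge0.
apply: Ex_le_ae => //.
- by move=> g; exact: powR_ge0.
- by move=> g; rewrite mulr_ge0 ?powR_ge0.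
- by apply: measurable_fun_powR; apply: measurable_Nb; exact: measurable_id.
- exact: measurable_fun_scale.
apply: ae_imp (mlaw_SL mu_SL n) => g g1 /=.
have u1 : 1 <= 1 + N1 (g : 'M[R]_d) by rewrite lerDl N1_ge0.
have u0 : 0 <= 1 + N1 (g : 'M[R]_d) by exact: le_trans u1.
apply: (@le_trans _ _ ((c' * (1 + N1 (g : 'M[R]_d)) ^+ d) `^ (k%:R * beta))).
  by apply: ge0_ler_powR; rewrite ?kb0 ?nnegrE ?Nb_ge0 ?mulr_ge0 ?exprn_ge0 ?(ltW c'0) ?(Hc' _ g1).
rewrite powRM ?exprn_ge0 ?(ltW c'0)// ler_wpM2l ?powR_ge0//.
rewrite -powR_mulrn// -powRrM /h; apply: ler_powR => //.
rewrite mulrA -natrM /beta mulrCA ler_piMr ?(ltW alpha0)//.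
by rewrite ler_pdivrMr// mul1r ler_nat.
Qed.

Definition crange (t e : R) n := [set g : M |
  expR ((t - e) * n%:R) <= N1 (compound k (g : 'M[R]_d)) <= expR ((t + e) * n%:R)].

Lemma measurable_crange t e n : measurable (crange t e n).
Proof.
have mC : measurable_fun [set: M] (fun g : M => N1 (compound k (g : 'M[R]_d))).
  by apply: measurable_N1; exact: measurable_compound.
rewrite (_ : crange t e n = [set g : M | expR ((t - e) * n%:R) <= N1 (compound k (g : 'M[R]_d))] `&`
  [set g : M | N1 (compound k (g : 'M[R]_d)) <= expR ((t + e) * n%:R)]).
  by apply: measurableI; apply: measurable_set_le.
by apply/seteqP; split => g /=; [move=> /andP|move=> H; apply/andP].
Qed.

(** The constants between the two norms are absorbed by half of the tolerance once [n] is large. *)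
Lemma crange_in_range t e : 0 < e -> exists n0, forall n, (n0 <= n)%N ->
  crange t (e / 2) n `<=` (@crep R k d : M -> borel 'M[R]_(crank R k d)) @^-1` in_range t e n /\
  (@crep R k d : M -> borel 'M[R]_(crank R k d)) @^-1` in_range t (e / 2) n `<=` crange t e n.
Proof.
move=> e0; have e20 : 0 < e / 2 by rewrite divr_gt0.
have [c1 c10 H1] := N1_crep_le R k d; have [c2 c20 H2] := N1_compound_crep R k d.
have [n0 Hn] := expR_dominates (c1 + c2) e20; exists n0 => n /Hn {}Hn.
set E := expR (e / 2 * n%:R) in Hn; have E0 : 0 < E by exact: expR_gt0.
have up : expR ((t + e) * n%:R) = E * expR ((t + e / 2) * n%:R).
  by rewrite -expRD; congr expR; field.
have lo : expR ((t - e / 2) * n%:R) = E * expR ((t - e) * n%:R).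
  by rewrite -expRD; congr expR; field.
have cE1 : c1 <= E by lra. have cE2 : c2 <= E by lra.
have aux x y lo' hi' : 0 <= x -> 0 <= y -> x <= c1 * y \/ x <= c2 * y -> y <= c1 * x \/ y <= c2 * x ->
    E * lo' <= x <= hi' -> lo' <= y <= E * hi'.
  move=> x0 y0 xy yx /andP[h1 h2].
  have xy' : x <= E * y by case: xy => /le_trans; apply; rewrite ler_wpM2r.
  have yx' : y <= E * x by case: yx => /le_trans; apply; rewrite ler_wpM2r.
  apply/andP; split; first by rewrite -(ler_pM2l E0) (le_trans h1).
  by apply: le_trans yx' _; rewrite ler_pM2l.
split => g; rewrite /crange /in_range /= lo up; apply: aux; rewrite ?N1_ge0//; auto.
Qed.

Variable Gam : R.
Hypothesis typ : forall e, 0 < e -> exists n0, forall n, (n0 <= n)%N ->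
  ((2^-1)%:E <= mlaw mu n (crange Gam e n))%E.

Lemma compound_large_deviations e : 0 < e ->
  exists2 c, 0 < c & exists C, forall n,
  (mlaw mu n (~` crange Gam e n) <= (C * expR (- c * n%:R))%:E)%E.
Proof.
move=> e0; have e20 : 0 < e / 2 by rewrite divr_gt0.
have mpre t e' n : measurable ((@crep R k d : M -> borel 'M[R]_(crank R k d)) @^-1` in_range t e' n).
  by rewrite -[X in measurable X]setTI; apply: measurable_crep => //; exact: measurable_in_range.
have r0 : (0 < crank R k d)%N.
  rewrite lt0n mxrank_eq0 -N1_gt0; apply: compound_N1_gt0 => //; exact: det1.
have typC : typical claw Gam.
  move=> e' e'0; have [n1 H1] := crange_in_range Gam e'0.
  have e'20 : 0 < e' / 2 by rewrite divr_gt0.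
  have [n2 H2] := typ e'20; exists (maxn n1 n2) => n; rewrite geq_max => /andP[h1 h2].
  apply: le_trans (H2 n h2) _.
  by apply: le_measure; rewrite ?inE; [exact: measurable_crange|exact: mpre|exact: (H1 n h1).1].
have [c c0 [C HC]] := large_deviations claw_conv_sg claw_moments r0 typC e20.
have [n1 H1] := crange_in_range Gam e0.
(* The second term of the constant makes the bound at least 1 at the finitely many times below [n1],
   where it is then trivial. *)
exists c => //; exists (`|C| + expR (c * n1%:R)) => n.
have [h1|h1] := leqP n1 n.
  apply: (@le_trans _ _ (C * expR (- c * n%:R))%:E); last first.
    by rewrite lee_fin ler_wpM2r ?expR_ge0// (le_trans (ler_norm _))// lerDl expR_ge0.
  apply: le_trans (HC n); apply: le_measure; rewrite ?inE.
  - by apply: measurableC; exact: measurable_crange.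
  - by apply: measurableC; exact: mpre.
  - by apply: subsetC; exact: (H1 n h1).2.
apply: (@le_trans _ _ 1%E); first by apply: probability_le1; apply: measurableC; exact: measurable_crange.
rewrite lee_fin [leRHS]mulrDl -expRD ler_wpDl ?mulr_ge0 ?expR_ge0//.
have hn : n%:R <= n1%:R :> R by rewrite ler_nat ltnW.
apply: (@le_trans _ _ (expR 0)); first by rewrite expR0.
by rewrite ler_expR mulNr subr_ge0 ler_wpM2l ?(ltW c0).
Qed.

End FixedDegree.
End CompoundDeviations.

(** * Borel-Cantelli for all logarithmic blocks *)

Lemma nneseries_le (R : realType) (u : nat -> \bar R) (K : \bar R) :
  (forall n, (0 <= u n)%E) -> (forall n, (\sum_(0 <= i < n) u i <= K)%E) ->
  (\sum_(n <oo) u n <= K)%E.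
Proof.
move=> u0 H; apply: lime_le; first by apply: is_cvg_nneseries => n _ _; exact: u0.
by apply: nearW => n; exact: H.
Qed.

(** The bound has this form because its series telescopes. *)
Lemma borel_cantelli_sq d (T : measurableType d) (R : realType) (P : probability T R)
    (A : nat -> set T) (K : R) n0 : 0 <= K -> (forall n, measurable (A n)) ->
  (forall n, (n0 <= n)%N -> (P (A n) <= (K / (n.+1%:R * n.+2%:R))%:E)%E) ->
  {ae P, forall w, exists n1, forall n, (n1 <= n)%N -> ~ A n w}.
Proof.
move=> K0 mA H; pose F n := if (n0 <= n)%N then A n else set0.
have mF n : measurable (F n) by rewrite /F; case: ifP.
have bF n : (P (F n) <= (K * (n.+1%:R^-1 - n.+2%:R^-1))%:E)%E.
  have E : n.+1%:R^-1 - n.+2%:R^-1 = (n.+1%:R * n.+2%:R)^-1 :> R.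
    have a0 : n.+1%:R != 0 :> R by rewrite pnatr_eq0.
    have b0 : n.+1%:R + 1 != 0 :> R by rewrite natr1 pnatr_eq0.
    rewrite -(natr1 n.+1); move: (n.+1%:R) a0 b0 => a a0 b0.
    by field; rewrite a0 b0.
  rewrite E /F; case: ifP => [/H//|_]; rewrite measure0 lee_fin mulr_ge0// invr_ge0 mulr_ge0.
have S0 : P (lim_sup_set F) = 0%E.
  apply: lim_sup_set_cvg0 => //; apply: (@le_lt_trans _ _ K%:E); last exact: ltry.
  apply: nneseries_le => // n.
  apply: (@le_trans _ _ (\sum_(0 <= i < n) (K * (i.+1%:R^-1 - i.+2%:R^-1))%:E)%E).
    by apply: lee_sum => i _; exact: bF.
  rewrite sumEFin -mulr_sumr lee_fin.
  have -> : \sum_(0 <= i < n) (i.+1%:R^-1 - i.+2%:R^-1) = 1 - n.+1%:R^-1 :> R.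
    elim: n => [|n IH]; first by rewrite big_nil invr1 subrr.
    by rewrite big_nat_recr//= IH addrA subrK.
  by rewrite ler_piMr// gerBl invr_ge0.
exists (lim_sup_set F); split => //.
  by apply: bigcapT_measurable => n; apply: bigcup_measurable => k _; exact: mF.
move=> w /= nH n _ /=; apply: contrapT => H'.
apply: nH; exists (maxn n n0) => m; rewrite geq_max => /andP[nm n0m] Am.
by apply: H'; exists m => //; rewrite /F n0m.
Qed.

Lemma uniform_decay (R : realType) m (u : nat -> nat -> \bar R) :
  (forall k, (k < m)%N -> exists2 c, 0 < c & exists C, forall n, (u k n <= (C * expR (- c * n%:R))%:E)%E) ->
  exists2 c, 0 < c & exists2 C, 0 <= C & forall k n, (k < m)%N -> (u k n <= (C * expR (- c * n%:R))%:E)%E.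
Proof.
elim: m => [|m IH] H; first by exists 1 => //; exists 0.
have [c c0 [C C0 HC]] := IH (fun k km => H k (ltnW km)).
have [c' c'0 [C' HC']] := H m (leqnn _).
exists (Num.min c c'); first by rewrite lt_min c0 c'0.
exists (C + `|C'|); first by rewrite addr_ge0.
have aux D c1 n : D <= C + `|C'| -> Num.min c c' <= c1 ->
    D * expR (- c1 * n%:R) <= (C + `|C'|) * expR (- Num.min c c' * n%:R).
  move=> h1 h2; apply: (@le_trans _ _ ((C + `|C'|) * expR (- c1 * n%:R))).
    by rewrite ler_wpM2r ?expR_ge0.
  by rewrite ler_wpM2l ?addr_ge0// ler_expR ler_wpM2r// lerN2.
move=> k n; rewrite ltnS leq_eqVlt => /orP[/eqP ->|km].
  apply: le_trans (HC' n) _; rewrite lee_fin aux// ?ge_min ?lexx ?orbT//.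
  by rewrite (le_trans (ler_norm _))// lerDr.
by apply: le_trans (HC k n km) _; rewrite lee_fin aux// ?ge_min ?lexx// lerDl.
Qed.

Section Scales.
Variable R : realType.

Definition block_len (c1 : R) N : nat := (Num.truncn (c1 * ln N%:R)).+1.
(** From the square root of [N] on, [ln n] is at least half of [ln N], so a window of length
    proportional to [ln N] is also short on the scale of [ln n], where the spreading is assumed. The
    skipped prefix is negligible compared with [N]. *)
Definition start_pt N : nat := (Num.truncn (Num.sqrt (N%:R : R))).+1.

Lemma block_len_ge (c1 : R) N : c1 * ln N%:R <= (block_len c1 N)%:R.
Proof. by apply: ltW; exact: truncnS_gt. Qed.

Lemma block_len_le (c1 : R) N : 0 <= c1 -> (0 < N)%N -> (block_len c1 N)%:R <= c1 * ln N%:R + 1.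
Proof.
move=> c0 N0; rewrite /block_len -natr1 lerD2r truncn_le// mulr_ge0// ln_ge0// ler1n//.
Qed.

Lemma start_pt_ge N : (N%:R : R) <= (start_pt N)%:R ^+ 2.
Proof.
rewrite -[leLHS]sqr_sqrtr//; apply: lerXn2r; rewrite ?nnegrE ?sqrtr_ge0//.
by apply: ltW; exact: truncnS_gt.
Qed.

Lemma start_pt_le N : (start_pt N)%:R <= Num.sqrt (N%:R : R) + 1.
Proof. by rewrite /start_pt -natr1 lerD2r truncn_le// sqrtr_ge0. Qed.

Lemma scales (c1 K eta : R) : 0 <= c1 -> 0 <= K -> 0 < eta -> exists N0, forall N, (N0 <= N)%N ->
  K * (1 + (start_pt N + block_len c1 N)%:R * (ln N%:R + 1)) <= eta * N%:R.
Proof.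
move=> c0 K0 eta0.
pose A := 1 + K * (16 + 20 * c1) / eta.
have A1 : 1 <= A by rewrite lerDl divr_ge0 ?(ltW eta0)// mulr_ge0//; lra.
exists (Num.truncn (A ^+ 4)).+1 => N h.
have NA : A ^+ 4 <= N%:R by apply/ltW/(lt_le_trans (truncnS_gt _)); rewrite ler_nat.
(* With [u] the fourth root of [N], the starting point and the block length are of order at most
   [u ^+ 2] and the logarithm at most [4 * u], so the left side is of order [u ^+ 3]. The constant
   [A] is the value of [u] from which [eta * u ^+ 4] dominates. *)
pose u := Num.sqrt (Num.sqrt (N%:R : R)).
have u0 : 0 <= u by exact: sqrtr_ge0.
have u2 : Num.sqrt (N%:R : R) = u ^+ 2 by rewrite sqr_sqrtr ?sqrtr_ge0.
have u4 : N%:R = u ^+ 4 by rewrite -[4%N]/(2 * 2)%N exprM -u2 sqr_sqrtr.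
have uA : A <= u by move: NA; rewrite u4 ler_pXn2r ?nnegrE// (le_trans _ A1).
have u1 : 1 <= u by exact: le_trans uA.
have up : 0 < u by exact: lt_le_trans u1.
have N0 : (0 < N)%N by apply: leq_trans h.
have lnN : ln (N%:R : R) <= 4 * u.
  rewrite u4 lnXn// -[_ *+ 4]mulr_natl ler_wpM2l//.
  have h1 : -1 < u - 1 by lra.
  have := le_ln1Dx h1; rewrite (_ : 1 + (u - 1) = u); [lra|ring].
have ln0 : 0 <= ln (N%:R : R) by rewrite ln_ge0// ler1n.
have S : (start_pt N + block_len c1 N)%:R <= (3 + 4 * c1) * u ^+ 2.
  have h1 := start_pt_le N; have h2 := block_len_le c0 N0.
  have h3 : c1 * ln (N%:R : R) <= c1 * (4 * u) by rewrite ler_wpM2l.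
  have h4 : c1 * (4 * u) <= c1 * (4 * u ^+ 2) by rewrite ler_wpM2l// ler_wpM2l// expr2 ler_peMr.
  have h5 : 1 <= u ^+ 2 by rewrite exprn_ege1.
  rewrite natrD; rewrite u2 in h1; lra.
have B : (start_pt N + block_len c1 N)%:R * (ln N%:R + 1) <= (3 + 4 * c1) * u ^+ 2 * (5 * u).
  by apply: ler_pM => //; [rewrite addr_ge0|lra].
have C : 1 + (start_pt N + block_len c1 N)%:R * (ln N%:R + 1) <= (16 + 20 * c1) * u ^+ 3.
  have : 1 <= u ^+ 3 by rewrite exprn_ege1.
  have -> : (16 + 20 * c1) * u ^+ 3 = u ^+ 3 + (3 + 4 * c1) * u ^+ 2 * (5 * u) by ring.
  lra.
apply: le_trans (ler_wpM2l K0 C) _.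
have D : K * (16 + 20 * c1) <= eta * u.
  have : K * (16 + 20 * c1) / eta <= u by apply: le_trans uA; rewrite lerDr.
  by rewrite ler_pdivrMr// [leRHS]mulrC.
rewrite u4 (_ : eta * u ^+ 4 = (eta * u) * u ^+ 3); last by ring.
by rewrite mulrA ler_wpM2r// exprn_ge0.
Qed.

(** Two blocks have length at most [2 * c1 * ln N + 2], hence at most [(2 * c1 + 4) * ln N] since
    [ln N >= 1]; passing from [ln N] to [ln n] doubles the constant. *)
Lemma double_block_le (c1 : R) N n : 0 <= c1 -> 1 <= ln (N%:R : R) -> (start_pt N <= n)%N ->
  (block_len c1 N + block_len c1 N <= Num.truncn ((4 * c1 + 8) * ln (n%:R : R)))%N.
Proof.
move=> c0 lnN sn.
have N0 : (0 < N)%N by case: N lnN {sn} => //; rewrite ln0// ler10.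
have n0 : (0 < n)%N by apply: leq_trans sn.
have h2 := block_len_le c0 N0.
have lnn : ln (N%:R : R) <= 2 * ln (n%:R : R).
  rewrite mulr_natl -lnXn ?ltr0n// ler_ln ?posrE ?exprn_gt0 ?ltr0n//.
  apply: le_trans (start_pt_ge N) _; apply: lerXn2r; rewrite ?nnegrE// ler_nat//.
have h3 : (4 * c1 + 8) * (ln (N%:R : R) / 2) <= (4 * c1 + 8) * ln (n%:R : R).
  by rewrite ler_wpM2l ?addr_ge0 ?mulr_ge0// ler_pdivrMr// mulrC.
rewrite truncn_ge_nat ?natrD; last first.
  by apply: le_trans h3; rewrite mulr_ge0 ?addr_ge0 ?mulr_ge0//; lra.
apply: le_trans h3; have : 0 <= c1 * ln (N%:R : R) by rewrite mulr_ge0//; lra.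
lra.
Qed.

End Scales.

Section GoodEvent.
Context (R : realType) (d : nat) (d0 : (0 < d)%N).
Local Notation M := (borel 'M[R]_d).
Context (disp : measure_display) (T : measurableType disp) (P : probability T R).
Variables (mu : probability M R) (alpha : R) (X : nat -> T -> M) (Gam : nat -> R).
Hypothesis mu_SL : {ae mu, forall g, \det (g : 'M[R]_d) = 1}.
Hypothesis alpha0 : 0 < alpha.
Hypothesis mu_mom : (Ex mu (fun g : M => (N1 (g : 'M[R]_d) `^ alpha)%R) < +oo)%E.
Hypothesis mX : forall n, (0 < n)%N -> measurable_fun [set: T] (X n).
Hypothesis mW : forall n len, measurable_fun [set: T] (window X n len : T -> M).
Hypothesis Xmu : forall n A, (0 < n)%N -> measurable A -> P (X n @^-1` A) = mu A.
Hypothesis wlaw : forall sigma : R, 0 < sigma -> exists n1, forall n len (A : set M), (n1 <= n)%N -> (0 < n)%N ->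
  (len <= Num.truncn (sigma * ln n%:R))%N -> measurable A ->
  P ((window X n len : T -> M) @^-1` A) = mlaw mu len A.
Hypothesis typ : forall k, (k <= d)%N -> forall e, 0 < e -> exists n0, forall n, (n0 <= n)%N ->
  ((2^-1)%:E <= mlaw mu n (@crange R d k (Gam k) e n))%E.

(** The double windows supply the norms of products of two consecutive blocks for the avalanche; the
    bound on single factors controls the prefix, where windows are not known to be independent. *)
Definition good (e c1 b : R) N (w : T) :=
  (forall k n, (k <= d)%N -> (start_pt R N <= n <= N)%N ->
     @crange R d k (Gam k) e (block_len c1 N) (window X n (block_len c1 N) w) /\
     @crange R d k (Gam k) e (block_len c1 N + block_len c1 N)
       (window X n (block_len c1 N + block_len c1 N) w)) /\
  (forall i, (0 < i <= N)%N -> N1 (X i w : 'M[R]_d) <= expR (b * ln N%:R)).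

Lemma eventually_good e : 0 < e -> exists2 c1 : R, 0 < c1 & exists2 b : R, 0 <= b &
  {ae P, forall w, exists N0, forall N, (N0 <= N)%N -> good e c1 b N w}.
Proof.
move=> e0.
have [c c0 [C C0 HC]] := @uniform_decay R d.+1 (fun k n => mlaw mu n (~` @crange R d k (Gam k) e n))
  (fun k kd => compound_large_deviations d0 mu_SL alpha0 mu_mom kd (typ kd) e0).
(* The two values of 3 make every single bad event have probability of order [N ^- 3]: the windows
   by concentration, the factors by Markov. Over the [N + 1] positions this leaves order [N ^- 2],
   which is summable. *)
pose c1 := 3 / c; have c10 : 0 < c1 by rewrite divr_gt0.
pose b := 3 / alpha; have b0 : 0 <= b by rewrite divr_ge0// ltW.
exists c1 => //; exists b => //.
pose L := block_len c1; pose s := start_pt R.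
have mcr k e' n : measurable (@crange R d k (Gam k) e' n) by exact: measurable_crange.
pose Wb k n len := (window X n len : T -> M) @^-1` (~` @crange R d k (Gam k) e len).
have mWb k n len : measurable (Wb k n len).
  by rewrite -[X in measurable X]setTI; apply: mW => //; exact: measurableC.
pose Ab N n := if (s N <= n)%N then \big[setU/set0]_(k < d.+1) (Wb k n (L N) `|` Wb k n (L N + L N)) else set0.
have mbig N n : measurable (\big[setU/set0]_(k < d.+1) (Wb k n (L N) `|` Wb k n (L N + L N))).
  by apply: bigsetU_measurable => k _; exact: measurableU.
have mAb N n : measurable (Ab N n) by rewrite /Ab; case: ifP.
pose Bs N := [set g : M | expR (b * ln N%:R) < N1 (g : 'M[R]_d)].
have mN1 : measurable_fun [set: M] (fun g : M => N1 (g : 'M[R]_d)).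
  by apply: measurable_N1; exact: measurable_id.
have mBs N : measurable (Bs N) by apply: measurable_set_lt => //; exact: measurable_cst.
pose Bb N n := if (0 < n)%N then X n @^-1` Bs N else set0.
have mBb N n : measurable (Bb N n).
  rewrite /Bb; case: ifP => // n0.
  by rewrite -[X in measurable X]setTI; apply: mX.
have BI (A : nat -> set T) m : (forall i, measurable (A i)) ->
    (P (\big[setU/set0]_(i < m) A i) <= \sum_(i < m) P (A i))%E.
  by move=> mA; apply: Boole_inequality => i _.
pose bad N := \big[setU/set0]_(n < N.+1) (Ab N n `|` Bb N n).
have mbad N : measurable (bad N) by apply: bigsetU_measurable => n _; exact: measurableU.
have [n1 Hn1] := wlaw (ltac:(by rewrite ltr_wpDl// mulr_ge0 ?(ltW c10)) : 0 < 4 * c1 + 8).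
pose E := fine (Ex mu (fun g : M => (N1 (g : 'M[R]_d) `^ alpha)%R)).
have EE : Ex mu (fun g : M => (N1 (g : 'M[R]_d) `^ alpha)%R) = E%:E.
  by rewrite /E fineK// ge0_fin_numE// Ex_ge0// => g; exact: powR_ge0.
have E0 : 0 <= E by rewrite /E fine_ge0// Ex_ge0// => g; exact: powR_ge0.
pose K0 := d.+1%:R * (C + C) + E.
have K00 : 0 <= K0 by rewrite addr_ge0// mulr_ge0// addr_ge0.
(* The square of [n1] ensures that the starting point is at least [n1], the threshold of the window
   law; the other bound ensures [ln N >= 1]. *)
pose N1' := (maxn (n1 * n1) (Num.truncn (expR 1 : R)).+1).
have bound N : (N1' <= N)%N -> (P (bad N) <= (12 * K0 / (N.+1%:R * N.+2%:R))%:E)%E.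
  rewrite geq_max => /andP[Nn1 Ne].
  have N0 : (0 < N)%N by apply: leq_trans Ne.
  have N0R : 0 < N%:R :> R by rewrite ltr0n.
  have lnN : 1 <= ln (N%:R : R).
    rewrite -[leLHS](expRK (1:R)) ler_ln ?posrE ?expR_gt0//.
    by apply/ltW/(lt_le_trans (truncnS_gt _)); rewrite ler_nat.
  have e3 : expR (- (3 * ln (N%:R : R))) = (N%:R ^+ 3)^-1.
    by rewrite expRN expRM_natl lnK ?posrE.
  have ns n : (s N <= n)%N -> (n1 <= n)%N.
    move=> sn; apply: leq_trans sn; rewrite leqNgt; apply/negP => h.
    have := start_pt_ge R N; rewrite -/(s N) -natrX ler_nat leqNgt => /negP; apply.
    by apply: leq_trans Nn1; rewrite -mulnn ltn_mul.
  have PW k n len : (k < d.+1)%N -> (s N <= n)%N -> (L N <= len)%N -> (len <= L N + L N)%N ->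
      (P (Wb k n len) <= (C / N%:R ^+ 3)%:E)%E.
    move=> kd sn len1 len2.
    have n0 : (0 < n)%N by apply: leq_trans sn.
    rewrite /Wb Hn1 ?ns//; last 2 first.
    - by apply: leq_trans len2 _; apply: double_block_le => //; exact: ltW.
    - exact: measurableC.
    apply: le_trans (HC k len kd) _; rewrite lee_fin -e3 ler_wpM2l// ler_expR mulNr lerN2.
    have -> : 3 * ln (N%:R : R) = c * (c1 * ln N%:R) by rewrite /c1; field; rewrite gt_eqF.
    rewrite ler_pM2l//; apply: le_trans (block_len_ge _ _) _.
    by rewrite ler_nat.
  have PA n : (P (Ab N n) <= (d.+1%:R * (C + C) / N%:R ^+ 3)%:E)%E.
    rewrite /Ab; case: ifP => sn; last first.
      by rewrite measure0 lee_fin divr_ge0 ?exprn_ge0// mulr_ge0// addr_ge0.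
    apply: le_trans (BI (fun k => Wb k n (L N) `|` Wb k n (L N + L N)%N) _ _) _.
      by move=> k; exact: measurableU.
    apply: (@le_trans _ _ (\sum_(k < d.+1) (C / N%:R ^+ 3 + C / N%:R ^+ 3)%:E)%E).
      apply: lee_sum => k _; apply: le_trans (measureU2 _ (mWb _ _ _) (mWb _ _ _)) _.
      by rewrite EFinD leeD// PW// ?leq_addr// leqnn.
    by rewrite sumEFin lee_fin sumr_const card_ord -mulrDl -[leLHS]mulr_natl mulrA.
  have PB n : (P (Bb N n) <= (E / N%:R ^+ 3)%:E)%E.
    rewrite /Bb; case: ifP => n0; last by rewrite measure0 lee_fin divr_ge0 ?exprn_ge0.
    rewrite Xmu//.
    have t0 : 0 < expR (3 * ln (N%:R : R)) by exact: expR_gt0.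
    apply: le_trans (markov_ae (f := fun g : M => N1 (g : 'M[R]_d) `^ alpha) t0 (mBs N) _ _ _) _.
    - by move=> g; exact: powR_ge0.
    - exact: measurable_fun_powR.
    - apply: aeW => g /= /ltW Bg.
      have := @ge0_ler_powR _ alpha (ltW alpha0) _ _ (expR_ge0 _) (N1_ge0 _) Bg.
      rewrite -expRM (_ : b * ln N%:R * alpha = 3 * ln N%:R)//.
      by rewrite /b; field; rewrite gt_eqF.
    by rewrite EE -EFinM lee_fin -expRN e3 mulrC.
  apply: le_trans (BI (fun n => Ab N n `|` Bb N n) _ _) _.
    by move=> n; exact: measurableU.
  apply: (@le_trans _ _ (\sum_(n < N.+1) (K0 / N%:R ^+ 3)%:E)%E).
    apply: lee_sum => n _; apply: le_trans (measureU2 _ (mAb _ _) (mBb _ _)) _.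
    by rewrite /K0 mulrDl EFinD; apply: leeD; [exact: PA|exact: PB].
  rewrite sumEFin lee_fin sumr_const card_ord -[leLHS]mulr_natl.
  rewrite -(natr1 N.+1) -(natr1 N).
  have N1R : 1 <= N%:R :> R by rewrite ler1n.
  move: (N%:R : R) N0R N1R => x x0 x1.
  rewrite mulrA ler_pdivrMr ?exprn_gt0// mulrAC ler_pdivlMr ?mulr_gt0//; try lra.
  (* The constant 12 is 2 * 2 * 3: for [x >= 1] the factors [x + 1] and [x + 2] are at most [2 * x]
     and [3 * x]. *)
  rewrite (_ : (x + 1) * K0 * _ = K0 * ((x + 1) * ((x + 1) * (x + 1 + 1)))); last by ring.
  rewrite (_ : 12 * K0 * _ = K0 * ((2 * x) * ((2 * x) * (3 * x)))); last by ring.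
  by rewrite ler_wpM2l//; apply: ler_pM; [lra|rewrite mulr_ge0; lra|lra|apply: ler_pM; lra].
have := @borel_cantelli_sq _ T R P bad (12 * K0) N1' _ mbad bound.
move=> /(_ _) BC; apply: ae_imp (BC _); last by rewrite mulr_ge0.
move=> w [N0 HN0]; exists N0 => N /HN0 nbad; split.
  move=> k n kd /andP[sn nN].
  have nA : ~ Ab N n w.
    move=> h; apply: nbad; rewrite /bad -(bigcup_mkord N.+1 (fun n => Ab N n `|` Bb N n)); exists n; rewrite //=; left; exact: h.
  rewrite /Ab -/(s N) sn in nA.
  have nWb len : (len = L N \/ len = L N + L N)%N -> ~ Wb k n len w.
    move=> hl h; apply: nA; rewrite -(bigcup_mkord _ (fun k => Wb k n (L N) `|` Wb k n (L N + L N))).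
    by exists k => //=; case: hl h => ->; [left|right].
  by split; apply: contrapT => h; [apply: (nWb (L N)) => //; left|apply: (nWb (L N + L N)%N) => //; right].
move=> i /andP[i0 iN]; rewrite leNgt; apply/negP => h.
apply: nbad; rewrite /bad -(bigcup_mkord N.+1 (fun n => Ab N n `|` Bb N n)); exists i; rewrite //=; right.
by rewrite /Bb i0.
Qed.

End GoodEvent.

(** * Deterministic growth on the good event *)

Section GoodGrowth.
Context (R : realType) (d : nat) (d0 : (0 < d)%N).
Local Notation M := (borel 'M[R]_d).
Context (disp : measure_display) (T : measurableType disp) (X : nat -> T -> M) (Gam : nat -> R).
Hypothesis Xdet : forall n w, \det (X n w : 'M[R]_d) = 1.
Local Notation x w := (fun n => X n w : 'M[R]_d).

(** The bound on the inverse serves the lower estimate: the blocks are the whole product multiplied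
    by the inverse of the prefix, and determinant 1 keeps that inverse polynomially bounded. *)
Lemma prefix_bound k : exists2 K : R, 0 <= K & forall (g : 'M[R]_d) y, \det g = 1 ->
  0 <= y -> N1 g <= expR y ->
  N1 (compound k g) <= expR (K * (1 + y)) /\ N1 (compound k (invmx g)) <= expR (K * (1 + y)).
Proof.
have [c1 c10 H1] := N1_compound_le R k d; have [c2 c20 H2] := N1_invmx_le R d.
pose K : R := `|ln c1| + k%:R * `|ln c2| + k%:R + k%:R * d%:R.
have p1 : 0 <= `|ln c1| + k%:R * `|ln c2| by rewrite addr_ge0 ?mulr_ge0.
have p2 : 0 <= k%:R * d%:R :> R by rewrite mulr_ge0.
have kr : 0 <= k%:R :> R by exact: ler0n.
exists K; first by rewrite !addr_ge0// mulr_ge0.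
move=> g y g1 y0 gy.
have l1 := ler_norm (ln c1); have l2 : k%:R * ln c2 <= k%:R * `|ln c2| by rewrite ler_wpM2l// ler_norm.
have py1 : 0 <= `|ln c1| * y by rewrite mulr_ge0.
have py0 : 0 <= k%:R * `|ln c2| * y by rewrite !mulr_ge0.
have q0 : 0 <= `|ln c1| by exact: normr_ge0.
have py2 : 0 <= k%:R * d%:R * y by rewrite mulr_ge0.
have py3 : 0 <= k%:R * y by rewrite mulr_ge0.
have q1 : 0 <= k%:R * `|ln c2| by rewrite mulr_ge0.
split.
  apply: le_trans (H1 g) _; apply: (@le_trans _ _ (c1 * expR y ^+ k)).
    by rewrite ler_pM2l// lerXn2r ?nnegrE ?N1_ge0 ?expR_ge0.
  rewrite -expRM_natl -{1}(lnK (c10 : c1 \is Num.pos)) -expRD ler_expR /K.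
  lra.
apply: le_trans (H1 _) _; apply: (@le_trans _ _ (c1 * (c2 * expR y ^+ d.-1) ^+ k)).
  rewrite ler_pM2l// lerXn2r ?nnegrE ?N1_ge0 ?mulr_ge0 ?exprn_ge0 ?expR_ge0 ?(ltW c20)//.
  apply: le_trans (H2 _ g1) _; rewrite ler_pM2l// lerXn2r ?nnegrE ?N1_ge0 ?expR_ge0//.
rewrite -expRM_natl -{1}(lnK (c20 : c2 \is Num.pos)) -expRD -expRM_natl.
rewrite -{1}(lnK (c10 : c1 \is Num.pos)) -expRD ler_expR /K.
have d1 : d.-1%:R * y <= d%:R * y by rewrite ler_wpM2r// ler_nat leq_pred.
have d2 : k%:R * (d.-1%:R * y) <= k%:R * d%:R * y by rewrite -mulrA ler_wpM2l.
lra.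
Qed.

Lemma split_scale (c1 K eta : R) : 0 < c1 -> 0 <= K -> 0 < eta -> exists N0, forall N, (N0 <= N)%N ->
  exists J p, [/\ (p + J.+1 * block_len c1 N = N)%N, (start_pt R N <= p)%N,
    0 <= ln (N%:R : R) & K * (1 + p%:R * (ln N%:R + 1)) <= eta * N%:R].
Proof.
move=> c10 K0 eta0.
have [n1 H1] := scales (ltW c10) (ler01 : 0 <= 1 :> R) (ltr01 : 0 < 1 :> R).
have [n2 H2] := scales (ltW c10) K0 eta0.
exists (maxn 1 (maxn n1 n2)) => N; rewrite !geq_max => /and3P[N0 /H1 {}H1 /H2 {}H2].
have ln0 : 0 <= ln (N%:R : R) by rewrite ln_ge0// ler1n.
set L := block_len c1 N in H1 H2 *; set s := start_pt R N in H1 H2 *.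
have sL : (s + L <= N)%N.
  rewrite -(ler_nat R); rewrite !mul1r in H1; apply: le_trans H1.
  apply: (@le_trans _ _ ((s + L)%:R * (ln N%:R + 1))); last by rewrite lerDr.
  by rewrite ler_peMr// lerDr.
have L0 : (0 < L)%N by [].
pose J := ((N - s) %/ L)%N.
have JL : (J * L <= N - s)%N by exact: leq_divM.
have J1 : (0 < J)%N by rewrite divn_gt0// leq_subRL// (leq_trans _ sL)// leq_addr.
have JL' : (N - s < J.+1 * L)%N by exact: ltn_ceil.
(* Blocks are counted from the end and the remainder of the division joins the prefix, so [p] lies
   between [s] and [s + L]. *)
exists J.-1, (N - J * L)%N; rewrite prednK//.
have sN : (s <= N)%N by apply: leq_trans sL; exact: leq_addr.
have JN : (J * L <= N)%N by apply: leq_trans JL (leq_subr _ _).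
split => //; first by rewrite subnK.
  by rewrite leq_subRL// addnC -leq_subRL.
apply: le_trans H2; rewrite ler_wpM2l// lerD2l ler_wpM2r ?addr_ge0// ler_nat.
by rewrite mulSn in JL'; lia.
Qed.

Lemma ln_le_of (y z : R) : 0 < y -> y <= expR z -> ln y <= z.
Proof. by move=> y0 yz; rewrite -[leRHS]expRK ler_ln ?posrE ?expR_gt0. Qed.

Lemma prefix_le e c1 b N w p J L : 0 <= b -> 0 <= ln (N%:R : R) -> (p + J * L = N)%N ->
  good X Gam e c1 b N w ->
  N1 (lprod (x w) p) <= expR (ln d%:R + p%:R * (b * ln N%:R)).
Proof.
move=> b0 ln0 pN [_ HB].
have B1 : 1 <= expR (b * ln (N%:R : R)) by rewrite -[leLHS]expR0 ler_expR mulr_ge0.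
apply: le_trans (N1_lprod_le (x := x w) (n := p) B1 _) _.
  by move=> i /andP[i0 ip]; apply: HB; rewrite i0 (leq_trans ip)// -pN leq_addr.
by rewrite expRD lnK ?posrE ?ltr0n// expRM_natl.
Qed.

Lemma error_le (A K b p D l : R) : 0 <= A -> 0 <= K -> 0 <= b -> 0 <= p -> 0 <= D -> 0 <= l ->
  A * p + K * (1 + (D + p * (b * l))) <= (A + K * (1 + D) + K * b) * (1 + p * (l + 1)).
Proof.
move=> A0 K0 b0 p0 D0 l0.
have h1 : 0 <= p * l by rewrite mulr_ge0.
have h2 : 0 <= K * (1 + D) by rewrite mulr_ge0// addr_ge0.
have h3 : 0 <= K * b by rewrite mulr_ge0.
have -> : (A + K * (1 + D) + K * b) * (1 + p * (l + 1)) =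
  A * p + K * (1 + (D + p * (b * l))) + A * (1 + p * l) + K * (1 + D) * (p * l + p) + K * b * (1 + p) by ring.
by rewrite -2!addrA lerDl; do !(rewrite ?addr_ge0 ?mulr_ge0).
Qed.

(** One [e] comes from the tolerance of the blocks, the other pays for the prefix. *)
Lemma good_upper k e c1 b : (k <= d)%N -> 0 < e -> 0 < c1 -> 0 <= b ->
  exists N0, forall N w, (N0 <= N)%N -> good X Gam e c1 b N w ->
  ln (N1 (compound k (lprod (x w) N))) <= (Gam k + 2 * e) * N%:R.
Proof.
move=> kd e0 c10 b0; have [K K0 HK] := prefix_bound k.
pose A := `|Gam k + e|; pose D : R := ln d%:R.
have D0 : 0 <= D by rewrite ln_ge0// ler1n.
have A0 : 0 <= A by exact: normr_ge0.
have K'0 : 0 <= A + K * (1 + D) + K * b by do !(rewrite ?addr_ge0 ?mulr_ge0).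
have [N0 HN] := split_scale c10 K'0 e0; exists N0 => N w /HN [J [p [pN sp ln0 Hs]]] gd.
have Q1 : \det (lprod (x w) p) = 1 by apply: det_lprod => i _.
have y0 : 0 <= D + p%:R * (b * ln (N%:R : R)) by rewrite addr_ge0 ?mulr_ge0// mulr_ge0.
have [QU _] := HK _ _ Q1 y0 (prefix_le b0 ln0 pN gd).
set L := block_len c1 N in pN.
have HU j : (j < J.+1)%N -> N1 (compound k (wdw (x w) (p + j * L) L)) <= expR ((Gam k + e) * L%:R).
  move=> jJ; have [/(_ k (p + j * L)%N kd)[]] := gd; last by move=> /andP[].
  rewrite (leq_trans sp (leq_addr _ _))/= -{1}pN leq_add2l leq_mul2r ltnW ?orbT//.
have ch := chain_upper (expR_ge0 _) HU; rewrite pN in ch.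
apply: ln_le_of; first by apply: compound_N1_gt0 => //; apply: det_lprod => i _.
apply: le_trans ch _; rewrite -expRM_natl.
apply: le_trans (ler_wpM2l (expR_ge0 _) QU) _; rewrite -expRD ler_expR.
have NE : N%:R = p%:R + J.+1%:R * L%:R :> R by rewrite -natrM -natrD pN.
have := error_le (normr_ge0 (Gam k + e)) K0 b0 (ler0n R p) D0 ln0.
have : - (Gam k + e) * p%:R <= `|Gam k + e| * p%:R.
  by rewrite ler_wpM2r// -normrN ler_norm.
have -> : J.+1%:R * ((Gam k + e) * L%:R) = (Gam k + e) * N%:R - (Gam k + e) * p%:R.
  by rewrite NE; ring.
rewrite -/A; move: Hs; set Err := _ * (1 + _ * (_ + 1)); set Y := K * (1 + _).
have -> : (Gam k + 2 * e) * N%:R = (Gam k + e) * N%:R + e * N%:R by ring.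
rewrite mulNr; lra.
Qed.

(** For partial sums [Gam] the gap condition says that the two exponents around degree [k] differ by
    at least [10 * e]. The minors of a block in degree [k] are bounded through its norms in degrees
    [k.-1] and [k.+1], which the good event also controls. *)
Lemma good_lower k e c1 b : (0 < k < d)%N -> 0 < e -> 0 < c1 -> 0 <= b ->
  Gam k.-1 + Gam k.+1 + 10 * e <= 2 * Gam k ->
  exists N0, forall N w, (N0 <= N)%N -> good X Gam e c1 b N w ->
  (Gam k - 5 * e) * N%:R <= ln (N1 (compound k (lprod (x w) N))).
Proof.
move=> /andP[k0 kd] e0 c10 b0 gap; have [K K0 HK] := prefix_bound k.
pose A := `|Gam k - 4 * e|; pose D : R := ln d%:R.
have D0 : 0 <= D by rewrite ln_ge0// ler1n.
have A0 : 0 <= A by exact: normr_ge0.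
have K'0 : 0 <= A + K * (1 + D) + K * b by do !(rewrite ?addr_ge0 ?mulr_ge0).
have [N0 HN] := split_scale c10 K'0 e0.
have k0d : (0 < k < d)%N by rewrite k0.
have [C C0 HC] := m2_compound_le R k0d.
have [n1 Hn1] := expR_dominates (1 + Num.sqrt C) e0.
exists (maxn N0 (Num.truncn (expR (n1%:R / c1))).+1) => N w.
rewrite geq_max => /andP[/HN [J [p [pN sp ln0 Hs]]] NL] gd.
have Q1 : \det (lprod (x w) p) = 1 by apply: det_lprod => i _.
have y0 : 0 <= D + p%:R * (b * ln (N%:R : R)) by rewrite addr_ge0 ?mulr_ge0// mulr_ge0.
have [_ QU] := HK _ _ Q1 y0 (prefix_le b0 ln0 pN gd).
have Lbig : (n1 <= block_len c1 N)%N.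
  rewrite -(ler_nat R); apply: le_trans (block_len_ge _ _).
  rewrite -ler_pdivrMl// mulrC -[leLHS]expRK ler_ln ?posrE ?expR_gt0 ?ltr0n//.
    by apply/ltW/(lt_le_trans (truncnS_gt _)); rewrite ler_nat.
  by apply: leq_trans NL.
have eL := Hn1 _ Lbig; set L := block_len c1 N in pN eL.
have rng k' j : (k' <= d)%N -> (j <= J)%N ->
    @crange R d k' (Gam k') e L (wdw (x w) (p + j * L) L) /\
    @crange R d k' (Gam k') e (L + L) (wdw (x w) (p + j * L) (L + L)).
  move=> k'd jJ; apply: gd.1 => //.
  by rewrite (leq_trans sp (leq_addr _ _))/= -{1}pN leq_add2l leq_mul2r (leq_trans jJ) ?orbT.
pose a := expR ((Gam k + e) * L%:R).
(* With this rate [rho * a] has exponent [2 * Gam k - 3 * e], a factor [expR (e * L)] below the pair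
   norm, which absorbs the constants. The error has exponent [Gam k.-1 + Gam k.+1 + 7 * e]; bringing
   it below the same level needs a gap of 7 + 3 = 10 times [e]. *)
pose rho := expR ((Gam k - 4 * e) * L%:R).
pose m := Num.sqrt C * expR ((Gam k.-1 + Gam k.+1 + 2 * e) * L%:R).
pose bb := expR ((Gam k - e) * (L + L)%:R).
have L0 : 0 <= L%:R :> R by exact: ler0n.
have cond : rho * a + a * m / rho <= bb.
  have e1 : rho * a = expR ((2 * Gam k - 3 * e) * L%:R) by rewrite -expRD; congr expR; ring.
  have e2 : a * m / rho = Num.sqrt C * expR ((Gam k.-1 + Gam k.+1 + 7 * e) * L%:R).
    rewrite /m mulrCA -!mulrA; congr (_ * _); rewrite mulrA -expRN -!expRD; congr expR; ring.
  have e3 : bb = expR (e * L%:R) * expR ((2 * Gam k - 3 * e) * L%:R).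
    by rewrite -expRD; congr expR; rewrite natrD; ring.
  rewrite e1 e2 e3; apply: (@le_trans _ _ ((1 + Num.sqrt C) * expR ((2 * Gam k - 3 * e) * L%:R))).
    rewrite [leRHS]mulrDl mul1r lerD2l ler_wpM2l ?sqrtr_ge0// ler_expR ler_wpM2r//; lra.
  by rewrite ler_wpM2r ?expR_ge0.
have B1 : rho <= N1 (compound k (wdw (x w) p L)).
  have [/andP[h _] _] := rng k 0%N (ltnW kd) isT; rewrite mul0n addn0 in h.
  by apply: le_trans h; rewrite ler_expR ler_wpM2r//; lra.
have B2 j : (j <= J)%N -> N1 (compound k (wdw (x w) (p + j * L) L)) <= a.
  by move=> jJ; have [/andP[_ h] _] := rng k j (ltnW kd) jJ.
have B3 j : (j <= J)%N -> m2 (compound k (wdw (x w) (p + j * L) L)) <= m.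
  move=> jJ; have [/andP[_ h1] _] := rng k.-1 j (leq_trans (leq_pred _) (ltnW kd)) jJ.
  have [/andP[_ h2] _] := rng k.+1 j kd jJ.
  set g := wdw _ _ _ in h1 h2 *.
  have mm : m2 (compound k g) <= Num.sqrt C * (N1 (compound k.-1 g) * N1 (compound k.+1 g)).
    rewrite -(@ler_pXn2r _ 2)// ?nnegrE ?m2_ge0 ?mulr_ge0 ?sqrtr_ge0 ?N1_ge0//.
    apply: le_trans (HC g) _; rewrite exprMn sqr_sqrtr ?(ltW C0)// ler_wpM2l ?(ltW C0)//.
    rewrite exprMn; apply: ler_pM; rewrite ?gram_prod_ge0//; apply: gram_prod_le_compound => //.
    by rewrite (leq_trans (leq_pred _))// ltnW.
  apply: le_trans mm _; rewrite /m ler_wpM2l ?sqrtr_ge0//.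
  apply: le_trans (ler_pM (N1_ge0 _) (N1_ge0 _) h1 h2) _.
  by rewrite -expRD ler_expR -mulrDl ler_wpM2r//; lra.
have B4 j : (j < J)%N -> bb <= N1 (compound k (wdw (x w) (p + j * L) (L + L))).
  by move=> jJ; have [_ /andP[h _]] := rng k j (ltnW kd) (ltnW jJ).
have low := chain_lower (expR_gt0 _ : 0 < rho) B1 B2 B3 B4 cond.
have P1 : \det (lprod (x w) N) = 1 by apply: det_lprod => i _.
have uQ : lprod (x w) p \in unitmx by rewrite unitmxE Q1 unitr1.
have fact : compound k (wdw (x w) p (J.+1 * L)) =
    compound k (lprod (x w) N) *m compound k (invmx (lprod (x w) p)).
  by rewrite -compound_mul -{1}pN lprod_split mulmxK.
rewrite fact in low.
have pos := compound_N1_gt0 (ltnW kd) P1.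
have low2 := le_trans low (le_trans (N1M _ _) (ler_wpM2l (ltW pos) QU)).
rewrite -{1}(lnK (pos : _ \is Num.pos)) -expRD -expRM_natl ler_expR in low2.
have NE : N%:R = p%:R + J.+1%:R * L%:R :> R by rewrite -natrM -natrD pN.
have := error_le (normr_ge0 (Gam k - 4 * e)) K0 b0 (ler0n R p) D0 ln0.
have : (Gam k - 4 * e) * p%:R <= `|Gam k - 4 * e| * p%:R.
  by rewrite ler_wpM2r// ler_norm.
have E1 : J.+1%:R * ((Gam k - 4 * e) * L%:R) = (Gam k - 4 * e) * N%:R - (Gam k - 4 * e) * p%:R.
  by rewrite NE; ring.
rewrite E1 in low2; move: low2.
rewrite -/A; move: Hs; set Err := _ * (1 + _ * (_ + 1)); set Y := K * (1 + _).
have -> : (Gam k - 5 * e) * N%:R = (Gam k - 4 * e) * N%:R - e * N%:R by ring.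
lra.
Qed.

End GoodGrowth.

(** * From exterior powers to the individual exponents *)

Definition psum (R : realType) d (f : 'I_d -> R) k : R := \sum_(i < d | (i < k)%N) f i.

Lemma psum0 (R : realType) d (f : 'I_d -> R) : psum f 0 = 0.
Proof. by rewrite /psum big_pred0. Qed.

Lemma psumS (R : realType) d (f : 'I_d -> R) (a : 'I_d) : psum f a.+1 = psum f a + f a.
Proof.
rewrite /psum (bigD1 a)//= addrC; congr (_ + _); apply: eq_bigl => i.
by rewrite ltnS ltn_neqAle andbC.
Qed.

Lemma psumZ (R : realType) d c (f : 'I_d -> R) k : psum (fun i => c * f i) k = c * psum f k.
Proof. by rewrite /psum mulr_sumr. Qed.

Lemma cvg_psum (R : realType) d (f : nat -> 'I_d -> R) (l : 'I_d -> R) k :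
  (forall i, f N i @[N --> \oo] --> l i) -> psum (f N) k @[N --> \oo] --> psum l k.
Proof.
move=> H; rewrite /psum; elim: (index_enum _) => [|i s IH].
  by under eq_cvg do rewrite big_nil; rewrite big_nil; exact: cvg_cst.
under eq_cvg do rewrite big_cons; rewrite big_cons; case: ifP => // _.
exact: (cvgD (H i) IH).
Qed.

Lemma compound_singular (R : realType) d k : (k <= d)%N -> exists2 C : R, 0 <= C &
  forall g : 'M[R]_d, \det g = 1 ->
  psum (fun i => ln (singular_value g i)) k <= ln (N1 (compound k g)) <=
  psum (fun i => ln (singular_value g i)) k + C.
Proof.
move=> kd.
have [C C0 HC] : exists2 C : R, 1 <= C & forall g : 'M[R]_d, N1 (compound k g) ^+ 2 <= C * gram_prod g k.
  (* Degree 0 is separate, because the upper comparison with [gram_prod] assumes a positive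
     degree. *)
  have [k0|k0] := posnP k.
    subst k; have [c c0 H] := N1_compound_le R 0 d; exists (1 + c ^+ 2); first by rewrite lerDl sqr_ge0.
    move=> g; rewrite /gram_prod big_ord0 mulr1; apply: (@le_trans _ _ (c ^+ 2)); last by rewrite lerDr.
    have := H g; rewrite expr0 mulr1 => h.
    by apply: lerXn2r; rewrite ?nnegrE ?N1_ge0 ?(ltW c0).
  set c : R := (#|{: cidx k d}| * #|{: cidx k d}|)%:R * (1 + (d ^ k)%:R).
  have c0 : 0 <= c by rewrite mulr_ge0// addr_ge0.
  exists (1 + c); first by rewrite lerDl.
  move=> g; apply: (@le_trans _ _ (c * gram_prod g k)).
    by apply: compound_le_gram_prod; rewrite k0.
  by rewrite ler_wpM2r ?gram_prod_ge0// lerDr.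
exists (ln C / 2); first by rewrite divr_ge0// ln_ge0.
move=> g g1; have pos := compound_N1_gt0 kd g1.
have gp := gram_prod_gt0 g1 kd.
have E2 : ln (N1 (compound k g) ^+ 2) = 2 * ln (N1 (compound k g)) by rewrite lnXn// mulr_natl.
have h1 : ln (gram_prod g k) <= ln (N1 (compound k g) ^+ 2).
  by rewrite ler_ln ?posrE ?exprn_gt0//; exact: gram_prod_le_compound.
have Cp : 0 < C by exact: lt_le_trans ltr01 C0.
have h2 : ln (N1 (compound k g) ^+ 2) <= ln (C * gram_prod g k).
  by rewrite ler_ln ?posrE ?exprn_gt0 ?mulr_gt0// HC.
have h3 : ln (C * gram_prod g k) = ln C + ln (gram_prod g k) by rewrite lnM ?posrE.
rewrite h3 in h2.
have LG : ln (gram_prod g k) = 2 * psum (fun i => ln (singular_value g i)) k.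
  exact: ln_gram_prod.
rewrite LG E2 in h1 h2.
by apply/andP; split; lra.
Qed.

Lemma psum_singular_full (R : realType) d (g : 'M[R]_d) : \det g = 1 ->
  psum (fun i => ln (singular_value g i)) d = 0.
Proof.
move=> g1; have := ln_gram_prod g1 (leqnn d).
rewrite gram_prod_det g1 expr1n ln1 => /esym/eqP; rewrite mulf_eq0 pnatr_eq0/= => /eqP.
exact.
Qed.

(** Let [b] be the last index with the same exponent as [i]. The partial sums are bounded below at
    [b.+1] and above at [b], so [x b] is at least [gamma b - 2 * eta], and monotonicity carries this
    back to [i]. The upper bound uses the first index of the plateau in the same way. *)
Lemma sandwich (R : realType) d (gamma x : 'I_d -> R) (eta : R) :
  (forall i j : 'I_d, (i <= j)%N -> gamma j <= gamma i) ->
  (forall i j : 'I_d, (i <= j)%N -> x j <= x i) ->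
  (forall k, (k <= d)%N -> psum x k <= psum gamma k + eta) ->
  (forall k, k = 0%N \/ k = d \/ (exists i j : 'I_d, [/\ i.+1 = k, j = k :> nat & gamma j < gamma i]) ->
     psum gamma k - eta <= psum x k) ->
  forall i, `|gamma i - x i| <= 2 * eta.
Proof.
move=> gn xn U L i; rewrite ler_distl andbC; apply/andP; split.
- have [b /eqP gb bmax] := @arg_maxnP _ i (fun b => gamma b == gamma i) val (eqxx _).
  have ib : (i <= b)%N by exact: (bmax i).
  have Lb : psum gamma b.+1 - eta <= psum x b.+1.
    apply: L; right; have [bd|bd] := ltnP b.+1 d; last by left; apply/eqP; rewrite eqn_leq bd ltn_ord.
    right; exists b, (Ordinal bd); split => //; rewrite lt_neqAle gn//= andbT.
    apply/eqP => E; have := bmax (Ordinal bd); rewrite E gb eqxx => /(_ isT) /=.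
    by rewrite ltnn.
  have Ub := U b (ltnW (ltn_ord b)); rewrite !psumS gb in Lb.
  have := xn _ _ ib; lra.
- have [a /eqP ga amin] := @arg_minnP _ i (fun a => gamma a == gamma i) val (eqxx _).
  have ai : (a <= i)%N by exact: (amin i).
  have La : psum gamma a - eta <= psum x a.
    apply: L; have [a0|a0] := posnP a; first by left.
    right; right.
    have ad : (a.-1 < d)%N by apply: leq_ltn_trans (leq_pred _) (ltn_ord a).
    exists (Ordinal ad), a; split => //=; first by rewrite prednK.
    rewrite lt_neqAle gn/= ?leq_pred// andbT.
    apply/eqP => E; have := amin (Ordinal ad); rewrite -E ga eqxx => /(_ isT) /=.
    by rewrite leqNgt prednK// leqnn.
  have Ua := U a.+1 (ltn_ord a); rewrite !psumS ga in Ua.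
  have := xn _ _ ai; lra.
Qed.

(** The events that [A n] holds for all [n] from [m] on increase with [m] to an event of probability
    one; continuity from below. *)
Lemma ae_eventually_half d (T : measurableType d) (R : realType) (P : probability T R)
    (A : nat -> set T) : (forall n, measurable (A n)) ->
  {ae P, forall w, exists n0, forall n, (n0 <= n)%N -> A n w} ->
  exists n0, forall n, (n0 <= n)%N -> ((2^-1)%:E <= P (A n))%E.
Proof.
move=> mA H; pose B m := \bigcap_(n in [set n | (m <= n)%N]) A n.
have mB m : measurable (B m) by apply: bigcap_measurable => //; exists m => /=.
have BA m n : (m <= n)%N -> B m `<=` A n by move=> mn w; apply.
have ndB : nondecreasing_seq B.
  by move=> m n mn; apply/subsetPset => w Bw k /= nk; apply: Bw; exact: leq_trans nk.
have mU : measurable (\bigcup_m B m) by exact: bigcup_measurable.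
have PU : P (\bigcup_m B m) = 1%E.
  have N0 : P (~` \bigcup_m B m) = 0%E.
    apply: measure_negligible; first exact: measurableC.
    apply: negligibleS H => w /= nU [n0 Hn]; apply: nU; exists n0 => // n /=; exact: Hn.
  by rewrite -[X in P X]setCK probability_setC ?N0 ?sube0//; exact: measurableC.
have cv : P \o B @ \oo --> 1%E by rewrite -PU; exact: nondecreasing_cvg_mu.
apply: contrapT => nH.
have small m : (P (B m) <= (2^-1)%:E)%E.
  rewrite leNgt; apply/negP => h; apply: nH; exists m => n mn.
  apply: le_trans (ltW h) _; apply: le_measure; rewrite ?inE//.
  exact: BA.
have : (limn (P \o B) <= (2^-1)%:E)%E.
  apply: lime_le; first by apply/cvg_ex; exists 1%E.
  exact: nearW.
rewrite (cvg_lim _ cv)// lee_fin; lra.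
Qed.

Lemma finite_eventually d (Q : nat -> nat -> Prop) :
  (forall k, (k <= d)%N -> exists N0, forall N, (N0 <= N)%N -> Q k N) ->
  exists N0, forall N, (N0 <= N)%N -> forall k, (k <= d)%N -> Q k N.
Proof.
elim: d => [|d IH] H.
  have [N0 H0] := H 0%N isT; exists N0 => N h k; rewrite leqn0 => /eqP ->; exact: H0.
have [N1 H1] := IH (fun k kd => H k (leqW kd)); have [N2 H2] := H d.+1 (leqnn _).
exists (maxn N1 N2) => N; rewrite geq_max => /andP[h1 h2] k.
by rewrite leq_eqVlt => /orP[/eqP ->|]; [exact: H2|exact: H1].
Qed.

Lemma harmonic_le (R : realType) (delta : R) : 0 < delta -> exists j, j.+1%:R^-1 <= delta.
Proof.
move=> d0; exists (Num.truncn delta^-1); rewrite -[leRHS]invrK lef_pV2 ?posrE ?invr_gt0 ?ltr0n//.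
by apply: ltW; exact: truncnS_gt.
Qed.

Lemma eventually_const_le (R : realType) (C e : R) : 0 < e ->
  exists N0, forall N, (N0 <= N)%N -> C <= e * N%:R.
Proof.
move=> e0; exists (Num.truncn (C / e)).+1 => N h; rewrite mulrC -ler_pdivrMr//.
by apply/ltW/(lt_le_trans (truncnS_gt _)); rewrite ler_nat.
Qed.

Section Limit.
Context (R : realType) (d : nat) (d0 : (0 < d)%N).
Local Notation M := (borel 'M[R]_d).
Context (disp : measure_display) (T : measurableType disp) (P : probability T R).
Variables (mu : probability M R) (alpha : R) (X : nat -> T -> M) (gamma : 'I_d -> R).
Local Notation Gam := (psum gamma).
Hypothesis mu_SL : {ae mu, forall g, \det (g : 'M[R]_d) = 1}.
Hypothesis alpha0 : 0 < alpha.
Hypothesis mu_mom : (Ex mu (fun g : M => (N1 (g : 'M[R]_d) `^ alpha)%R) < +oo)%E.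
Hypothesis Xdet : forall n w, \det (X n w : 'M[R]_d) = 1.
Hypothesis mX : forall n, (0 < n)%N -> measurable_fun [set: T] (X n).
Hypothesis mW : forall n len, measurable_fun [set: T] (window X n len : T -> M).
Hypothesis Xmu : forall n A, (0 < n)%N -> measurable A -> P (X n @^-1` A) = mu A.
Hypothesis wlaw : forall sigma : R, 0 < sigma -> exists n1, forall n len (A : set M), (n1 <= n)%N -> (0 < n)%N ->
  (len <= Num.truncn (sigma * ln n%:R))%N -> measurable A ->
  P ((window X n len : T -> M) @^-1` A) = mlaw mu len A.
Hypothesis typ : forall k, (k <= d)%N -> forall e, 0 < e -> exists n0, forall n, (n0 <= n)%N ->
  ((2^-1)%:E <= mlaw mu n (@crange R d k (Gam k) e n))%E.
Hypothesis gamma_noninc : forall i j : 'I_d, (i <= j)%N -> gamma j <= gamma i.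
Hypothesis gamma_sum : psum gamma d = 0.

Local Notation prod w N := (lprod (fun n => X n w : 'M[R]_d) N).
Local Notation lnsv w N := (fun i => ln (singular_value (prod w N) i)).

Let prod_det w N : \det (prod w N) = 1.
Proof. by apply: det_lprod => i _. Qed.

Lemma growth_bounds e : 0 < e -> {ae P, forall w, forall k, (k <= d)%N ->
  (exists N0, forall N, (N0 <= N)%N -> psum (lnsv w N) k <= (Gam k + 2 * e) * N%:R) /\
  ((0 < k < d)%N -> Gam k.-1 + Gam k.+1 + 10 * e <= 2 * Gam k ->
   exists N0, forall N, (N0 <= N)%N -> (Gam k - 6 * e) * N%:R <= psum (lnsv w N) k)}.
Proof.
move=> e0.
have [c1 c10 [b b0 H]] := eventually_good d0 mu_SL alpha0 mu_mom mX mW Xmu wlaw typ e0.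
apply: ae_imp H => w [N0 HN0] k kd; have [C C0 HC] := compound_singular R kd; split.
  have [N1 HN1] := good_upper d0 Gam Xdet kd e0 c10 b0.
  exists (maxn N0 N1) => N; rewrite geq_max => /andP[/HN0 h1 /HN1 /(_ h1)].
  by apply: le_trans; have /andP[] := HC _ (prod_det w N).
move=> k0d gap; have [N1 HN1] := good_lower d0 Xdet k0d e0 c10 b0 gap.
have [N2 HN2] := eventually_const_le C e0.
exists (maxn N0 (maxn N1 N2)) => N; rewrite !geq_max => /and3P[/HN0 h1 /HN1 /(_ h1) h2 /HN2 h3].
have /andP[_ h4] := HC _ (prod_det w N).
have -> : (Gam k - 6 * e) * N%:R = (Gam k - 5 * e) * N%:R - e * N%:R by ring.
lra.
Qed.

Lemma limit_singular : {ae P, forall w, forall i : 'I_d,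
  N%:R^-1 * ln (singular_value (prod w N) i) @[N --> \oo] --> gamma i}.
Proof.
(* The tolerances are restricted to the numbers 1/(j+1), so that a single null set serves them
   all. *)
have H : {ae P, forall w, forall j k, (k <= d)%N ->
  (exists N0, forall N, (N0 <= N)%N -> psum (lnsv w N) k <= (Gam k + 2 * j.+1%:R^-1) * N%:R) /\
  ((0 < k < d)%N -> Gam k.-1 + Gam k.+1 + 10 * j.+1%:R^-1 <= 2 * Gam k ->
   exists N0, forall N, (N0 <= N)%N -> (Gam k - 6 * j.+1%:R^-1) * N%:R <= psum (lnsv w N) k)}.
  apply: ae_forall_nat => j; apply: growth_bounds; by rewrite invr_gt0 ltr0n.
apply: ae_imp H => w H i; apply/cvgrPdist_le => eps eps0.
pose eta := eps / 2; have eta0 : 0 < eta by rewrite divr_gt0.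
pose xN N (i : 'I_d) := N%:R^-1 * ln (singular_value (prod w N) i).
pose isgap k := k = 0%N \/ k = d \/ (exists i j : 'I_d, [/\ i.+1 = k, j = k :> nat & gamma j < gamma i]).
have up k : (k <= d)%N -> exists N0, forall N, (N0 <= N)%N -> psum (xN N) k <= Gam k + eta.
  move=> kd; have [j hj] := harmonic_le (divr_gt0 eta0 (ltr0n R 2)).
  have [[N0 HN] _] := H j k kd; exists (maxn 1 N0) => N; rewrite geq_max => /andP[Np /HN h].
  rewrite /xN psumZ ler_pdivrMl ?ltr0n// mulrC; apply: le_trans h _.
  by rewrite ler_wpM2r// lerD2l; rewrite ler_pdivlMr// in hj; rewrite mulrC.
have lo k : (k <= d)%N -> exists N0, forall N, (N0 <= N)%N -> isgap k -> Gam k - eta <= psum (xN N) k.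
  move=> kd.
  have [g|ng] := pselect (exists i j : 'I_d, [/\ i.+1 = k, j = k :> nat & gamma j < gamma i]); last first.
    exists 0%N => N _ [->|[->|//]].
      by rewrite !psum0 sub0r oppr_le0 ltW.
    by rewrite gamma_sum /xN psumZ psum_singular_full// mulr0 sub0r oppr_le0 ltW.
  have [a [b [ak bk ab]]] := g.
  (* The lower growth bound loses six times the tolerance and requires a gap of ten times the
     tolerance. *)
  have dab : 0 < Num.min (eta / 6) ((gamma a - gamma b) / 10).
    by rewrite lt_min !divr_gt0// subr_gt0.
  have [j] := harmonic_le dab; rewrite le_min => /andP[hj1 hj2].
  have k0d : (0 < k < d)%N by rewrite -{1}ak -bk ltn_ord.
  have gapk : Gam k.-1 + Gam k.+1 + 10 * j.+1%:R^-1 <= 2 * Gam k.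
    have -> : Gam k.+1 = Gam k + gamma b by rewrite -bk psumS.
    have -> : Gam k.-1 = Gam k - gamma a by rewrite -ak psumS addrK.
    by move: hj2; move: (_^-1) => ej hj2; lra.
  have [_ /(_ k0d gapk)[N0 HN]] := H j k kd.
  exists (maxn 1 N0) => N; rewrite geq_max => /andP[Np /HN h] _.
  rewrite /xN psumZ ler_pdivlMl ?ltr0n// mulrC; apply: le_trans h.
  by rewrite ler_wpM2r// lerD2l lerN2; move: hj1; move: (_^-1) => ej hj1; lra.
have [N1 H1] := finite_eventually up; have [N2 H2] := finite_eventually lo.
exists (maxn N1 N2) => // N /=; rewrite geq_max => /andP[h1 h2].
have -> : eps = 2 * eta by rewrite /eta; field.
apply: (@sandwich R d gamma (xN N) eta) => //.
- move=> i1 i2 i12; rewrite /xN ler_wpM2l ?invr_ge0// ler_ln ?posrE ?singular_value_gt0//.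
  exact: singular_value_noninc.
- by move=> k kd; exact: H1.
- move=> k gk; apply: (H2 N h2 k) => //.
  by case: gk => [->//|[->//|[_ [b [_ <- _]]]]]; exact: ltnW.
Qed.

Lemma limit_opnorm (w : T) (g0 : R) :
  N%:R^-1 * ln (singular_value (prod w N) (Ordinal d0)) @[N --> \oo] --> g0 ->
  N%:R^-1 * ln (opnorm (prod w N)) @[N --> \oo] --> g0.
Proof.
move=> /cvgrPdist_le H; apply/cvgrPdist_le => eps eps0.
have e20 : 0 < eps / 2 by rewrite divr_gt0.
pose D : R := d%:R * (d * d)%:R.
have D1 : 1 <= D by rewrite /D -natrM ler1n !muln_gt0 d0.
have D0 : 0 < D by exact: lt_le_trans ltr01 D1.
have [N1 _ H1] := H _ e20; have [N2 H2] := eventually_const_le (ln D) e20.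
exists (maxn 1 (maxn N1 N2)) => // N /=; rewrite !geq_max => /and3P[Np n1 /H2 {}H2].
have {}H1 := H1 N n1; set s := singular_value _ _ in H1; set o := opnorm _.
have s0 : 0 < s by exact: singular_value_gt0.
have h1 : s <= D * o.
  apply: le_trans (singular_value0_le _ d0) _; rewrite -/o /D -mulrA ler_peMl ?ler1n//.
  by rewrite mulr_ge0// (le_trans (normr_ge0 (prod w N (Ordinal d0) (Ordinal d0))))// entry_le_opnorm.
have h2 : o <= D * s by exact: singular_value0_ge.
have o0 : 0 < o by rewrite -(pmulr_rgt0 _ D0) (lt_le_trans s0).
have l1 : ln s <= ln D + ln o.
  rewrite (_ : ln D + ln o = ln (D * o)); last by rewrite lnM ?posrE.
  by rewrite ler_ln ?posrE// mulr_gt0.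
have l2 : ln o <= ln D + ln s.
  rewrite (_ : ln D + ln s = ln (D * s)); last by rewrite lnM ?posrE.
  by rewrite ler_ln ?posrE// mulr_gt0.
have N0 : 0 < N%:R^-1 :> R by rewrite invr_gt0 ltr0n.
have dist : `|N%:R^-1 * ln s - N%:R^-1 * ln o| <= eps / 2.
  rewrite -mulrBr normrM gtr0_norm// ler_pdivrMl ?ltr0n// mulrC.
  by apply: le_trans H2; rewrite ler_norml; apply/andP; split; lra.
rewrite (splitr eps); apply: le_trans (lerD H1 dist).
have -> : g0 - N%:R^-1 * ln o = (g0 - N%:R^-1 * ln s) + (N%:R^-1 * ln s - N%:R^-1 * ln o) by ring.
exact: ler_normD.
Qed.

End Limit.

(** Almost sure convergence gives the weak probability bound, and the logarithm of the norm of an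
    exterior power differs from the sum of the top logarithms only by a constant. The window
    starting at 0 is the whole product, whose law is [mlaw]. *)
Lemma iid_typical (R : realType) (d : nat) (disp : measure_display) (T : measurableType disp)
    (P : probability T R) (Y : nat -> {RV P >-> borel 'M[R]_d}) (mu : probability (borel 'M[R]_d) R)
    (gamma : 'I_d -> R) :
  independent_family (fun n => Y n.+1) ->
  (forall n A, (0 < n)%N -> measurable A -> P (Y n @^-1` A) = mu A) ->
  {ae P, forall w, forall n, (0 < n)%N -> \det (Y n w : 'M[R]_d) = 1} ->
  {ae P, forall w, forall i, N%:R^-1 * ln (singular_value (lprod (fun n => Y n w : 'M[R]_d) N) i)
     @[N --> \oo] --> gamma i} ->
  forall k, (k <= d)%N -> forall e, 0 < e -> exists n0, forall n, (n0 <= n)%N ->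
  ((2^-1)%:E <= mlaw mu n (@crange R d k (psum gamma k) e n))%E.
Proof.
move=> Yind Ymu Ydet Hg k kd e e0.
pose J n := [set n.-1] : set nat.
have mYs n : (0 < n)%N -> measurable_fun [set: g_sigma_algebraType (cylinders (fun n => Y n.+1) (J n))]
    (Y n : g_sigma_algebraType (cylinders (fun n => Y n.+1) (J n)) -> borel 'M[R]_d).
  move=> n0; have := @measurable_coord _ _ _ _ _ P (fun n => Y n.+1) (J n) n.-1 erefl.
  by rewrite prednK.
have YL N (A : set (borel 'M[R]_d)) : measurable A ->
    P ((window (fun n => Y n : T -> borel 'M[R]_d) 0 N : T -> borel 'M[R]_d) @^-1` A) = mlaw mu N A.
  move=> mA; apply: (@window_law _ _ _ _ R P (fun n => Y n.+1) Yind d mu (fun n => Y n : T -> borel 'M[R]_d) J) => //.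
  move=> m m' /andP[m0 mm] _ j -> /= E.
  have m'0 : (0 < m')%N by exact: ltn_trans mm.
  by move: mm; rewrite -(prednK m0) E prednK// ltnn.
have mWY N : measurable_fun [set: T]
    (window (fun n => Y n : T -> borel 'M[R]_d) 0 N : T -> borel 'M[R]_d).
  exact (measurable_window_T mYs 0%N N).
have mcr n : measurable (@crange R d k (psum gamma k) e n) by exact: measurable_crange.
suff [n0 H] : exists n0, forall n, (n0 <= n)%N -> ((2^-1)%:E <= P
   ((window (fun n => Y n : T -> borel 'M[R]_d) 0 n : T -> borel 'M[R]_d) @^-1` (@crange R d k (psum gamma k) e n)))%E.
  by exists n0 => n /H; rewrite YL.
apply: ae_eventually_half.
  by move=> n; rewrite -[X in measurable X]setTI; exact: mWY.
apply: ae_imp2 Ydet Hg => w dw gw.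
have [C C0 HC] := compound_singular R kd.
have e20 : 0 < e / 2 by rewrite divr_gt0.
have /cvgrPdist_le /(_ _ e20) [n1 _ H1] := @cvg_psum _ _ _ _ k gw.
have [N2 H2] := eventually_const_le C e20.
exists (maxn 1 (maxn n1 N2)) => N; rewrite !geq_max => /and3P[Np Nn1 /H2 {}H2].
have {}H1 := H1 N Nn1; rewrite /= psumZ in H1.
set g := lprod (fun n => Y n w : 'M[R]_d) N in H1.
have g1 : \det g = 1 by apply: det_lprod => i i0; exact: dw.
have /andP[h1 h2] := HC g g1; have pos := compound_N1_gt0 kd g1.
set S := psum (fun i => ln (singular_value g i)) k in H1 h1 h2.
have N0 : 0 < N%:R :> R by rewrite ltr0n.
have H3 : `|psum gamma k * N%:R - S| <= e / 2 * N%:R.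
  have -> : psum gamma k * N%:R - S = (psum gamma k - N%:R^-1 * S) * N%:R.
    by field; rewrite gt_eqF.
  by rewrite normrM (gtr0_norm N0) ler_pM2r.
move: H3; rewrite ler_norml => /andP[h3 h4].
rewrite /crange /= -[window _ _ _ _]/g -(lnK (pos : N1 (compound k g) \is Num.pos)) !ler_expR.
by apply/andP; split; lra.
Qed.

Theorem theorem2p2 (R : realType) (d l : nat) (hd : (0 < d)%N) (hl : (1 < l)%N)
  (disp : measure_display) (T : measurableType disp) (P : probability T R)
  (xi : nat -> {RV P >-> R})
  (xi_iid : iid (fun n => xi n.+1))
  (F : 'rV[R]_l -> 'M[R]_d)
  (F_meas : measurable_fun [set: borel 'rV[R]_l] (F : borel 'rV[R]_l -> borel 'M[R]_d))
  (F_SL : forall x, \det (F x) = 1)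
  (q : 'I_l -> nat -> nat)
  (q_incr : forall (i : 'I_l) (m n : nat), (0 < m)%N -> (m < n)%N -> (q i m < q i n)%N)
  (q_lt : forall (i j : 'I_l) (n : nat), (i < j)%N -> (0 < n)%N -> (q i n < q j n)%N)
  (q_ge1 : (1 <= q (Ordinal (ltnW hl)) 1)%N) :
  let X := nonconventional F q (fun n => xi n : T -> R) in
  let mu := pushforward P (X 1%N : T -> borel 'M[R]_d) in
  strongly_irreducible (msupport mu) ->
  (exists2 alpha : R, 0 < alpha &
     ('E_P[fun w => (opnorm (X 1%N w) `^ alpha)%R] < +oo)%E) ->
  (forall sigma : R, 0 < sigma ->
     exists n0 : nat, forall n : nat, (0 < n)%N -> (n0 <= n)%N ->
       forall i j : 'I_l, j = i.+1 :> nat ->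
         (q i (n + Num.truncn (sigma * ln n%:R)) <= q j n)%N) ->
  forall (disp' : measure_display) (T' : measurableType disp')
    (P' : probability T' R) (Y : nat -> {RV P' >-> borel 'M[R]_d}),
  iid (fun n => Y n.+1) ->
  (forall A : set (borel 'M[R]_d), measurable A -> distribution P' (Y 1%N) A = mu A) ->
  forall gamma : 'I_d -> R,
  (forall i : 'I_d,
     {ae P', forall w,
       N%:R^-1 * ln (singular_value (lprod (fun n => Y n w : 'M[R]_d) N) i)
         @[N --> \oo] --> gamma i}) ->
  {ae P, forall w, forall i : 'I_d,
     N%:R^-1 * ln (singular_value (lprod (fun n => X n w) N) i)
       @[N --> \oo] --> gamma i}
  /\
  {ae P, forall w,
     N%:R^-1 * ln (opnorm (lprod (fun n => X n w) N))
       @[N --> \oo] --> gamma (Ordinal hd)}.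
Proof.
move=> X mu _ [alpha alpha0 opfin] spread disp' T' P' Y [Yind Yid] Ymu gamma Hg.
have mXs n : (0 < n)%N -> measurable_fun [set: g_sigma_algebraType (cylinders (fun n => xi n.+1) (past q n))]
    (X n : g_sigma_algebraType (cylinders (fun n => xi n.+1) (past q n)) -> borel 'M[R]_d).
  exact: measurable_nonconventional.
have mX n (n0 : (0 < n)%N) : measurable_fun [set: T] (X n : T -> borel 'M[R]_d).
  exact: (measurable_sub_T (mXs n n0)).
pose muP : probability (borel 'M[R]_d) R := distribution P (mfun_of (mX 1%N isT)).
have Xmu n (A : set (borel 'M[R]_d)) : (0 < n)%N -> measurable A ->
    P ((X n : T -> borel 'M[R]_d) @^-1` A) = muP A.
  move=> n0 mA; exact: (nonconventional_law xi_iid F_meas q_incr q_lt q_ge1 n0 (isT : (0 < 1)%N) mA).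
have Xdet n w : \det (X n w) = 1 by exact: F_SL.
pose SL := (fun g : borel 'M[R]_d => \det (g : 'M[R]_d)) @^-1` [set 1].
have mSL : measurable SL.
  by rewrite -[X in measurable X]setTI; apply: measurable_det => //; exact: measurable_set1.
have muSL0 : muP (~` SL) = 0%E.
  rewrite -(Xmu 1%N)//; last exact: measurableC.
  by rewrite (_ : _ @^-1` _ = set0) ?measure0//; apply/seteqP; split => // w /=; apply; exact: Xdet.
have mu_SL : {ae muP, forall g, \det (g : 'M[R]_d) = 1}.
  by exists (~` SL); split => //; exact: measurableC.
have mu_mom : (Ex muP (fun g : borel 'M[R]_d => (N1 (g : 'M[R]_d) `^ alpha)%R) < +oo)%E.
  have mN : measurable_fun [set: borel 'M[R]_d] (fun g : borel 'M[R]_d => N1 (g : 'M[R]_d) `^ alpha).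
    by apply: measurable_fun_powR; apply: measurable_N1; exact: measurable_id.
  rewrite Ex_distribution//; last by move=> g; exact: powR_ge0.
  pose c : R := (d * d)%:R `^ alpha.
  have dd0 : 0 < (d * d)%:R :> R by rewrite ltr0n muln_gt0 hd.
  have c0 : 0 < c by exact: powR_gt0.
  have mNX := measurableT_comp mN (mX 1%N isT).
  have op0 w : 0 <= opnorm (X 1%N w).
    apply: le_trans (normr_ge0 (X 1%N w (Ordinal hd) (Ordinal hd))) _; exact: entry_le_opnorm.
  have : (Ex P (fun w => (c^-1 * N1 (X 1%N w) `^ alpha)%R) < +oo)%E.
    move: opfin; rewrite unlock; apply: le_lt_trans.
    apply: (@Ex_le_nonmeas _ _ R P _ (fun w => opnorm (X 1%N w) `^ alpha)) => w.
    rewrite mulr_ge0 ?invr_ge0 ?powR_ge0//= ler_pdivrMl// -powRM// ?op0//.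
    apply: ge0_ler_powR; rewrite ?(ltW alpha0) ?nnegrE ?N1_ge0 ?mulr_ge0 ?op0//.
    exact: N1_le_opnorm.
  rewrite ExZ ?invr_ge0 ?(ltW c0)//; last by move=> w; exact: powR_ge0.
  have : (0 <= Ex P (fun w => (N1 (X 1%N w) `^ alpha)%R))%E by apply: Ex_ge0 => w; exact: powR_ge0.
  rewrite /=; case: (Ex P _) => [r _ _|_|//]; first exact: ltry.
  by rewrite gt0_muley ?ltxx// lte_fin invr_gt0.
have mW n len : measurable_fun [set: T] (window X n len : T -> borel 'M[R]_d).
  exact (measurable_window_T mXs n len).
have wlaw (sigma : R) : 0 < sigma -> exists n1, forall n len (A : set (borel 'M[R]_d)),
    (n1 <= n)%N -> (0 < n)%N -> (len <= Num.truncn (sigma * ln n%:R))%N -> measurable A ->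
    P ((window X n len : T -> borel 'M[R]_d) @^-1` A) = mlaw muP len A.
  move=> s0; have [n1 H] := spread sigma s0; exists n1 => n len A n1n n0 ln mA.
  apply: (window_law xi_iid.1 mXs) => // m m' /andP[nm mm] ml j.
  have m0 : (0 < m)%N by exact: ltn_trans nm.
  (* The spreading is used at the earlier index [m] of the pair, not at the start [n] of the window:
     as [n < m], its logarithmic range is at least as long and still covers [m']. *)
  apply: (past_disjoint q_incr q_lt q_ge1 (s := Num.truncn (sigma * exp.ln m%:R))).
  - by rewrite m0.
  - have h : (Num.truncn (sigma * exp.ln n%:R) <= Num.truncn (sigma * exp.ln m%:R))%N.
      by apply: le_truncn; rewrite ler_pM2l// ler_ln ?posrE ?ltr0n// ler_nat ltnW.
    by apply: leq_ltn_trans ml _; rewrite -addSn leq_add// (leq_trans ln).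
  - by move=> i i' ii'; apply: H => //; apply: leq_trans n1n (ltnW nm).
have YmuP n (A : set (borel 'M[R]_d)) : (0 < n)%N -> measurable A -> P' (Y n @^-1` A) = muP A.
  move=> n0 mA; have := Yid n.-1 0%N A mA; rewrite prednK// => E.
  by rewrite -[LHS]/(distribution P' (Y n) A) E Ymu.
have Ydet : {ae P', forall w, forall n, (0 < n)%N -> \det (Y n w : 'M[R]_d) = 1}.
  apply: ae_forall_nat => n; have [->|n0] := posnP n; first by apply: aeW.
  exists (Y n @^-1` (~` SL)); split.
  - by rewrite -[X in measurable X]setTI; apply: measurable_funP => //; exact: measurableC.
  - by rewrite YmuP//; exact: measurableC.
  - by move=> w /= h h'; apply: h => _.
have {}Hg : {ae P', forall w, forall i,
    N%:R^-1 * ln (singular_value (lprod (fun n => Y n w : 'M[R]_d) N) i) @[N --> \oo] --> gamma i}.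
  exact: ae_forall_fin.
(* One sample path with determinant 1 and convergent exponents suffices for the deterministic facts
   on [gamma]: monotonicity, and zero sum. *)
have [w0 [dw gw]] : exists w, (forall n, (0 < n)%N -> \det (Y n w : 'M[R]_d) = 1) /\
    forall i, N%:R^-1 * ln (singular_value (lprod (fun n => Y n w : 'M[R]_d) N) i) @[N --> \oo] --> gamma i.
  by apply: (@ae_exists _ _ R P'); apply: ae_imp2 Ydet Hg.
have d1 N : \det (lprod (fun n => Y n w0 : 'M[R]_d) N) = 1 by exact: det_lprod.
have gamma_noninc (i j : 'I_d) : (i <= j)%N -> gamma j <= gamma i.
  move=> ij; apply: (ler_cvg_to (gw j) (gw i)); apply: nearW => N.
  by rewrite ler_wpM2l ?invr_ge0// ler_ln ?posrE ?singular_value_gt0// singular_value_noninc.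
have gamma_sum : psum gamma d = 0.
  have := @cvg_psum _ _ _ _ d gw; under eq_cvg do rewrite psumZ psum_singular_full// mulr0.
  move=> /(cvg_unique _) => /(_ (@norm_hausdorff _ _) 0); apply; exact: cvg_cst.
have typ := iid_typical Yind YmuP Ydet Hg.
have lim := limit_singular hd mu_SL alpha0 mu_mom Xdet mX mW Xmu wlaw typ gamma_noninc gamma_sum.
split => //; apply: ae_imp lim => w /(_ (Ordinal hd)).
exact: (limit_opnorm Xdet).
Qed.
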